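(* Let $X=\{X_t,t\in[0,1]\}$ be an $\mathbb F$-adapted real-valued process satisfying the following two conditions. (H) There is $\theta>1/2$ such that $X\in C^\theta[0,1]$ almost surely. (S) There exist positive constants $\lambda,\mu,K_1,K_2$ such that for all $\varepsilon>0$, all $\Delta\in(0,1]$ and all $s\in[0,1-\Delta]$ $$\mathbf P\Big\{\sup_{s\le t\le s+\Delta}|X_t-X_s|\le \varepsilon\Big\}\le K_1\exp\{-K_2\,\varepsilon^{-\lambda}\Delta^{\mu}\}.$$ Let $\xi$ be a random variable such that $\xi=Z_1$ for some $\mathbb F$-adapted process $Z=\{Z_t,t\in[0,1]\}$ with $Z\in C^\rho[0,1]$ almost surely, where $\rho>\frac{\mu}{\lambda\theta}-1$. Then there exists an $\mathbb F$-adapted process $\psi=\{\psi_t,t\in[0,1]\}$ such that, for some $\alpha\in(1-\theta,1/2)$, $\|\psi\|_{\alpha,1}<\infty$ and $$\int_0^1\psi_s\,dX_s=\xi$$ almost surely, where the integral is the pathwise generalized Lebesgue--Stieltjes integral (with this $\alpha$).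
   Context: $(\Omega,\mathcal F,\mathbb F=(\mathcal F_t)_{t\in[0,1]},\mathbf P)$ is a stochastic basis satisfying the usual assumptions. $C^\theta[0,1]$ denotes the class of Hölder continuous functions of order $\theta$ on $[0,1]$, i.e. functions $f$ with $|f(t)-f(s)|\le C|t-s|^\theta$ for some finite $C$ (depending on $f$). Fractional derivatives: for $[a,b]\subset[0,1]$, $\alpha\in(0,1)$, $f,g:[0,1]\to\mathbb R$, $$(D_{a+}^{\alpha}f)(x)=\frac{1}{\Gamma(1-\alpha)}\Big(\frac{f(x)}{(x-a)^\alpha}+\alpha\int_a^x\frac{f(x)-f(u)}{(x-u)^{1+\alpha}}du\Big)\mathbf 1_{(a,b)}(x),$$ $$(D_{b-}^{1-\alpha}g)(x)=\frac{e^{i\pi\alpha}}{\Gamma(\alpha)}\Big(\frac{g(x)}{(b-x)^{1-\alpha}}+(1-\alpha)\int_x^b\frac{g(x)-g(u)}{(u-x)^{2-\alpha}}du\Big)\mathbf 1_{(a,b)}(x).$$ If $D_{a+}^\alpha f\in L_1[a,b]$ and $D_{b-}^{1-\alpha}g_{b-}\in L_\infty[a,b]$, where $g_{b-}(x)=g(x)-g(b)$, the generalized Lebesgue--Stieltjes integral is $$\int_a^b f(x)\,dg(x)=-e^{-i\pi\alpha}\int_a^b (D_{a+}^\alpha f)(x)\,(D_{b-}^{1-\alpha}g_{b-})(x)\,dx.$$ (For $f\in C^\beta[a,b]$, $g\in C^\gamma[a,b]$ with $\beta+\gamma>1$ it exists and equals the limit of Riemann sums.) Norm: $$\|f\|_{\alpha,[a,b]}=\int_a^b\Big(\frac{|f(s)|}{(s-a)^\alpha}+\int_a^s\frac{|f(s)-f(z)|}{(s-z)^{1+\alpha}}dz\Big)ds,\qquad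 \|f\|_{\alpha,t}=\|f\|_{\alpha,[0,t]}.$$ When $X\in C^\theta[0,1]$ and $\alpha\in(1-\theta,1/2)$, the integral $\int_0^t f(s)\,dX_s$ is well defined for every $f$ with $\|f\|_{\alpha,t}<\infty$. *)

(* Defs.v *)
From HB Require Import structures.
From mathcomp Require Export all_boot all_order all_algebra.
From mathcomp Require Export all_classical all_reals all_analysis.
From mathcomp.real_closed Require Export complex.

Set Implicit Arguments.
Unset Strict Implicit.
Unset Printing Implicit Defensive.

Import Order.TTheory GRing.Theory Num.Theory.
Import numFieldNormedType.Exports.

Local Open Scope classical_set_scope.
Local Open Scope ring_scope.
Local Open Scope complex_scope.

(** Processes and filtrations are indexed by [R]; only their values at times
    in [[0, 1]] are ever used. *)

(** Since
    [P.-negligible N] does not require [N] to be measurable, the fourth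
    condition also makes [P] complete. *)
Definition usual_conditions (R : realType) (d : measure_display)
    (T : measurableType d) (P : probability T R) (F : R -> set (set T)) : Prop :=
  [/\ forall t : R, t \in `[0, 1] ->
        sigma_algebra [set: T] (F t) /\ F t `<=` measurable,
      forall s t : R, 0 <= s -> s <= t -> t <= 1 -> F s `<=` F t,
      forall t : R, 0 <= t -> t < 1 -> F t = \bigcap_(s in `]t, 1]) F s &
      forall N : set T, P.-negligible N -> F 0 N].

Definition adapted (R : realType) (T : Type) (F : R -> set (set T))
    (X : R -> T -> R) : Prop :=
  forall t : R, t \in `[0, 1] ->
  forall B : set R, measurable B -> F t (X t @^-1` B).

Definition holder (R : realType) (theta a b : R) (f : R -> R) : Prop :=
  exists C : R, forall s t : R, s \in `[a, b] -> t \in `[a, b] ->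
    `|f t - f s| <= C * `|t - s| `^ theta.

(** Extended-real valued, so that it is [+oo] on unbounded paths. *)
Definition sup_increment (R : realType) (s Delta : R) (x : R -> R) : \bar R :=
  ereal_sup [set `|x t - x s|%:E | t in `[s, s + Delta]].

Definition Gamma (R : realType) (z : R) : R :=
  \int[@lebesgue_measure R]_(t in `]0, +oo[) (t `^ (z - 1) * expR (- t)).

Definition cexpi (R : realType) (x : R) : R[i] := cos x +i* sin x.

Definition cintegral (R : realType) (D : set R) (h : R -> R[i]) : R[i] :=
  (\int[@lebesgue_measure R]_(x in D) complex.Re (h x)) +i*
  (\int[@lebesgue_measure R]_(x in D) complex.Im (h x)).

Section FractionalDerivatives.
Context {R : realType}.
Implicit Types (alpha a b x : R) (f g : R -> R).
Notation mu := (@lebesgue_measure R).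

Definition left_kernel alpha f x : R -> R :=
  fun u => (f x - f u) / (x - u) `^ (1 + alpha).

(** [D_{a+}^alpha f] on [[a, b]]. *)
Definition left_fderiv alpha a b f x : R :=
  (Gamma (1 - alpha))^-1 *
  (f x / (x - a) `^ alpha +
   alpha * \int[mu]_(u in `]a, x[) left_kernel alpha f x u) *
  \1_(`]a, b[ : set R) x.

Definition right_kernel alpha g x : R -> R :=
  fun u => (g x - g u) / (u - x) `^ (2 - alpha).

(** [D_{b-}^(1-alpha) g] on [[a, b]]: the order of the derivative is
    [1 - alpha], not [alpha]. *)
Definition right_fderiv alpha a b g x : R[i] :=
  cexpi (pi * alpha) *
  ((Gamma alpha)^-1 *
   (g x / (b - x) `^ (1 - alpha) +
    (1 - alpha) * \int[mu]_(u in `]x, b[) right_kernel alpha g x u) *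
   \1_(`]a, b[ : set R) x)%:C.

(** [Rintegral] is total, so the existence of the fractional derivatives
    (almost everywhere) has to be required besides their integrability. *)
Definition left_fderiv_L1 alpha a b f : Prop :=
  {ae mu, forall x, x \in `]a, b[ ->
     mu.-integrable `]a, x[ (EFin \o left_kernel alpha f x)} /\
  mu.-integrable `[a, b] (EFin \o left_fderiv alpha a b f).

(** The infinity-norm is over the whole line, but [right_fderiv] vanishes
    outside [(a, b)]. *)
Definition right_fderiv_Linfty alpha a b g : Prop :=
  [/\ {ae mu, forall x, x \in `]a, b[ ->
         mu.-integrable `]x, b[ (EFin \o right_kernel alpha g x)},
      measurable_fun `[a, b] (fun x => complex.Re (right_fderiv alpha a b g x)),
      measurable_fun `[a, b] (fun x => complex.Im (right_fderiv alpha a b g x)) &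
      finite_norm mu +oo
        (fun x => Normc.normc (right_fderiv alpha a b g x))].

(** Generalized Lebesgue--Stieltjes integral of [f] with respect to [g]. *)
Definition gls_integrable alpha a b f g : Prop :=
  left_fderiv_L1 alpha a b f /\
  right_fderiv_Linfty alpha a b (fun x => g x - g b).

Definition gls_integral alpha a b f g : R[i] :=
  - cexpi (- (pi * alpha)) *
  cintegral `[a, b] (fun x =>
    (left_fderiv alpha a b f x)%:C *
    right_fderiv alpha a b (fun y => g y - g b) x).

Definition fnorm alpha a b f : \bar R :=
  (\int[mu]_(s in `[a, b])
     ((`|f s| / (s - a) `^ alpha)%:E +
      \int[mu]_(z in `[a, s]) (`|f s - f z| / (s - z) `^ (1 + alpha))%:E))%E.

(** The library integral of a nonnegative function that is not measurable is a
    lower integral, so measurability of [f] is part of finiteness of its norm. *)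
Definition fnorm_finite alpha a b f : Prop :=
  measurable_fun `[a, b] f /\ (fnorm alpha a b f < +oo)%E.

End FractionalDerivatives.

(* Main.v *)
(** Let [t_n = 1 - 2^-n]. Between [t_n] and [t_{n+1}] the strategy is constant on
    the cells of a fine uniform grid and holds [c_n (X_s - X_{t_n})] as long as
    this increment has stayed below a level [e_n] in absolute value. By summation
    by parts the gain of the block is [c_n e_n^2 / 2] up to the sum of the squared
    increments, which a fine grid makes negligible because [theta > 1/2]. Hence
    [c_n = 2 (Z_{t_n} - gain so far) / e_n^2] nearly closes the gap to [Z_{t_n}],
    provided that the level is reached; with [e_n = 2^-((n+1) M) / 2] and
    [M > mu / lambda] the small-ball estimate and Borel--Cantelli ensure this for
    all large [n], almost surely. The gap is then [O(2^-(n rho))], so the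
    strategy replicates [Z_1], and the norms of the blocks decay geometrically
    when [M] is close to [mu / lambda], as [rho > mu / (lambda theta) - 1].

    The integral of a step function reduces to that of the indicator of
    [(c, 1]], which is an inversion formula for the fractional derivative of the
    integrator: after Fubini the two parts of that derivative telescope, leaving
    the Beta integral [Gamma a * Gamma (1 - a)]. The hypotheses force
    [theta <= 1] and [mu / lambda >= theta]: otherwise a Hoelder path would not
    oscillate enough near time [0] for the small-ball estimate. *)

(* The bound on [rho] is dictated by the norm of a late block. With a level of order 2^(-nM) and a
   gap of order 2^(-n rho), the position on block n is of order 2^(n(M - rho)) on an interval of
   length 2^(-n); this asks for rho - M + 1 - a > 0. The oscillation of the position is the real
   obstacle: at the full Hoelder order [theta] the large factor [c_n] gains nothing from the small
   level. Interpolating between the sup bound 2 e_n and the bound C d^theta gives a Hoelder bound of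
   order k in (a, theta] that keeps a factor e_n^(1 - k/theta), and asks for rho - M(1 + k/theta) +
   1 + k - a > 0. Small k and a are best, as M > theta; when both tend to 1 - theta and M to
   mu/lambda, the condition becomes rho > mu/(lambda theta) - 1.

   The position also jumps at each grid point, while the norm must not depend on the mesh. A jump of
   size h^k costs h^k times h^(1-a), and m of them cost m h times h^(k-a): this stays bounded
   because k > a.

   Probability enters only through Borel-Cantelli and adaptedness; the rest concerns a single
   path. *)
From HB Require Import structures.
Require Import Defs.
From mathcomp Require Import measurable_realfun ess_sup_inf ring lra.
Set Implicit Arguments.
Unset Strict Implicit.
Unset Printing Implicit Defensive.
Import Order.TTheory GRing.Theory Num.Theory.
Import numFieldNormedType.Exports.
Local Open Scope classical_set_scope.
Local Open Scope ring_scope.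
Local Open Scope complex_scope.

(** * Power integrals and the Beta function *)

Section RealIntegrals.
Context {R : realType}.
Implicit Types (f F : R -> R) (a b c s x : R).
Notation leb := (@lebesgue_measure R).

(* The integrand may be unbounded at both ends; exhaust by compact intervals. *)
Lemma ge0_FTC_oo f F a b : a < b ->
  {in `]a, b[, forall x, 0 <= f x} ->
  {in `]a, b[, forall x, is_derive x 1 F (f x)} ->
  {in `]a, b[, continuous f} ->
  F @ a^'+ --> F a -> F @ b^'- --> F b ->
  (\int[leb]_(x in `]a, b[) (f x)%:E = (F b - F a)%:E)%E.
Proof.
move=> ab f0 dF cf Fa Fb.
(* Dividing by at least 3 keeps [e n] below half the length, so that the compact intervals are
   nondegenerate from n = 0 on. *)
pose e n : R := (b - a) / n.+3%:R.
have e0 n : 0 < e n by rewrite divr_gt0 ?subr_gt0.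
have e2 n : e n < (b - a) / 2.
  by rewrite ltr_pM2l ?subr_gt0// ltf_pV2 ?posrE// ltr_nat.
have ecvg : e n @[n --> \oo] --> 0.
  rewrite -[X in _ --> X](mulr0 (b - a)); apply: cvgMl_tmp.
  have := @cvg_harmonic R; rewrite -(cvg_shiftn 2).
  by under eq_fun do rewrite /= addn2.
pose I n : set R := `[a + e n, b - e n]%classic.
have sub n x : I n x -> x \in `]a, b[.
  rewrite /I /= !in_itv/= => /andP[x1 x2]; have := e0 n.
  by move=> ?; apply/andP; split; lra.
have UI : \bigcup_n I n = `]a, b[%classic.
  apply/seteqP; split => x [].
    by move=> n _ /sub.
  move=> /=; rewrite in_itv/= => /andP[ax xb].
  have : \forall n \near \oo, e n < Num.min (x - a) (b - x).
    by apply: (cvgr_lt 0) => //; rewrite lt_min !subr_gt0 ax.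
  move=> [N _ /(_ N (leqnn N))]/=; rewrite lt_min => /andP[h1 h2].
  by exists N => //; rewrite /I /= in_itv/=; apply/andP; split; lra.
have mf : measurable_fun `]a, b[%classic f.
  apply: open_continuous_measurable_fun => // x.
  by rewrite inE/= => xab; exact: cf.
have cvg1 : (\int[leb]_(x in I n) (f x)%:E)%E @[n --> \oo] -->
    (\int[leb]_(x in `]a, b[) (f x)%:E)%E.
  rewrite -UI; apply: ge0_nondecreasing_set_cvg_integral => //.
  - move=> m n mn; apply/subsetPset => x; rewrite /I/= !in_itv/=.
    have : e n <= e m.
      rewrite ler_pM2l ?subr_gt0// lef_pV2 ?posrE// ler_nat !ltnS//.
    by move=> ? /andP[? ?]; apply/andP; split; lra.
  - by move=> n; exact: measurable_itv.
  - move=> n; apply/measurable_EFinP; apply: measurable_funS mf => //.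
    by move=> x /sub.
  - by move=> n x /sub xab; rewrite lee_fin f0.
have intI n : (\int[leb]_(x in I n) (f x)%:E = (F (b - e n) - F (a + e n))%:E)%E.
  have h1 := e0 n; have h2 := e2 n.
  have lt1 : a + e n < b - e n by lra.
  rewrite EFinB; apply: continuous_FTC2 => //.
  - apply: continuous_in_subspaceT => x; rewrite inE => /sub; exact: cf.
  - split.
    + move=> x; rewrite in_itv/= => /andP[x1 x2].
      have xab : x \in `]a, b[ by rewrite in_itv/=; apply/andP; split; lra.
      by have := dF _ xab.
    + have xab : a + e n \in `]a, b[ by rewrite in_itv/=; apply/andP; split; lra.
      apply: cvg_at_right_filter.
      have [/derivable1_diffP /differentiable_continuous + _] := dF _ xab.
      exact.
    + have xab : b - e n \in `]a, b[ by rewrite in_itv/=; apply/andP; split; lra.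
      apply: cvg_at_left_filter.
      have [/derivable1_diffP /differentiable_continuous + _] := dF _ xab.
      exact.
  - move=> x; rewrite in_itv/= => /andP[x1 x2].
    have xab : x \in `]a, b[ by rewrite in_itv/=; apply/andP; split; lra.
    by rewrite derive1E; have [_ ->] := dF _ xab.
have cvg2 : (\int[leb]_(x in I n) (f x)%:E)%E @[n --> \oo] --> ((F b - F a)%:E)%E.
  under eq_fun do rewrite intI.
  apply: cvg_EFin; first exact: nearW.
  apply: cvgB.
  - apply: (cvg_at_leftP F b (F b)).1 => //; split=> [n|]; first by rewrite ltrBlDr ltrDl.
    by rewrite -[X in _ --> X]subr0; apply: cvgB => //; exact: cvg_cst.
  - apply: (cvg_at_rightP F a (F a)).1 => //; split=> [n|]; first by rewrite ltrDl.
    by rewrite -[X in _ --> X]addr0; apply: cvgD => //; exact: cvg_cst.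
exact: cvg_unique cvg1 cvg2.
Qed.

End RealIntegrals.

Section PowerIntegrals.
Context {R : realType}.
Implicit Types (f F : R -> R) (a b c s x : R).
Notation leb := (@lebesgue_measure R).

Lemma powR_continuous_right e x : 0 < e -> 0 <= x -> y `^ e @[y --> x^'+] --> x `^ e.
Proof.
move=> e0; rewrite le_eqVlt => /predU1P[<-|x0].
  by rewrite powR0 ?gt_eqF//; exact: powR_cvg0.
apply: cvg_at_right_filter.
by have [/derivable1_diffP /differentiable_continuous + _] := is_derive1_powR e x0; exact.
Qed.

Lemma powR_continuous e x : 0 < x -> {for x, continuous (@powR R ^~ e)}.
Proof.
by move=> x0; have [/derivable1_diffP /differentiable_continuous + _] := is_derive1_powR e x0; exact.
Qed.

Lemma is_derive_powR_subr e c x : c < x ->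
  is_derive x 1 (fun y => (y - c) `^ e) (e * (x - c) `^ (e - 1)).
Proof.
move=> cx; have xc : 0 < x - c by rewrite subr_gt0.
have dg : is_derive x 1 (fun y => y - c) 1.
  by apply: is_derive_eq; rewrite subr0.
have dp : is_derive ((fun y => y - c) x) 1 (@powR R ^~ e) _ := is_derive1_powR e xc.
by have := @is_derive1_comp _ (@powR R ^~ e) (fun y => y - c) x _ _ dp dg; rewrite mulr1.
Qed.

Lemma is_derive_powR_subl e c x : x < c ->
  is_derive x 1 (fun y => (c - y) `^ e) (- (e * (c - x) `^ (e - 1))).
Proof.
move=> cx; have xc : 0 < c - x by rewrite subr_gt0.
have dg : is_derive x 1 (fun y => c - y) (-1).
  by have := is_deriveB (is_derive_cst c x 1) (is_derive_id x 1); rewrite sub0r.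
have dp : is_derive ((fun y => c - y) x) 1 (@powR R ^~ e) _ := is_derive1_powR e xc.
by have := @is_derive1_comp _ (@powR R ^~ e) (fun y => c - y) x _ _ dp dg; rewrite mulrN1.
Qed.

Lemma cvg_powR_right e x : 0 <= x -> 0 < e \/ 0 < x ->
  y `^ e @[y --> x^'+] --> x `^ e.
Proof.
move=> x0 [e0|{}x0]; first exact: powR_continuous_right.
by apply: cvg_at_right_filter; exact: powR_continuous.
Qed.

(** The disjunction allows either an integrable singularity, possibly at the end point [a] itself,
    or any exponent other than -1 with the singularity strictly to the left of [a]. *)
Lemma integral_powR_subr e c a b : c <= a -> a < b -> e + 1 != 0 ->
    0 < e + 1 \/ c < a ->
  (\int[leb]_(x in `]a, b[) ((x - c) `^ e)%:E =
   (((b - c) `^ (e + 1) - (a - c) `^ (e + 1)) / (e + 1))%:E)%E.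
Proof.
move=> ca ab e1 h.
pose F y := (e + 1)^-1 * (y - c) `^ (e + 1).
transitivity ((F b - F a)%:E); last by congr EFin; rewrite /F mulrC mulrBl; ring.
apply: ge0_FTC_oo => //.
- by move=> x _; exact: powR_ge0.
- move=> x; rewrite in_itv/= => /andP[ax xb].
  have cx : c < x by exact: le_lt_trans ax.
  have := is_derive_powR_subr (e + 1) cx => d1.
  have := is_deriveZ (e + 1)^-1 d1.
  by rewrite addrK /= scalerA mulVf// scale1r.
- move=> x; rewrite in_itv/= => /andP[ax xb].
  have cx : c < x by exact: le_lt_trans ax.
  by have [/derivable1_diffP /differentiable_continuous + _] := is_derive_powR_subr e cx; exact.
- apply: cvgMl_tmp; apply/cvg_at_rightP => u [ua ucvg].
  have : 0 < e + 1 \/ 0 < a - c by case: h; [left|right; rewrite subr_gt0].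
  have ac : 0 <= a - c by rewrite subr_ge0.
  move=> /(cvg_powR_right ac)/cvg_at_rightP; apply; split=> [n|].
    by rewrite ltrBlDr subrK.
  by apply: cvgB => //; exact: cvg_cst.
- apply: cvgMl_tmp; apply: cvg_at_left_filter.
  have cb : c < b by exact: le_lt_trans ab.
  by have [/derivable1_diffP /differentiable_continuous + _] := is_derive_powR_subr (e + 1) cb; exact.
Qed.

Lemma integral_powR_subl e c a b : b <= c -> a < b -> e + 1 != 0 ->
    0 < e + 1 \/ b < c ->
  (\int[leb]_(x in `]a, b[) ((c - x) `^ e)%:E =
   (((c - a) `^ (e + 1) - (c - b) `^ (e + 1)) / (e + 1))%:E)%E.
Proof.
move=> bc ab e1 h.
pose F y := - (e + 1)^-1 * (c - y) `^ (e + 1).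
transitivity ((F b - F a)%:E); last by congr EFin; rewrite /F mulrC mulrBl; ring.
apply: ge0_FTC_oo => //.
- by move=> x _; exact: powR_ge0.
- move=> x; rewrite in_itv/= => /andP[ax xb].
  have xc : x < c by exact: lt_le_trans bc.
  have := is_derive_powR_subl (e + 1) xc => d1.
  have := is_deriveZ (- (e + 1)^-1) d1.
  by rewrite addrK /= scalerN -scaleNr opprK scalerA mulVf// scale1r.
- move=> x; rewrite in_itv/= => /andP[ax xb].
  have xc : x < c by exact: lt_le_trans bc.
  by have [/derivable1_diffP /differentiable_continuous + _] := is_derive_powR_subl e xc; exact.
- apply: cvgMl_tmp; apply: cvg_at_right_filter.
  have ac : a < c by exact: lt_le_trans bc.
  by have [/derivable1_diffP /differentiable_continuous + _] := is_derive_powR_subl (e + 1) ac; exact.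
- apply: cvgMl_tmp; apply/cvg_at_leftP => u [ua ucvg].
  have : 0 < e + 1 \/ 0 < c - b by case: h; [left|right; rewrite subr_gt0].
  have ac : 0 <= c - b by rewrite subr_ge0.
  move=> /(cvg_powR_right ac)/cvg_at_rightP; apply; split=> [n|].
    by rewrite ltrD2l ltrN2.
  by apply: cvgB => //; exact: cvg_cst.
Qed.

Lemma powR_cvgy_0 e : e < 0 -> y `^ e @[y --> +oo] --> (0 : R).
Proof.
move=> e0; have en : 0 < - e by rewrite oppr_gt0.
apply/cvgr0Pnorm_le => /= eps eps0.
near=> y.
have y0 : 0 < y by near: y; exact: nbhs_pinfty_gt.
rewrite ger0_norm ?powR_ge0//.
have hy : (eps `^ (e^-1)) <= y by near: y; apply: nbhs_pinfty_ge; exact: num_real.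
have epsE : eps = (eps `^ (e^-1)) `^ e.
  by rewrite -powRrM mulVf ?lt_eqF// powRr1// ltW.
rewrite [leRHS]epsE -[X in _ `^ X <= _ `^ X]opprK powRN [leRHS]powRN.
rewrite lef_pV2 ?posrE ?powR_gt0//.
by rewrite ge0_ler_powR ?nnegrE ?powR_ge0// ltW.
Unshelve. all: end_near. Qed.

Lemma integral_powRy e b : 0 < b -> e + 1 < 0 ->
  (\int[leb]_(x in `[b, +oo[) (x `^ e)%:E = (b `^ (e + 1) / - (e + 1))%:E)%E.
Proof.
move=> b0 e1.
pose F y := (e + 1)^-1 * y `^ (e + 1).
have dF x : b <= x -> is_derive x 1 F (x `^ e).
  move=> bx; have x0 := lt_le_trans b0 bx.
  have := is_deriveZ (e + 1)^-1 (is_derive1_powR (e + 1) x0).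
  by rewrite addrK /= scalerA mulVf ?scale1r// lt_eqF.
rewrite (@ge0_continuous_FTC2y _ _ F _ 0).
- by rewrite sub0e; congr EFin; rewrite /F invrN mulrN mulrC.
- by move=> x _; exact: powR_ge0.
- apply: continuous_in_subspaceT => x; rewrite inE/= in_itv/= andbT => bx.
  by apply: powR_continuous; exact: lt_le_trans bx.
- rewrite -[X in _ --> X](mulr0 (e + 1)^-1); apply: cvgMl_tmp.
  exact: powR_cvgy_0.
- by move=> x bx; have [] := dF x (ltW bx).
- apply: cvg_at_right_filter.
  by have [/derivable1_diffP /differentiable_continuous + _] := dF b (lexx _); exact.
- move=> x; rewrite in_itv/= andbT => bx.
  by rewrite derive1E; have [_ ->] := dF x (ltW bx).
Qed.

End PowerIntegrals.

(** * Affine change of variables *)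

Section AffineChange.
Context {R : realType}.
Notation leb := (@lebesgue_measure R).

Variables (k b : R).
Hypothesis k0 : 0 < k.

Let phi (x : R) : measurableTypeR R := k * x + b.

Let mphi : measurable_fun [set: measurableTypeR R] phi.
Proof. by apply: measurable_funD => //; exact: measurable_funM. Qed.

Let pm : {measure set (measurableTypeR R) -> \bar R} :=
  measure_function_pushforward__canonical__measure_function_Measure leb mphi.

Let m := mscale (NngNum (ltW k0)) pm.

(** Lebesgue measure is determined by its values on half-open intervals, whose preimages under [phi]
    are intervals shorter by the factor [k]. *)
Let lebE (A : set R) : measurable A -> leb A = m A.
Proof.
move=> mA; apply: lebesgue_measure_unique => //= _ [[x y] _ <-].
rewrite /m /mscale /= /pushforward.
rewrite (_ : phi @^-1` _ = `]((x - b) / k), ((y - b) / k)]%classic); last first.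
  apply/seteqP; split=> z; rewrite /phi /= !in_itv/= ltr_pdivrMr// ler_pdivlMr// (mulrC k);
   by move=> /andP[? ?]; apply/andP; split; lra.
rewrite !lebesgue_measure_itv/= !lte_fin ltr_pM2r ?invr_gt0// ltrD2r.
case: ifPn => _; last by rewrite mule0.
by rewrite -EFinM; congr EFin; field; rewrite gt_eqF.
Qed.

Lemma ge0_integral_affine (f : R -> \bar R) : measurable_fun setT f ->
  (forall x, 0 <= f x)%E ->
  (\int[leb]_x f x = k%:E * \int[leb]_x f (k * x + b)%R)%E.
Proof.
move=> mf f0.
transitivity (\int[m]_x f x)%E.
  by apply: eq_measure_integral => A mA _; exact: lebE.
rewrite /m ge0_integral_mscale//; congr (_ * _)%E.
by rewrite /pm/= ge0_integral_pushforward.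
Qed.

Lemma integral_affine (f : R -> R) : leb.-integrable setT (EFin \o f) ->
  (\int[leb]_x (f x)%:E = k%:E * \int[leb]_x (f (k * x + b))%:E)%E.
Proof.
move=> fi; have mf := measurable_int _ fi.
rewrite integralE.
rewrite (@ge0_integral_affine ((EFin \o f)^\+)%E)//; last exact: measurable_funepos.
rewrite (@ge0_integral_affine ((EFin \o f)^\-)%E)//; last exact: measurable_funeneg.
rewrite [in RHS]integralE.
have := integrable_neg_fin_num measurableT fi.
rewrite (@ge0_integral_affine ((EFin \o f)^\-)%E)//; last exact: measurable_funeneg.
set A := (\int[leb]_x (EFin \o f)^\+ (k * x + b)%R)%E.
have : (0 <= \int[leb]_x (EFin \o f)^\- (k * x + b)%R)%E by exact: integral_ge0.
set B := (\int[leb]_x (EFin \o f)^\- (k * x + b)%R)%E.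
(* As [k] is positive, finiteness of k B forces that of B, and the product then distributes over the
   difference of extended reals. *)
move=> B0 kB; have {}B0 : B \is a fin_num.
  by case: B B0 kB => //=; rewrite gt0_muley.
rewrite -muleBr//; last by rewrite fin_num_adde_defl// fin_numN.
by congr (_ * (_ - _))%E; apply: eq_integral => x _; rewrite ?funeposE ?funenegE.
Qed.

End AffineChange.

Lemma measurable_fun_powR {R : realType} d (T : measurableType d) (D : set T) (f : T -> R) p :
  measurable_fun D f -> measurable_fun D (fun x => f x `^ p).
Proof. by move=> mf; apply: (measurableT_comp (measurable_powR p) mf). Qed.

Lemma measurable_fun_expR {R : realType} d (T : measurableType d) (D : set T) (f : T -> R) :
  measurable_fun D f -> measurable_fun D (fun x => expR (f x)).
Proof. by move=> mf; apply: (measurableT_comp (@measurable_expR R) mf). Qed.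

Lemma measurable_fun_normr {R : realType} d (T : measurableType d) (D : set T) (f : T -> R) :
  measurable_fun D f -> measurable_fun D (fun x => `|f x|).
Proof. by move=> mf; apply: (measurableT_comp (@normr_measurable R setT) mf). Qed.

Ltac solve_meas := repeat first
  [ assumption
  | exact: measurable_id
  | exact: measurable_cst
  | exact: measurable_fst
  | exact: measurable_snd
  | apply: measurable_and
  | apply: measurable_fun_ltr
  | apply: measurable_fun_ler
  | apply: measurable_fun_powR
  | apply: measurable_fun_expR
  | apply: measurable_fun_normr
  | apply: measurable_funM
  | apply: measurable_funB
  | apply: measurable_funD
  | apply: measurable_funN
  | apply: measurable_fun_ifT
  | apply: measurableT_comp ].

(** * The Beta integral as a product of two Gamma values *)

Section BetaGamma.
Context {R : realType}.
Implicit Types (a r s t v x y : R).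
Notation leb := (@lebesgue_measure R).

Lemma integral_itv_if (i : interval R) (f : R -> \bar R) :
  (\int[leb]_(x in [set` i]) f x = \int[leb]_x (if x \in i then f x else 0))%E.
Proof.
by rewrite integral_mkcond; apply: eq_integral => x _; rewrite patchE mem_setE.
Qed.

Lemma integral_expRN : (\int[leb]_(x in `]0%R, +oo[) (expR (- x))%:E = 1)%E.
Proof.
rewrite integral_itv_obnd_cbnd; last first.
  apply/measurable_EFinP; apply: measurable_funTS.
  by apply: measurableT_comp => //; exact: measurableT_comp.
pose F x : R := - expR (- x).
have dF x : is_derive x 1 F (expR (- x)).
  have dp : is_derive ((fun y : R => - y) x) 1 expR _ := is_derive_expR _.
  have dg : is_derive x 1 (fun y : R => - y) (-1) by exact: is_deriveNid.
  have := is_deriveN (@is_derive1_comp _ expR (fun y => - y) x _ _ dp dg).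
  by rewrite mulrN1 opprK.
rewrite (@ge0_continuous_FTC2y _ _ F _ 0).
- by rewrite /F oppr0 expR0 sub0e EFinN oppeK.
- by move=> x _; exact: expR_ge0.
- apply: continuous_subspaceT => x; apply: continuous_comp; first exact: opp_continuous.
  exact: continuous_expR.
- rewrite -[X in _ --> X]oppr0; apply: cvgN.
  exact: cvgr_expR.
- by move=> x _; have [] := dF x.
- apply: cvg_at_right_filter.
  by have [/derivable1_diffP /differentiable_continuous + _] := dF 0; exact.
- by move=> x _; rewrite derive1E; have [_ ->] := dF x.
Qed.

Lemma integral_powR e b : 0 < b -> 0 < e + 1 ->
  (\int[leb]_(x in `]0%R, b[) (x `^ e)%:E = (b `^ (e + 1) / (e + 1))%:E)%E.
Proof.
move=> b0 e1; have e1' : e + 1 != 0 by rewrite gt_eqF.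
have := @integral_powR_subr R e 0 0 b (lexx _) b0 e1' (or_introl e1).
rewrite !subr0 (powR0 e1') subr0 => <-.
by apply: eq_integral => x _; rewrite subr0.
Qed.

Definition beta_integrand a v : R := v `^ (a - 1) * (1 - v) `^ (- a).

Definition beta_integral a : \bar R := (\int[leb]_(v in `]0%R, 1%R[) (beta_integrand a v)%:E)%E.

Lemma measurable_beta_integrand a : measurable_fun setT (beta_integrand a).
Proof.
by apply: measurable_funM; apply: measurable_fun_powR => //; exact: measurable_funB.
Qed.

Lemma powR_gt1_neg v e : 0 < v -> v <= 1 -> e <= 0 -> 1 <= v `^ e.
Proof.
move=> v0 v1 e0; rewrite -[leLHS](powRr0 v); apply: ger_powR => //.
by rewrite v0.
Qed.

(** Both factors of the integrand are at least 1. The bound, together with finiteness, later forces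
    both Gamma factors to be finite and positive. *)
Lemma beta_integral_ge1 a : 0 < a -> a < 1 -> (1 <= beta_integral a)%E.
Proof.
move=> a0 a1; apply: (@le_trans _ _ (\int[leb]_(v in `]0%R, 1%R[) 1%:E)%E).
  rewrite integral_cst//= lebesgue_measure_itv/= lte_fin ltr01 mul1e.
  by rewrite oppr0 adde0.
apply: ge0_le_integral => //.
- by apply/measurable_EFinP/measurable_funTS; exact: measurable_beta_integrand.
- move=> v; rewrite /= in_itv/= => /andP[v0 v1]; rewrite lee_fin.
  have h1 : 1 <= v `^ (a - 1) by apply: powR_gt1_neg; lra.
  have h2 : 1 <= (1 - v) `^ (- a) by apply: powR_gt1_neg; lra.
  by rewrite /beta_integrand -[leLHS]mulr1; apply: ler_pM.
Qed.

Lemma powR_le_neg (x y e : R) : 0 < x -> x <= y -> e <= 0 -> y `^ e <= x `^ e.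
Proof.
move=> x0 xy e0; rewrite -[e]opprK 2!(powRN _ (- e)) lef_pV2 ?posrE ?powR_gt0//; last lra.
by apply: ge0_ler_powR; rewrite ?nnegrE; lra.
Qed.

Lemma beta_integral_lty a : 0 < a -> a < 1 -> (beta_integral a < +oo)%E.
Proof.
(* On each half of the interval only one factor is singular; the other is at most its value at
   1/2. *)
move=> a0 a1; pose c e : R := 2^-1 `^ e.
apply: (@le_lt_trans _ _ (\int[leb]_(v in `]0%R, 1%R[)
   ((c (- a))%:E * (v `^ (a - 1))%:E + (c (a - 1))%:E * ((1 - v) `^ (- a))%:E))%E).
  apply: ge0_le_integral => //.
  - by move=> v _; rewrite lee_fin mulr_ge0// powR_ge0.
  - by apply/measurable_EFinP/measurable_funTS; exact: measurable_beta_integrand.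
  - apply: emeasurable_funD; apply: measurable_funeM; apply/measurable_EFinP/measurable_funTS.
      exact: measurable_powR.
    by apply: measurable_fun_powR; exact: measurable_funB.
  move=> v; rewrite /= in_itv/= => /andP[v0 v1]; rewrite -!EFinM -EFinD lee_fin.
  rewrite /beta_integrand; have [vh|vh] := leP v 2^-1.
    rewrite -[leLHS]addr0 lerD ?mulr_ge0 ?powR_ge0//.
    by rewrite mulrC ler_wpM2r ?powR_ge0//; apply: powR_le_neg; lra.
  rewrite -[leLHS]add0r lerD ?mulr_ge0 ?powR_ge0//.
  by rewrite ler_wpM2r ?powR_ge0//; apply: powR_le_neg; lra.
rewrite ge0_integralD//; last 4 first.
- by move=> v _; rewrite lee_fin mulr_ge0// powR_ge0.
- by apply: measurable_funeM; apply/measurable_EFinP/measurable_funTS; exact: measurable_powR.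
- by move=> v _; rewrite lee_fin mulr_ge0// powR_ge0.
- apply: measurable_funeM; apply/measurable_EFinP/measurable_funTS.
  by apply: measurable_fun_powR; exact: measurable_funB.
rewrite !ge0_integralZl_EFin ?powR_ge0//; last 4 first.
- by move=> v _; rewrite lee_fin powR_ge0.
- apply/measurable_EFinP/measurable_funTS.
  by apply: measurable_fun_powR; exact: measurable_funB.
- by move=> v _; rewrite lee_fin powR_ge0.
- by apply/measurable_EFinP/measurable_funTS; exact: measurable_powR.
rewrite integral_powR//; last lra.
rewrite integral_powR_subl//; [|lra|left; lra].
by rewrite -!EFinM -EFinD ltry.
Qed.

Lemma beta_integral_scale a r : 0 < a -> a < 1 -> 0 < r ->
  (\int[leb]_(s in `]0%R, r[) (s `^ (a - 1) * (r - s) `^ (- a))%:E = beta_integral a)%E.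
Proof.
move=> a0 a1 r0; rewrite /beta_integral !integral_itv_if.
pose f s := if s \in `]0, r[ then s `^ (a - 1) * (r - s) `^ (- a) else 0.
transitivity (\int[leb]_s (f s)%:E)%E.
  by apply: eq_integral => s _; rewrite /f; case: ifPn.
have mf : measurable_fun setT f.
  rewrite /f; under eq_fun do rewrite in_itv/=.
  solve_meas.
rewrite (@ge0_integral_affine _ r 0 r0 (fun s => (f s)%:E)); last 2 first.
- exact/measurable_EFinP.
- by move=> x; rewrite /f lee_fin; case: ifPn => // _; rewrite mulr_ge0 ?powR_ge0.
rewrite -ge0_integralZl_EFin ?ltW//.
- apply: eq_integral => v _; rewrite addr0 /f/= !in_itv/= pmulr_rgt0// -ltr_pdivlMl//.
  rewrite mulVf ?gt_eqF//; case: ifPn => [/andP[v0 v1]|_]; last by rewrite mule0.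
  rewrite -EFinM; congr EFin; rewrite /beta_integrand.
  have -> : r - r * v = r * (1 - v) by ring.
  rewrite !powRM ?(ltW r0) ?(ltW v0) ?subr_ge0 ?(ltW v1)//.
  rewrite [LHS](_ : _ = (r * r `^ (a - 1) * r `^ (- a)) * (v `^ (a - 1) * (1 - v) `^ (- a))); last by ring.
  rewrite -{1}[r](powRr1 (ltW r0)) -!powRD ?(gt_eqF r0) ?implybT//.
  by rewrite (_ : 1 + _ + _ = 0) ?powRr0 ?mul1r//; ring.
- by move=> x _; rewrite lee_fin /f; case: ifPn => // _; rewrite mulr_ge0 ?powR_ge0.
- apply/measurable_EFinP; apply: (measurableT_comp mf).
  by apply: measurable_funD => //; exact: measurable_funM.
Qed.

(** Euler's computation: in the double integral of the product, the substitution r = s + t and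
    Tonelli leave, for each r, the scaled Beta integral times exp(-r). It is done with extended
    integrals, since [Gamma] is a [fine] value whose finiteness is not known beforehand. *)
Lemma Gamma_reflection_beta a : 0 < a -> a < 1 ->
  0 < Gamma a :> R /\ 0 < Gamma (1 - a) /\
  beta_integral a = (Gamma a * Gamma (1 - a))%:E.
Proof.
move=> a0 a1.
pose f e t : R := if 0 < t then t `^ e * expR (- t) else 0.
have f0 e t : 0 <= f e t.
  by rewrite /f; case: ifPn => // _; rewrite mulr_ge0 ?powR_ge0 ?expR_ge0.
have mf e : measurable_fun setT (f e) by rewrite /f; solve_meas.
pose G e : \bar R := (\int[leb]_t (f e t)%:E)%E.
have G0 e : (0 <= G e)%E by apply: integral_ge0 => x _; rewrite lee_fin.
have GE z : Gamma z = fine (G (z - 1)).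
  rewrite /Gamma /Rintegral /G integral_itv_if; congr fine.
  by apply: eq_integral => t _; rewrite /f in_itv/= andbT; case: ifPn.
pose h (z : R * R) : R := if (0 < z.1) && (z.1 < z.2) then
  z.1 `^ (a - 1) * (z.2 - z.1) `^ (- a) * expR (- z.2) else 0.
have h0 z : 0 <= h z.
  by rewrite /h; case: ifPn => // _; rewrite !mulr_ge0 ?powR_ge0 ?expR_ge0.
have mh : measurable_fun setT h by rewrite /h; solve_meas.
have GG : (G (a - 1)%R * G (- a)%R = beta_integral a)%E.
  rewrite {1}/G -ge0_integralZr; last 4 first.
  - exact: measurableT.
  - by apply/measurable_EFinP; first [exact: mf | exact: mh].
  - by move=> x _; rewrite lee_fin.
  - exact: G0.
  transitivity (\int[leb]_s \int[leb]_r (h (s, r))%:E)%E.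
    apply: eq_integral => s _; rewrite -ge0_integralZl_EFin; last 4 first.
    - exact: measurableT.
    - by move=> x _; rewrite lee_fin.
    - by apply/measurable_EFinP; first [exact: mf | exact: mh].
    - exact: f0.
    rewrite (@ge0_integral_affine _ 1 (- s) ltr01 (fun t => ((f (a - 1) s)%:E * (f (- a) t)%:E)%E)); last 2 first.
    - by apply: measurable_funeM; by apply/measurable_EFinP; first [exact: mf | exact: mh].
    - by move=> x; rewrite -EFinM lee_fin mulr_ge0.
    rewrite mul1e; apply: eq_integral => r _.
    rewrite -EFinM; congr EFin; rewrite /f /h/= mul1r subr_gt0.
    case: ifPn => //= s0; last by rewrite mul0r.
    case: ifPn => //= sr; last by rewrite mulr0.
    rewrite [expR (- r)](_ : _ = expR (- s) * expR (- (r - s))); first by ring.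
    by rewrite -expRD; congr expR; ring.
  rewrite (@fubini_tonelli _ _ _ _ _ leb leb (EFin \o h)); last 2 first.
  - by apply/measurable_EFinP; exact: mh.
  - by move=> z; rewrite lee_fin.
  transitivity (\int[leb]_r ((beta_integral a) * (if (0 < r)%R then (expR (- r)%R)%:E else 0)))%E.
    apply: eq_integral => r _; case: ifPn => r0; last first.
      rewrite mule0 integral0_eq// => s _; rewrite /h/=.
      by case: ifPn => // /andP[s0 sr]; move: r0; rewrite (lt_trans s0 sr).
    rewrite -(beta_integral_scale a0 a1 r0) integral_itv_if -ge0_integralZr; last 4 first.
    - exact: measurableT.
    - under eq_fun do rewrite in_itv/=.
      apply: measurable_fun_ifT; [solve_meas| |exact: measurable_cst].
      by apply/measurable_EFinP; solve_meas.
    - by move=> s _; case: ifPn => // _; rewrite lee_fin mulr_ge0 ?powR_ge0.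
    - by rewrite lee_fin expR_ge0.
    apply: eq_integral => s _; rewrite /h/= in_itv/=.
    by case: ifPn => // _; rewrite mul0e.
  rewrite ge0_integralZl//; last 3 first.
  - by apply: measurable_fun_ifT; [solve_meas|apply/measurable_EFinP; solve_meas|exact: measurable_cst].
  - by move=> s _; case: ifPn => // _; rewrite lee_fin expR_ge0.
  - by apply: le_trans (beta_integral_ge1 a0 a1).
  have := integral_expRN; rewrite integral_itv_if => E1.
  rewrite -[RHS]mule1 -E1; congr (_ * _)%E.
  by apply: eq_integral => s _; rewrite in_itv/= andbT.
have B1 := beta_integral_ge1 a0 a1; have B2 := beta_integral_lty a0 a1.
rewrite !GE (_ : 1 - a - 1 = - a); last by ring.
move: B1 B2; rewrite -GG; move: (G0 (a - 1)) (G0 (- a)).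
(* An infinite factor would make the product infinite or, against a zero factor, equal to 0; both
   contradict 1 <= [beta_integral a] < +oo. *)
case: (G (a - 1)) => [x| |]//; case: (G (- a)) => [y| |]//=.
- rewrite -EFinM !lee_fin ltry => x0 y0 xy _.
  have x1 : 0 < x.
    by rewrite lt_neqAle x0 andbT; apply/eqP => x1; move: xy; rewrite -x1 mul0r ler10.
  have y1 : 0 < y.
    by rewrite lt_neqAle y0 andbT; apply/eqP => y1; move: xy; rewrite -y1 mulr0 ler10.
  by [].
- rewrite lee_fin => x0 _; have [->|x1] := eqVneq x 0.
    by rewrite mul0e lee_fin ler10.
  by rewrite gt0_muley ?ltxx// lte_fin lt_neqAle eq_sym x1.
- rewrite lee_fin => _ y0; have [->|y1] := eqVneq y 0.
    by rewrite mule0 lee_fin ler10.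
  by rewrite gt0_mulye ?ltxx// lte_fin lt_neqAle eq_sym y1.
Qed.

End BetaGamma.

(** * Domination and cut-off powers on the whole line *)

Section Integrability.
Context {R : realType}.
Notation leb := (@lebesgue_measure R).

Lemma integrable_le (f g : R -> R) : measurable_fun setT f -> measurable_fun setT g ->
  (forall x, `|f x| <= g x) -> (\int[leb]_x (g x)%:E < +oo)%E ->
  leb.-integrable setT (EFin \o f).
Proof.
move=> mf mg fg goo; apply/integrableP; split; first by apply/measurable_EFinP; exact: mf.
apply: le_lt_trans goo; apply: ge0_le_integral => //.
- by apply: measurableT_comp => //; apply/measurable_EFinP; exact: mf.
- by apply/measurable_EFinP; exact: mg.
- by move=> x _; rewrite lee_fin.
Qed.

Lemma integrable_affine (f : R -> R) (k b : R) : 0 < k ->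
  leb.-integrable setT (EFin \o f) ->
  leb.-integrable setT (EFin \o (fun x => k * f (k * x + b))).
Proof.
move=> k0 fi; have mf : measurable_fun setT f.
  by apply/measurable_EFinP; exact: measurable_int fi.
suff H : leb.-integrable setT (EFin \o (fun x => f (k * x + b))).
  by have := integrableZl measurableT k H; apply: eq_integrable.
have mfk : measurable_fun setT (fun x => f (k * x + b)).
  by apply: (measurableT_comp mf); solve_meas.
apply/integrableP; split; first by apply/measurable_EFinP; exact: mfk.
have /integrableP[_] := fi.
rewrite (@ge0_integral_affine _ k b k0 (fun x => `|(EFin \o f) x|%E)).
- have : (0 <= \int[leb]_x `|(EFin \o f) (k * x + b)%R|)%E by exact: integral_ge0.
  rewrite /=; case: integral => //; last by rewrite gt0_muley.
  by move=> r _ _; rewrite ltry.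
- by apply: measurableT_comp => //; apply/measurable_EFinP; exact: mf.
- by move=> x.
Qed.

Lemma integral_affineM (f : R -> R) (k b : R) : 0 < k ->
  leb.-integrable setT (EFin \o f) ->
  (\int[leb]_x (f x)%:E = \int[leb]_x (k * f (k * x + b))%:E)%E.
Proof.
move=> k0 fi; rewrite (integral_affine b k0 fi) -integralZl//.
have := integrableZl measurableT k^-1 (integrable_affine b k0 fi).
apply: eq_integrable => // x _.
by rewrite /= -EFinM mulKf ?gt_eqF.
Qed.

Lemma integral_if_powR_subr (K e c a b : R) : 0 <= K -> c <= a -> a < b -> e + 1 != 0 ->
    0 < e + 1 \/ c < a ->
  (\int[leb]_x (if (a < x)%R && (x < b)%R then K * (x - c) `^ e else 0%R)%:E =
   (K * (((b - c) `^ (e + 1) - (a - c) `^ (e + 1)) / (e + 1)))%:E)%E.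
Proof.
move=> K0 ca ab e0 h; rewrite [RHS]EFinM -(integral_powR_subr ca ab e0 h).
rewrite integral_itv_if -ge0_integralZl_EFin; last 4 first.
- exact: measurableT.
- by move=> x _; case: ifPn => // _; rewrite lee_fin powR_ge0.
- under eq_fun do rewrite in_itv/=.
  apply: measurable_fun_ifT; [solve_meas| |exact: measurable_cst].
  by apply/measurable_EFinP; solve_meas.
- exact: K0.
by apply: eq_integral => x _; rewrite in_itv/=; case: ifPn; rewrite ?mule0.
Qed.

Lemma integral_if_powR_subl (K e c a b : R) : 0 <= K -> b <= c -> a < b -> e + 1 != 0 ->
    0 < e + 1 \/ b < c ->
  (\int[leb]_x (if (a < x)%R && (x < b)%R then K * (c - x) `^ e else 0%R)%:E =
   (K * (((c - a) `^ (e + 1) - (c - b) `^ (e + 1)) / (e + 1)))%:E)%E.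
Proof.
move=> K0 ca ab e0 h; rewrite [RHS]EFinM -(integral_powR_subl ca ab e0 h).
rewrite integral_itv_if -ge0_integralZl_EFin; last 4 first.
- exact: measurableT.
- by move=> x _; case: ifPn => // _; rewrite lee_fin powR_ge0.
- under eq_fun do rewrite in_itv/=.
  apply: measurable_fun_ifT; [solve_meas| |exact: measurable_cst].
  by apply/measurable_EFinP; solve_meas.
- exact: K0.
by apply: eq_integral => x _; rewrite in_itv/=; case: ifPn; rewrite ?mule0.
Qed.

Lemma integral_if_powRy (K e b : R) : 0 < b -> e + 1 < 0 ->
  (\int[leb]_x (if (b <= x)%R then K * x `^ e else 0%R)%:E =
   (K * (b `^ (e + 1) / - (e + 1)))%:E)%E.
Proof.
move=> b0 e1; rewrite [RHS]EFinM -(integral_powRy b0 e1).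
rewrite integral_itv_if -integralZl; last 2 first.
- exact: measurableT.
- apply/integrableP; split.
    under eq_fun do rewrite in_itv/= andbT.
    apply: measurable_fun_ifT; [solve_meas| |exact: measurable_cst].
    by apply/measurable_EFinP; solve_meas.
  rewrite (_ : integral _ _ _ = \int[leb]_(x in `[b, +oo[) (x `^ e)%:E)%E.
    by rewrite integral_powRy ?ltry.
  rewrite integral_itv_if; apply: eq_integral => x _.
  by case: ifPn => _; rewrite ?abse0//= ger0_norm ?powR_ge0.
by apply: eq_integral => x _; rewrite in_itv/= andbT; case: ifPn; rewrite ?mule0.
Qed.

End Integrability.

(** * Inversion of the right-sided fractional derivative *)

Section KernelIntegrability.
Context {R : realType}.
Notation leb := (@lebesgue_measure R).

Lemma integral_if_powR (K e b : R) : 0 <= K -> 0 < b -> 0 < e + 1 ->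
  (\int[leb]_x (if (0 < x)%R && (x < b)%R then K * x `^ e else 0%R)%:E =
   (K * (b `^ (e + 1) / (e + 1)))%:E)%E.
Proof.
move=> K0 b0 e1; have e1' : e + 1 != 0 by rewrite gt_eqF.
have := @integral_if_powR_subr R K e 0 0 b K0 (lexx _) b0 e1' (or_introl e1).
rewrite !subr0 (powR0 e1') subr0 => <-.
by apply: eq_integral => x _; rewrite subr0.
Qed.

Lemma integrable_prod_le (F : R * R -> R) (B : R -> R) :
  measurable_fun setT F -> measurable_fun setT B -> (forall x, 0 <= B x) ->
  (forall x, \int[leb]_y `|F (x, y)|%:E <= (B x)%:E)%E ->
  (\int[leb]_x (B x)%:E < +oo)%E ->
  (leb \x leb)%E.-integrable setT (EFin \o F).
Proof.
move=> mF mB B0 FB Boo.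
have mF' : measurable_fun setT (fun z => `|F z|%:E).
  by apply/measurable_EFinP; apply: measurableT_comp => //; exact: mF.
apply/integrable12ltyP; first by apply/measurable_EFinP; exact: mF.
apply: le_lt_trans Boo; apply: ge0_le_integral => //.
- by move=> x _; apply: integral_ge0 => y _.
- apply: (@measurable_fun_fubini_tonelli_F _ _ _ _ _ leb (fun z => `|F z|%:E)) => //.
- by apply/measurable_EFinP; exact: mB.
- by move=> x _; exact: FB.
Qed.

(** The increment of [h] supplies [th] powers of u - x, and th + a - 2 > -1 is the hypothesis 1 - a
    < th. The Hoelder bound is asked on the whole line because the paths will be extended there by
    [clamp]. *)
Lemma right_kernel_integrable (a th C x b : R) (h : R -> R) :
  1 - a < th -> 0 <= C -> measurable_fun setT h ->
  (forall u v, `|h u - h v| <= C * `|u - v| `^ th) ->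
  leb.-integrable setT (EFin \o (fun u => if (x < u) && (u < b) then
    (h x - h u) * (u - x) `^ (a - 2) else 0)).
Proof.
move=> ath C0 mh hh.
have [xb|bx] := ltP x b; last first.
  apply: (@integrable_le _ _ (fun _ => 0)).
  - by solve_meas.
  - by solve_meas.
  - move=> u; case: ifPn => [/andP[xu ub]|]; last by rewrite normr0.
    by have := lt_trans xu ub; rewrite ltNge bx.
  - by rewrite integral0.
apply: (@integrable_le _ _ (fun u => if (x < u) && (u < b) then C * (u - x) `^ (th + a - 2) else 0)).
- by solve_meas.
- by solve_meas.
- move=> u; case: ifPn => [/andP[xu ub]|]; last by rewrite normr0.
  have ux : 0 < u - x by rewrite subr_gt0.
  rewrite normrM (ger0_norm (powR_ge0 _ _)) -addrA [in leRHS]powRD ?(gt_eqF ux) ?implybT// mulrA.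
  by rewrite ler_wpM2r ?powR_ge0// distrC (le_trans (hh _ _))// gtr0_norm.
- rewrite integral_if_powR_subr ?ltry//; first by apply: lt0r_neq0; lra.
  by left; lra.
Qed.

End KernelIntegrability.

Section Inversion.
Context {R : realType}.
Notation leb := (@lebesgue_measure R).

(** Allows a substitution in only one of two terms under a common integral sign, which is legitimate
    when the terms are separately integrable. *)
Lemma integral_swap_eq (k : R) (A Q q : R -> R) :
  leb.-integrable setT (EFin \o A) -> leb.-integrable setT (EFin \o Q) ->
  leb.-integrable setT (EFin \o q) ->
  (\int[leb]_x (Q x)%:E = \int[leb]_x (q x)%:E)%E ->
  (\int[leb]_x (k * (A x - Q x))%:E = \int[leb]_x (k * (A x - q x))%:E)%E.
Proof.
move=> iA iQ iq Qq.
have aux f : leb.-integrable setT (EFin \o f) ->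
    (\int[leb]_x (k * (A x - f x))%:E = k%:E * (\int[leb]_x (A x)%:E - \int[leb]_x (f x)%:E))%E.
  move=> fi; rewrite -integralB_EFin// -integralZl//.
  have := integrableB measurableT iA fi; exact: eq_integrable.
by rewrite !aux// Qq.
Qed.

(** In the variable y = (u - x)/(x - c) all powers of x - c merge into dx/(x - c), which is
    invariant under dilations about c. For fixed y the terms h(x) and h(c + (1+y)(x-c)) therefore
    have the same integral up to the range of x, and only the part of the range where the dilated
    point leaves (c, 1) survives. The condition h(c) = 0 is what makes h(x)/(x - c) integrable,
    hence the two terms separable. *)
Lemma kernel_inversion (a th C c : R) (h : R -> R) :
  0 < a -> a < 1 -> a < th -> 1 - a < th -> 0 <= C -> c < 1 ->
  measurable_fun setT h -> (forall u v, `|h u - h v| <= C * `|u - v| `^ th) ->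
  h c = 0 ->
  (\int[leb]_(x in `]c, 1%R[) \int[leb]_(u in `]x, 1%R[)
      ((x - c) `^ (- a) * ((h x - h u) * (u - x) `^ (a - 2)))%:E =
   \int[leb]_(x in `]c, 1%R[) (- (h x * (x - c) `^ (- a) * (1 - x) `^ (a - 1) / (1 - a)))%:E)%E.
Proof.
move=> a0 a1 ath ath1 C0 c1 mh hh hc.
pose s := th + a - 1; have s0 : 0 < s by rewrite /s; lra.
pose dom x y : bool := (c < x) && ((0 < y) && (c + (1 + y) * (x - c) < 1)).
pose Phi (z : R * R) : R := if dom z.1 z.2 then
  (z.1 - c) `^ (-1) * (z.2 `^ (a - 2) * (h z.1 - h (z.1 + z.2 * (z.1 - c)))) else 0.
have mPhi : measurable_fun setT Phi by rewrite /Phi/dom; solve_meas.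
have domE x y : c < x -> dom x y = (0 < y) && (y < (1 - x) / (x - c)).
  move=> cx; rewrite /dom cx/= ltr_pdivlMr ?subr_gt0//; congr (_ && _).
  by apply/idP/idP => ?; nra.
have dom1 x y : dom x y -> x < 1.
  by move=> /andP[cx /andP[y0 h1]]; nra.
have hc' x : c < x -> `|h x| <= C * (x - c) `^ th.
  by move=> cx; rewrite -[h x]subr0 -hc (le_trans (hh _ _))// gtr0_norm ?subr_gt0.
have iPhi : (leb \x leb)%E.-integrable setT (EFin \o Phi).
  (* Integrating C (x-c)^(th-1) y^(th+a-2) over 0 < y < (1-x)/(x-c) gives C/s (1-x)^s (x-c)^(-a),
     and 1 - x is at most 1 - c. *)
  pose K := C / s * (1 - c) `^ s.
  have K0 : 0 <= K by rewrite mulr_ge0 ?powR_ge0// divr_ge0// ltW.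
  apply: (@integrable_prod_le _ _ (fun x => if (c < x) && (x < 1) then K * (x - c) `^ (- a) else 0)) => //.
  - by solve_meas.
  - by move=> x; case: ifPn => // _; rewrite mulr_ge0 ?powR_ge0.
  - move=> x; have [cx|xc] := ltP c x; last first.
      rewrite integral0_eq// => y _; rewrite /Phi/dom/= ltNge xc/= normr0//.
    have [x1|x1] := ltP x 1; last first.
      rewrite integral0_eq// => y _; rewrite /Phi/=.
      by case: ifPn => [/dom1|]; rewrite ?normr0// ltNge x1.
    have xc0 : 0 < x - c by rewrite subr_gt0.
    have b0 : 0 < (1 - x) / (x - c) by rewrite divr_gt0// subr_gt0.
    have K1 : 0 <= C * (x - c) `^ (th - 1) by rewrite mulr_ge0 ?powR_ge0.
    apply: (@le_trans _ _ (\int[leb]_y (if (0 < y)%R && (y < (1 - x) / (x - c))%R then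
        C * (x - c) `^ (th - 1) * y `^ (th + a - 2) else 0%R)%:E)%E).
      apply: ge0_le_integral => //.
      + apply/measurable_EFinP; apply: measurableT_comp => //.
        by rewrite /Phi/dom; solve_meas.
      + by apply/measurable_EFinP; solve_meas.
      + move=> y _; rewrite lee_fin /Phi/= domE//; case: ifPn => [/andP[y0 yb]|]; last by rewrite normr0.
        rewrite !normrM !(ger0_norm (powR_ge0 _ _)).
        have xyE : `|x - (x + y * (x - c))| = y * (x - c).
          by rewrite opprD addNKr normrN gtr0_norm ?mulr_gt0.
        have := hh x (x + y * (x - c)).
        rewrite xyE powRM ?(ltW y0) ?(ltW xc0)// => hxy.
        rewrite [in leRHS]powRD ?(gt_eqF xc0) ?implybT//.
        rewrite -(addrA th) [in leRHS]powRD ?(gt_eqF y0) ?implybT//.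
        rewrite [leRHS](_ : _ = (x - c) `^ (-1) * (y `^ (a - 2) * (C * (y `^ th * (x - c) `^ th)))); last by ring.
        by rewrite ler_wpM2l ?powR_ge0// ler_wpM2l ?powR_ge0.
    rewrite integral_if_powR//; last by lra.
    rewrite lee_fin (_ : th + a - 2 + 1 = s); last by rewrite /s; ring.
    have x10 : 0 <= 1 - x by rewrite subr_ge0 ltW.
    rewrite powRM ?invr_ge0 ?(ltW xc0)// -powR_inv1 ?(ltW xc0)// -powRrM mulN1r.
    rewrite [leLHS](_ : _ = C / s * (1 - x) `^ s * ((x - c) `^ (th - 1) * (x - c) `^ (- s))); last by ring.
    rewrite -powRD ?(gt_eqF xc0) ?implybT//.
    rewrite (_ : th - 1 - s = - a); last by rewrite /s; ring.
    rewrite ler_wpM2r ?powR_ge0// /K ler_wpM2l ?divr_ge0 ?(ltW s0)//.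
    by rewrite ge0_ler_powR ?nnegrE; lra.
  - rewrite integral_if_powR_subr ?ltry//; first by apply: lt0r_neq0; lra.
    by left; lra.
(* the substitution [u = x + y (x - c)] *)
have Phiy x : (\int[leb]_y (Phi (x, y))%:E = if (c < x)%R && (x < 1)%R then
    \int[leb]_(u in `]x, 1%R[) ((x - c) `^ (- a) * ((h x - h u) * (u - x) `^ (a - 2)))%:E else 0)%E.
  have [cx|xc] := ltP c x; last first.
    by rewrite integral0_eq// => y _; rewrite /Phi/dom/= ltNge xc/=.
  have [x1|x1] := ltP x 1; last first.
    rewrite integral0_eq// => y _; rewrite /Phi/=.
    by case: ifPn => [/dom1|]//; rewrite ltNge x1.
  have xc0 : 0 < x - c by rewrite subr_gt0.
  have ik := @right_kernel_integrable _ a th C x 1 h ath1 C0 mh hh.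
  have ik' : leb.-integrable setT (EFin \o (fun u => (x - c) `^ (- a) *
      (if (x < u) && (u < 1) then (h x - h u) * (u - x) `^ (a - 2) else 0))).
    by have := integrableZl measurableT ((x - c) `^ (- a)) ik; apply: eq_integrable.
  rewrite integral_itv_if/=.
  transitivity (\int[leb]_u ((x - c) `^ (- a) *
      (if (x < u)%R && (u < 1)%R then (h x - h u) * (u - x) `^ (a - 2) else 0%R))%:E)%E; last first.
    by apply: eq_integral => u _; rewrite in_itv/=; case: ifPn => // _; rewrite mulr0.
  rewrite (@integral_affineM _ _ (x - c) x xc0 ik').
  apply: eq_integral => y _; rewrite /Phi/= domE//; congr EFin.
  rewrite ltrDr pmulr_rgt0// -ltrBrDr -ltr_pdivlMl// (mulrC _^-1).
  case: ifPn => [/andP[y0 yb]|_]; last by rewrite !mulr0.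
  rewrite addrK (mulrC (x - c) y) powRM ?(ltW y0) ?(ltW xc0)//.
  rewrite [RHS](_ : _ = (x - c) * (x - c) `^ (- a) * (x - c) `^ (a - 2) *
     (y `^ (a - 2) * (h x - h (y * (x - c) + x)))); last by ring.
  have -> : (x - c) * (x - c) `^ (- a) * (x - c) `^ (a - 2) = (x - c) `^ (-1).
    rewrite -{1}[x - c](powRr1 (ltW xc0)) -!powRD ?(gt_eqF xc0) ?implybT//.
    by congr (_ `^ _); ring.
  by rewrite (addrC x (y * _)).
(* ... and [x' = c + (1 + y) (x - c)], which makes the two halves of [Phi] telescope *)
pose Psi (z : R * R) : R := if (c < z.1) && ((z.1 < 1) && ((0 < z.2) && (1 <= c + (1 + z.2) * (z.1 - c))))
  then - (z.2 `^ (a - 2) * (h z.1 * (z.1 - c) `^ (-1))) else 0.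
have mPsi : measurable_fun setT Psi by rewrite /Psi; solve_meas.
have Phix y : (\int[leb]_x (Phi (x, y))%:E = \int[leb]_x (Psi (x, y))%:E)%E.
  have [y0|y0] := ltP 0 y; last first.
    by apply: eq_integral => x _; rewrite /Phi/Psi/dom/= (ltNge 0 y) y0/= !andbF.
  pose q x := if (c < x) && (x < 1) then h x * (x - c) `^ (-1) else 0.
  have iq : leb.-integrable setT (EFin \o q).
    apply: (@integrable_le _ _ (fun x => if (c < x) && (x < 1) then C * (x - c) `^ (th - 1) else 0)).
    - by rewrite /q; solve_meas.
    - by solve_meas.
    - move=> x; rewrite /q; case: ifPn => [/andP[cx _]|]; last by rewrite normr0.
      have xc0 : 0 < x - c by rewrite subr_gt0.
      rewrite normrM (ger0_norm (powR_ge0 _ _)) [in leRHS]powRD ?(gt_eqF xc0) ?implybT//.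
      by rewrite mulrA ler_wpM2r ?powR_ge0// hc'.
    - rewrite integral_if_powR_subr ?ltry//; first by apply: lt0r_neq0; lra.
      by left; lra.
  pose A x := if (c < x) && (c + (1 + y) * (x - c) < 1) then h x * (x - c) `^ (-1) else 0.
  have iA : leb.-integrable setT (EFin \o A).
    apply: (@le_integrable _ _ _ leb setT measurableT (EFin \o A) (EFin \o q)) => //.
    - by apply/measurable_EFinP; rewrite /A; solve_meas.
    - move=> x _; rewrite lee_fin /A /q; case: ifPn => [/andP[cx h1]|_].
        by rewrite cx ifT//=; nra.
      by rewrite normr0.
  have y1 : 0 < 1 + y by rewrite addr_gt0.
  pose b := c - (1 + y) * c.
  have iQ := @integrable_affine _ q _ b y1 iq.
  transitivity (\int[leb]_x (y `^ (a - 2) * (A x - (1 + y) * q ((1 + y) * x + b)))%:E)%E.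
    apply: eq_integral => x _; congr EFin; rewrite /Phi/dom/= y0/= /A /q.
    have -> : (1 + y) * x + b = c + (1 + y) * (x - c) by rewrite /b; ring.
    rewrite ltrDl pmulr_rgt0// subr_gt0; case: ifPn => [/andP[cx _]|]; last first.
      by move=> _; rewrite mulr0 subrr mulr0.
    rewrite addrAC subrr add0r (powRM _ (ltW y1)); last by rewrite subr_ge0 ltW.
    rewrite (powR_inv1 (ltW y1)).
    have -> : c + (1 + y) * (x - c) = x + y * (x - c) by ring.
    by field; rewrite gt_eqF.
  rewrite (integral_swap_eq _ iA iQ iq); last by rewrite -(@integral_affineM _ q _ b).
  apply: eq_integral => x _; congr EFin; rewrite /A /q/Psi/= y0/=.
  case: (ltP c x) => cx/=; last by rewrite subrr mulr0.
  case: (ltP x 1) => x1/=.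
    by case: ltP => h1; rewrite ?subrr ?mulr0// sub0r mulrN.
  case: ltP => h1; last by rewrite subrr mulr0.
  by exfalso; nra.
have bE x y : c < x -> x < 1 ->
    (0 < y) && (1 <= c + (1 + y) * (x - c)) = ((1 - x) / (x - c) <= y).
  move=> cx x1; rewrite ler_pdivrMr ?subr_gt0//.
  by apply/idP/idP => [/andP[y0 ?]|?]; [nra|apply/andP; split; nra].
(* A positively homogeneous [f] lets one computation serve twice: with the absolute value for the
   integrability of [Psi], and with the identity for its iterated integral. *)
have Psiy x (f : R -> R) : f 0 = 0 -> c < x -> x < 1 -> (forall u v, 0 <= v -> f (- (v * u)) = v * f (- u)) ->
    (\int[leb]_y (f (Psi (x, y)))%:E =
      (f (- (h x * (x - c) `^ (- a) * (1 - x) `^ (a - 1) / (1 - a))))%:E)%E.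
  move=> f0 cx x1 fM; have xc0 : 0 < x - c by rewrite subr_gt0.
  have x10 : 0 < 1 - x by rewrite subr_gt0.
  transitivity (\int[leb]_y (if ((1 - x) / (x - c) <= y)%R then
     f (- (h x * (x - c) `^ (-1))) * y `^ (a - 2) else 0%R)%:E)%E.
    apply: eq_integral => y _; rewrite /Psi/= cx x1/= bE//; case: ifPn => _; last by rewrite f0.
    by rewrite fM ?powR_ge0// mulrC.
  rewrite integral_if_powRy ?divr_gt0//; last by lra.
  congr EFin; rewrite (_ : a - 2 + 1 = a - 1); last by ring.
  rewrite (powRM _ (ltW x10)) ?invr_ge0 ?(ltW xc0)// -powR_inv1 ?(ltW xc0)// -powRrM.
  rewrite mulrC -fM; last first.
    by rewrite mulr_ge0 ?mulr_ge0 ?powR_ge0// invr_ge0; lra.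
  have -> : (x - c) `^ (- a) = (x - c) `^ (-1) * (x - c) `^ (-1 * (a - 1)).
    by rewrite -powRD ?(gt_eqF xc0) ?implybT//; congr (_ `^ _); ring.
  by congr (f (- _)); rewrite (_ : - (a - 1) = 1 - a); ring.
have iPsi : (leb \x leb)%E.-integrable setT (EFin \o Psi).
  pose K := C / (1 - a) * (1 - c) `^ (th - a).
  have K0 : 0 <= K by rewrite mulr_ge0 ?powR_ge0// divr_ge0//; lra.
  apply: (@integrable_prod_le _ _ (fun x => if (c < x) && (x < 1) then K * (1 - x) `^ (a - 1) else 0)) => //.
  - by solve_meas.
  - by move=> x; case: ifPn => // _; rewrite mulr_ge0 ?powR_ge0.
  - move=> x; case: ifPn => [/andP[cx x1]|xc]; last first.
      rewrite integral0_eq// => y _; rewrite /Psi/= andbA (negbTE xc)/= normr0//.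
    have xc0 : 0 < x - c by rewrite subr_gt0.
    rewrite (Psiy x (fun v => `|v|)) ?normr0//; last first.
      by move=> u v v0; rewrite !normrN normrM ger0_norm.
    rewrite lee_fin normrN !normrM !(ger0_norm (powR_ge0 _ _)) (@ger0_norm _ (1 - a)^-1); last by rewrite invr_ge0; lra.
    rewrite /K [leRHS](_ : _ = (C * (1 - c) `^ (th - a)) * (1 - x) `^ (a - 1) / (1 - a)); last by ring.
    rewrite ler_wpM2r ?invr_ge0 ?ler_wpM2r ?powR_ge0//; first by lra.
    apply: (@le_trans _ _ (C * (x - c) `^ th * (x - c) `^ (- a))).
      by rewrite ler_wpM2r ?powR_ge0// hc'.
    rewrite -mulrA -powRD ?(gt_eqF xc0) ?implybT// ler_wpM2l//.
    by rewrite ge0_ler_powR ?nnegrE; lra.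
  - rewrite integral_if_powR_subl ?ltry//; first by apply: lt0r_neq0; lra.
    by left; lra.
rewrite !integral_itv_if.
transitivity (\int[leb]_x \int[leb]_y (Phi (x, y))%:E)%E.
  by apply: eq_integral => x _; rewrite Phiy in_itv.
transitivity (\int[leb]_y \int[leb]_x (Phi (x, y))%:E)%E; first exact: (Fubini iPhi).
transitivity (\int[leb]_y \int[leb]_x (Psi (x, y))%:E)%E.
  by apply: eq_integral => y _; exact: Phix.
transitivity (\int[leb]_x \int[leb]_y (Psi (x, y))%:E)%E; first exact/esym/(Fubini iPsi).
apply: eq_integral => x _; rewrite in_itv/=; case: ifPn => [/andP[cx x1]|xc].
  by apply: (Psiy x (fun v => v)) => // u v _; rewrite mulrN.
by rewrite integral0_eq// => y _; rewrite /Psi/= andbA (negbTE xc).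
Qed.

End Inversion.

Section LebesgueIntegrable.
Context {R : realType}.
Notation leb := (@lebesgue_measure R).
Context (D : set R) (mD : measurable D).

Lemma leb_integrableZl (k : R) (f : R -> R) :
  leb.-integrable D (EFin \o f) -> leb.-integrable D (EFin \o (fun x => k * f x)).
Proof.
by move=> fi; have := @integrableZl _ _ _ leb D mD k (EFin \o f) fi; apply: eq_integrable.
Qed.

Lemma leb_integrableD (f1 f2 : R -> R) :
  leb.-integrable D (EFin \o f1) -> leb.-integrable D (EFin \o f2) ->
  leb.-integrable D (EFin \o (fun x => f1 x + f2 x)).
Proof.
by move=> fi1 fi2; have := @integrableD _ _ _ leb D mD _ _ fi1 fi2; apply: eq_integrable.
Qed.

Lemma leb_le_integrable (f1 f2 : R -> R) : measurable_fun D f1 ->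
  (forall x, D x -> `|f1 x| <= f2 x) -> leb.-integrable D (EFin \o f2) ->
  leb.-integrable D (EFin \o f1).
Proof.
move=> mf f12; apply: (@le_integrable _ _ _ leb D mD (EFin \o f1) (EFin \o f2)).
  by apply/measurable_EFinP; exact: mf.
by move=> x Dx; rewrite lee_fin (le_trans (f12 x Dx))// ler_norm.
Qed.

End LebesgueIntegrable.

(** * The right derivative of a Hoelder function *)

Section RightDerivative.
Context {R : realType}.
Notation leb := (@lebesgue_measure R).

Lemma powR_le1 (x e : R) : 0 <= x -> x <= 1 -> 0 <= e -> x `^ e <= 1.
Proof.
move=> x0 x1 e0;
have : x `^ e <= 1 `^ e by apply: ge0_ler_powR => //; rewrite nnegrE.
by rewrite powR1.
Qed.

(** No section has to be integrable: the positive and negative parts have measurable integrals by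
    Tonelli, and [fine] turns infinite or undefined values into a measurable default. *)
Lemma measurable_fine_integral_section (K : R * R -> R) : measurable_fun setT K ->
  measurable_fun setT (fun x => fine (\int[leb]_y (K (x, y))%:E)%E).
Proof.
move=> mK; apply: measurableT_comp; first exact: fine_measurable.
have mK' : measurable_fun setT (EFin \o K) by apply/measurable_EFinP; exact: mK.
have mp := measurable_funepos mK'; have mn := measurable_funeneg mK'.
rewrite [X in measurable_fun _ X](_ : _ = (fun x =>
    (\int[leb]_y ((EFin \o K)^\+ (x, y)) - \int[leb]_y ((EFin \o K)^\- (x, y)))%E)).
  apply: emeasurable_funB.
    by apply: (@measurable_fun_fubini_tonelli_F _ _ _ _ _ leb ((EFin \o K)^\+)%E) => // z; rewrite funepos_ge0.
  by apply: (@measurable_fun_fubini_tonelli_F _ _ _ _ _ leb ((EFin \o K)^\-)%E) => // z; rewrite funeneg_ge0.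
apply/funext => x; rewrite integralE; congr (_ - _)%E.
  by apply: eq_integral => y _; rewrite !funeposE.
by apply: eq_integral => y _; rewrite !funenegE.
Qed.

(** The derivative on [0, 1] without its constant phase, so that the analysis stays real. *)
Definition right_deriv (a : R) (g : R -> R) (x : R) : R :=
  (Gamma a)^-1 *
   ((g x - g 1) / (1 - x) `^ (1 - a) +
    (1 - a) * \int[leb]_(u in `]x, 1[) right_kernel a (fun y => g y - g 1) x u) *
  \1_(`]0, 1[ : set R) x.

Lemma right_fderivE a g x :
  right_fderiv a 0 1 (fun y => g y - g 1) x = cexpi (pi * a) * (right_deriv a g x)%:C.
Proof. by []. Qed.

Lemma right_kernelE a (g : R -> R) c x u :
  right_kernel a (fun y => g y - c) x u = (g x - g u) * (u - x) `^ (a - 2).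
Proof.
rewrite /right_kernel -powRN; congr (_ * _ `^ _); ring.
Qed.

Context (a th C : R) (g : R -> R).
Context (a0 : 0 < a) (a1 : a < 1) (ath : a < th) (ath1 : 1 - a < th) (C0 : 0 <= C).
Context (mg : measurable_fun setT g).
Context (hg : forall u v, `|g u - g v| <= C * `|u - v| `^ th).

Let s := th + a - 1.
Let s0 : 0 < s. Proof. by have h := ath1; rewrite /s; lra. Qed.

Let If x u := if (x < u) && (u < 1) then (g x - g u) * (u - x) `^ (a - 2) else 0.

Lemma right_kernelE_integral x :
  \int[leb]_(u in `]x, 1[) right_kernel a (fun y => g y - g 1) x u =
  fine (\int[leb]_u (If x u)%:E)%E.
Proof.
rewrite /Rintegral integral_itv_if; congr fine; apply: eq_integral => u _.
by rewrite /If in_itv/=; case: ifPn => // _; rewrite right_kernelE.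
Qed.

Lemma right_kernel_itv_integrable x :
  leb.-integrable `]x, 1[ (EFin \o right_kernel a (fun y => g y - g 1) x).
Proof.
apply/integrable_mkcond => //.
have := @right_kernel_integrable _ a th C x 1 g ath1 C0 mg hg.
apply: eq_integrable => // u _; rewrite /= patchE mem_setE in_itv/=.
by case: ifPn => // _; rewrite right_kernelE.
Qed.

Lemma right_kernel_integral_le x : 0 <= x -> x < 1 ->
  `|fine (\int[leb]_u (If x u)%:E)%E| <= C / s.
Proof.
move=> x0 x1; have ik := @right_kernel_integrable _ a th C x 1 g ath1 C0 mg hg.
have fin := integrable_fin_num measurableT ik.
rewrite -lee_fin -[leLHS]abse_EFin fineK//.
apply: (le_trans (le_abse_integral _ _ _)) => //; first exact: measurable_int ik.
apply: (@le_trans _ _ (\int[leb]_u (if (x < u)%R && (u < 1)%R then C * (u - x) `^ (th + a - 2) else 0%R)%:E)%E).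
  apply: ge0_le_integral => //.
  - by apply: measurableT_comp => //; exact: measurable_int ik.
  - by apply/measurable_EFinP; solve_meas.
  - move=> u _; rewrite /If/= lee_fin; case: ifPn => [/andP[xu ub]|]; last by rewrite normr0.
    have ux : 0 < u - x by rewrite subr_gt0.
    rewrite normrM (ger0_norm (powR_ge0 _ _)) -addrA [in leRHS]powRD ?(gt_eqF ux) ?implybT// mulrA.
    by rewrite ler_wpM2r ?powR_ge0// distrC (le_trans (hg _ _))// gtr0_norm.
have s0' := s0; have sE : th + a - 2 + 1 = s by rewrite /s; ring.
rewrite integral_if_powR_subr//; rewrite ?sE ?gt_eqF//; last by left.
rewrite subrr powR0 ?gt_eqF// subr0 lee_fin mulrA ler_wpM2r ?invr_ge0 ?(ltW s0)//.
by rewrite -[leRHS]mulr1 ler_wpM2l// powR_le1 ?(ltW s0)//; lra.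
Qed.

Lemma measurable_right_deriv : measurable_fun setT (right_deriv a g).
Proof.
apply: measurable_funM; last exact: measurable_indic.
apply: measurable_funM => //; apply: measurable_funD.
  under eq_fun do rewrite -powRN; solve_meas.
apply: measurable_funM => //; under eq_fun do rewrite right_kernelE_integral.
apply: (@measurable_fine_integral_section (fun z => If z.1 z.2)).
by rewrite /If; solve_meas.
Qed.

(** Near 1 the boundary term is O((1-x)^(th+a-1)), and the integral is at most C/s; both use th > 1
    - a. This is the sup-norm half of the duality whose L_1 half is controlled by [fnorm]. *)
Lemma right_deriv_bounded : exists M, 0 <= M /\ forall x, `|right_deriv a g x| <= M.
Proof.
have s0' := s0.
have [Ga0 _] := Gamma_reflection_beta a0 a1.
exists ((Gamma a)^-1 * (C + (1 - a) * (C / s))).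
have a1' := a1; have ath1' := ath1.
have M0 : 0 <= (Gamma a)^-1 * (C + (1 - a) * (C / s)).
  rewrite mulr_ge0 ?invr_ge0 ?(ltW Ga0)// addr_ge0// mulr_ge0//; first by lra.
  by rewrite divr_ge0// ltW.
split => // x; rewrite /right_deriv indicE; have [|xn] := boolP (x \in _); last first.
  by rewrite mulr0 normr0.
rewrite inE/= in_itv/= => /andP[x0 x1]; rewrite mulr1.
rewrite right_kernelE_integral normrM gtr0_norm ?invr_gt0// ler_wpM2l ?invr_ge0 ?(ltW Ga0)//.
rewrite (le_trans (ler_normD _ _))// lerD//; last first.
  rewrite normrM ger0_norm; last by lra.
  by rewrite ler_wpM2l ?right_kernel_integral_le// ?ltW//; lra.
have x10 : 0 < 1 - x by rewrite subr_gt0.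
rewrite -powRN normrM (ger0_norm (powR_ge0 _ _)).
apply: (@le_trans _ _ (C * (1 - x) `^ th * (1 - x) `^ (- (1 - a)))).
  by rewrite ler_wpM2r ?powR_ge0// (le_trans (hg _ _))// distrC gtr0_norm.
rewrite -mulrA -powRD ?(gt_eqF x10) ?implybT//.
by rewrite -[leRHS]mulr1 ler_wpM2l// powR_le1; lra.
Qed.

Let B1 c x := (x - c) `^ (- a) * (1 - x) `^ (a - 1).

Lemma integral_beta_shift c : c < 1 ->
  (\int[leb]_(x in `]c, 1%R[) (B1 c x)%:E = (Gamma a * Gamma (1 - a))%:E)%E.
Proof.
move=> c1; have a0' := a0; have a1' := a1.
have b0 : 0 < 1 - a by lra.
have b1 : 1 - a < 1 by lra.
have c0 : 0 < 1 - c by lra.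
have [_ [_ E]] := Gamma_reflection_beta b0 b1.
rewrite (_ : Gamma a * _ = Gamma (1 - a) * Gamma (1 - (1 - a))); last first.
  by rewrite mulrC; congr (_ * Gamma _); ring.
rewrite -E -(beta_integral_scale b0 b1 c0) !integral_itv_if.
rewrite (@ge0_integral_affine _ 1 c ltr01); last 2 first.
- under eq_fun do rewrite in_itv/=.
  apply: measurable_fun_ifT; [solve_meas| |exact: measurable_cst].
  by apply/measurable_EFinP; rewrite /B1; solve_meas.
- by move=> x; case: ifPn => // _; rewrite lee_fin mulr_ge0 ?powR_ge0.
rewrite mul1e; apply: eq_integral => x _; rewrite !in_itv/= mul1r.
rewrite ltrDr -ltrBrDr; case: ifPn => // _; congr EFin; rewrite /B1.
by congr (_ `^ _ * _ `^ _); ring.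
Qed.

Lemma integrable_beta_shift c : c < 1 -> leb.-integrable `]c, 1[ (EFin \o B1 c).
Proof.
move=> c1; apply/integrableP; split.
  by apply: measurable_funTS; apply/measurable_EFinP; rewrite /B1; solve_meas.
apply: (@le_lt_trans _ _ (\int[leb]_(x in `]c, 1%R[) (B1 c x)%:E)%E); last first.
  by rewrite integral_beta_shift// ltry.
rewrite le_eqVlt (_ : (_ == _) = true)//; apply/eqP; apply: eq_integral => x _.
by rewrite /= ger0_norm// mulr_ge0 ?powR_ge0.
Qed.

(** Write g(x) - g(1) as h(x) + (g(c) - g(1)) with h = g - g(c). By [kernel_inversion] the
    contribution of h cancels against the integral term of the derivative; the constant g(c) - g(1)
    is multiplied by the Beta integral, one factor of which is removed by the normalization
    1/Gamma(a). *)
Lemma right_deriv_inversion c : 0 <= c -> c < 1 ->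
  \int[leb]_(x in `]c, 1[) ((x - c) `^ (- a) * right_deriv a g x) =
  - (g 1 - g c) * Gamma (1 - a).
Proof.
move=> c0 c1; have a0' := a0; have a1' := a1; have s0' := s0; have ath1' := ath1.
have [Ga0 _] := Gamma_reflection_beta a0 a1.
pose h x := g x - g c.
have hh u v : `|h u - h v| <= C * `|u - v| `^ th.
  by rewrite /h (_ : _ - _ = g u - g v)//; ring.
have mh : measurable_fun setT h by rewrite /h; solve_meas.
have hc : h c = 0 by rewrite /h subrr.
pose A1 x := h x * (x - c) `^ (- a) * (1 - x) `^ (a - 1).
pose I1 x := (x - c) `^ (- a) * fine (\int[leb]_u (If x u)%:E)%E.
have iB := integrable_beta_shift c1.
have leB (f : R -> R) K : measurable_fun setT f -> 0 <= K ->
    (forall x, c < x -> x < 1 -> `|f x| <= K * B1 c x) -> leb.-integrable `]c, 1[ (EFin \o f).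
  move=> mf K0 fK; apply: (leb_le_integrable _ _ _ (leb_integrableZl _ K iB)) => //.
    exact: measurable_funTS.
  by move=> x; rewrite /= in_itv/= => /andP[cx x1]; exact: fK.
have iA : leb.-integrable `]c, 1[ (EFin \o A1).
  apply: (@leB A1 C) => //; first by rewrite /A1; solve_meas.
  move=> x cx x1; rewrite /A1 /B1 !normrM !(ger0_norm (powR_ge0 _ _)) -mulrA.
  rewrite ler_wpM2r ?mulr_ge0 ?powR_ge0// -[h x]subr0 -hc (le_trans (hh _ _))//.
  rewrite -[leRHS]mulr1 ler_wpM2l// powR_le1//; first by rewrite gtr0_norm; lra.
  by have := ath; lra.
have iI : leb.-integrable `]c, 1[ (EFin \o I1).
  apply: (@leB I1 (C / s)) => //.
  - apply: measurable_funM; first solve_meas.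
    apply: (@measurable_fine_integral_section (fun z => If z.1 z.2)).
    by rewrite /If; solve_meas.
  - by rewrite divr_ge0// ltW.
  - move=> x cx x1; rewrite /I1 /B1 normrM (ger0_norm (powR_ge0 _ _)) mulrCA.
    rewrite ler_wpM2l ?powR_ge0// (le_trans (right_kernel_integral_le _ _))//; first lra.
    rewrite -[leLHS]mulr1 ler_wpM2l ?divr_ge0 ?(ltW s0)// powR_gt1_neg; lra.
have EI : \int[leb]_(x in `]c, 1[) I1 x = - (1 - a)^-1 * \int[leb]_(x in `]c, 1[) A1 x.
  rewrite -RintegralZl//; rewrite /Rintegral; congr fine.
  have := kernel_inversion a0 a1 ath ath1 C0 c1 mh hh hc.
  rewrite [X in _ = X -> _](_ : _ = (\int[leb]_(x in `]c, 1%R[) (- (1 - a)^-1 * A1 x)%:E)%E); last first.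
    by apply: eq_integral => x _; congr EFin; rewrite /A1; ring.
  move=> <-; apply: eq_integral => x; rewrite inE/= in_itv/= => /andP[cx x1].
  have ik := @right_kernel_integrable _ a th C x 1 g ath1 C0 mg hg.
  rewrite /I1 EFinM fineK; last exact: integrable_fin_num ik.
  rewrite -integralZl// integral_itv_if; apply: eq_integral => u _.
  rewrite in_itv/= /If; case: ifPn; rewrite ?mule0// -EFinM => _; congr (_ * (_ * _))%:E.
  by rewrite /h; ring.
have EB : \int[leb]_(x in `]c, 1[) B1 c x = Gamma a * Gamma (1 - a).
  by rewrite /Rintegral integral_beta_shift.
transitivity (\int[leb]_(x in `]c, 1[)
    ((Gamma a)^-1 * (A1 x + ((g c - g 1) * B1 c x + (1 - a) * I1 x)))).
  apply: eq_Rintegral => x; rewrite inE/= in_itv/= => /andP[cx x1].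
  rewrite /right_deriv indicE mem_set ?mulr1; last by rewrite /= in_itv/= x1 andbT; lra.
  rewrite right_kernelE_integral -powRN /A1 /B1 /I1 /h.
  rewrite (_ : - (1 - a) = a - 1); last by ring.
  by ring.
have iB' : leb.-integrable `]c, 1[ (EFin \o (fun x => (g c - g 1) * B1 c x)).
  exact: leb_integrableZl.
have iI' : leb.-integrable `]c, 1[ (EFin \o (fun x => (1 - a) * I1 x)).
  exact: leb_integrableZl.
have iBI : leb.-integrable `]c, 1[ (EFin \o (fun x => (g c - g 1) * B1 c x + (1 - a) * I1 x)).
  exact: leb_integrableD.
rewrite RintegralZl//; last exact: leb_integrableD.
rewrite RintegralD// RintegralD// RintegralZl// EB RintegralZl// EI.
by field; rewrite (gt_eqF Ga0) andbT subr_eq0 eq_sym lt_eqF.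
Qed.

End RightDerivative.

(** * The integral on functions of finite norm *)

Section FractionalNorm.
Context {R : realType}.
Notation leb := (@lebesgue_measure R).
Context (a : R) (a0 : 0 < a) (a1 : a < 1).
Implicit Types f : R -> R.

Let ae_filter : Filter (almost_everywhere leb).
Proof. exact: (@ae_filter_ringOfSetsType _ _ _ (@lebesgue_measure R)). Qed.

Definition fnorm_inner f (s : R) : \bar R :=
  (\int[leb]_(z in `[0%R, s]) (`|f s - f z| / (s - z) `^ (1 + a))%:E)%E.

Definition fnorm_density f (s : R) : \bar R :=
  ((`|f s| / (s - 0) `^ a)%:E + fnorm_inner f s)%E.

Lemma fnorm_densityE f :
  fnorm a 0 1 f = (\int[leb]_(s in `[0%R, 1%R]) fnorm_density f s)%E.
Proof. by []. Qed.

Lemma fnorm_inner_ge0 f s : (0 <= fnorm_inner f s)%E.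
Proof. by apply: integral_ge0 => z _; rewrite lee_fin divr_ge0 ?powR_ge0. Qed.

Lemma fnorm_density_ge0 f s : (0 <= fnorm_density f s)%E.
Proof.
by apply: adde_ge0; [rewrite lee_fin divr_ge0 ?powR_ge0|exact: fnorm_inner_ge0].
Qed.

Lemma fnorm_ge0 f : (0 <= fnorm a 0 1 f)%E.
Proof. by apply: integral_ge0 => s _; exact: fnorm_density_ge0. Qed.

Lemma measurable_fnorm_section f (D : set R) s : measurable_fun setT f ->
  measurable_fun D (fun z => (`|f s - f z| / (s - z) `^ (1 + a))%:E).
Proof.
move=> mf; apply: measurable_funTS; apply/measurable_EFinP.
by under eq_fun do rewrite -powRN; solve_meas.
Qed.

Lemma measurable_fnorm_density f : measurable_fun setT f ->
  measurable_fun setT (fnorm_density f).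
Proof.
move=> mf; apply: emeasurable_funD.
  by apply/measurable_EFinP; under eq_fun do rewrite -powRN; solve_meas.
pose k (z : R * R) : R := if (0 <= z.2) && (z.2 <= z.1) then
  `|f z.1 - f z.2| * (z.1 - z.2) `^ (- (1 + a)) else 0.
have mk : measurable_fun setT k by rewrite /k; solve_meas.
rewrite (_ : fnorm_inner f = (fun s => \int[leb]_z (k (s, z))%:E)%E).
  apply: (@measurable_fun_fubini_tonelli_F _ _ _ _ _ leb (EFin \o k)).
    by apply/measurable_EFinP; exact: mk.
  by move=> z; rewrite lee_fin /k; case: ifPn => // _; rewrite mulr_ge0 ?powR_ge0.
apply/funext => s; rewrite /fnorm_inner integral_itv_if; apply: eq_integral => z _.
by rewrite /k/= in_itv/=; case: ifPn => //; rewrite powRN.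
Qed.

(** Triangle inequality and homogeneity at once: every decomposition below is a combination of this
    shape. *)
Lemma fnorm_linear_le (k : R) f1 f2 : measurable_fun setT f1 -> measurable_fun setT f2 ->
  (fnorm a 0 1 (fun x => k * f1 x + f2 x)%R <= `|k|%:E * fnorm a 0 1 f1 + fnorm a 0 1 f2)%E.
Proof.
move=> m1 m2.
have mk : measurable_fun setT (fun x => k * f1 x + f2 x) by solve_meas.
rewrite !fnorm_densityE -ge0_integralZl//; last 2 first.
- by apply: measurable_funTS; exact: measurable_fnorm_density.
- by move=> s _; exact: fnorm_density_ge0.
rewrite -ge0_integralD//; last 4 first.
- by move=> s _; apply: mule_ge0 => //; exact: fnorm_density_ge0.
- by apply: measurable_funeM; apply: measurable_funTS; exact: measurable_fnorm_density.
- by move=> s _; exact: fnorm_density_ge0.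
- by apply: measurable_funTS; exact: measurable_fnorm_density.
apply: ge0_le_integral => //.
- by move=> s _; exact: fnorm_density_ge0.
- by apply: measurable_funTS; exact: measurable_fnorm_density.
- apply: emeasurable_funD; last by apply: measurable_funTS; exact: measurable_fnorm_density.
  by apply: measurable_funeM; apply: measurable_funTS; exact: measurable_fnorm_density.
move=> s _; rewrite /fnorm_density ge0_muleDr ?fnorm_inner_ge0 ?lee_fin ?divr_ge0 ?powR_ge0//.
rewrite addeACA leeD//.
  rewrite -EFinM -EFinD lee_fin mulrA -mulrDl ler_wpM2r ?invr_ge0 ?powR_ge0//.
  by rewrite (le_trans (ler_normD _ _))// normrM.
rewrite /fnorm_inner -ge0_integralZl//; last 2 first.
- exact: measurable_fnorm_section.
- by move=> z _; rewrite lee_fin divr_ge0 ?powR_ge0.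
rewrite -ge0_integralD//; last 4 first.
- by move=> z _; rewrite -EFinM lee_fin mulr_ge0// divr_ge0 ?powR_ge0.
- by apply: measurable_funeM; exact: measurable_fnorm_section.
- by move=> z _; rewrite lee_fin divr_ge0 ?powR_ge0.
- exact: measurable_fnorm_section.
apply: ge0_le_integral => //.
- by move=> z _; rewrite lee_fin divr_ge0 ?powR_ge0.
- by apply: (@measurable_fnorm_section (fun x => k * f1 x + f2 x)).
- apply: emeasurable_funD; last exact: measurable_fnorm_section.
  by apply: measurable_funeM; exact: measurable_fnorm_section.
move=> z _; rewrite -EFinM -EFinD lee_fin mulrA -mulrDl ler_wpM2r ?invr_ge0 ?powR_ge0//.
rewrite (_ : _ - _ = k * (f1 s - f1 z) + (f2 s - f2 z)); last by ring.
by rewrite (le_trans (ler_normD _ _))// normrM.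
Qed.

Let Gb0 : 0 < Gamma (1 - a) :> R.
Proof. by have [_ []] := Gamma_reflection_beta a0 a1. Qed.

Lemma left_kernel_integrable f x : measurable_fun setT f -> 0 <= x ->
  (fnorm_density f x < +oo)%E -> leb.-integrable `]0, x[ (EFin \o left_kernel a f x).
Proof.
move=> mf x0 foo; apply/integrableP; split.
  apply: measurable_funTS; apply/measurable_EFinP; rewrite /left_kernel.
  by under eq_fun do rewrite -powRN; solve_meas.
apply: (@le_lt_trans _ _ (fnorm_inner f x)); last first.
  apply: le_lt_trans foo; rewrite /fnorm_density -[leLHS]add0e leeD2r//.
  by rewrite lee_fin divr_ge0 ?powR_ge0.
rewrite /fnorm_inner (@integral_itv_bndoo _ 0 x _ true false); last exact: measurable_fnorm_section.
rewrite le_eqVlt (_ : (_ == _) = true)//; apply/eqP; apply: eq_integral => z _.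
by rewrite /left_kernel/= normrM normfV (ger0_norm (powR_ge0 _ _)).
Qed.

Lemma measurable_left_fderiv f : measurable_fun setT f -> measurable_fun setT (left_fderiv a 0 1 f).
Proof.
move=> mf; apply: measurable_funM; last exact: measurable_indic.
apply: measurable_funM => //; apply: measurable_funD.
  by under eq_fun do rewrite -powRN; solve_meas.
apply: measurable_funM => //.
pose k (z : R * R) : R := if (0 < z.2) && (z.2 < z.1) then
  (f z.1 - f z.2) * (z.1 - z.2) `^ (- (1 + a)) else 0.
rewrite [X in measurable_fun _ X](_ : _ = (fun x => fine (\int[leb]_u (k (x, u))%:E)%E)).
  by apply: measurable_fine_integral_section; rewrite /k; solve_meas.
apply/funext => x; rewrite /Rintegral integral_itv_if; congr fine; apply: eq_integral => u _.
by rewrite /k/= in_itv/=; case: ifPn => // _; rewrite /left_kernel powRN.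
Qed.

Lemma left_fderiv_le f x : measurable_fun setT f ->
  (`|left_fderiv a 0 1 f x|%:E <= (Gamma (1 - a))^-1%:E * fnorm_density f x)%E.
Proof.
move=> mf; have G0 : 0 <= (Gamma (1 - a))^-1 :> R by rewrite invr_ge0 ltW.
(* Where the density is infinite the bound is trivial; elsewhere the kernel is integrable, so the
   real integral in [left_fderiv] is a genuine one and not a default value. *)
have [foo|] := ltP (fnorm_density f x) +oo%E; last first.
  by rewrite leye_eq => /eqP ->; rewrite gt0_muley ?leey// lte_fin invr_gt0.
rewrite /left_fderiv indicE; have [|xn] := boolP (x \in _); last first.
  by rewrite mulr0 normr0 mule_ge0 ?fnorm_density_ge0// lee_fin.
rewrite inE/= in_itv/= => /andP[x0 x1]; rewrite mulr1.
have ik := left_kernel_integrable mf (ltW x0) foo.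
rewrite normrM ger0_norm// EFinM lee_wpmul2l ?lee_fin// /fnorm_density.
apply: (@le_trans _ _ ((`|f x| / (x - 0) `^ a)%:E +
   `|\int[leb]_(u in `]0, x[) left_kernel a f x u|%:E)%E).
  rewrite -EFinD lee_fin (le_trans (ler_normD _ _))// lerD//.
    by rewrite normrM normfV (ger0_norm (powR_ge0 _ _)).
  by rewrite normrM (gtr0_norm a0) ler_piMl// ltW.
rewrite leeD2l//; have fin := @integrable_fin_num _ _ _ leb `]0, x[ (measurable_itv _) _ ik.
rewrite /Rintegral -abse_EFin fineK//.
apply: (le_trans (le_abse_integral _ _ _)) => //; first exact: measurable_int ik.
rewrite /fnorm_inner (@integral_itv_bndoo _ 0 x _ true false); last exact: measurable_fnorm_section.
rewrite le_eqVlt (_ : (_ == _) = true)//; apply/eqP; apply: eq_integral => z _.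
by rewrite /left_kernel/= normrM normfV (ger0_norm (powR_ge0 _ _)).
Qed.

Lemma integral_left_fderiv_le f : measurable_fun setT f ->
  (\int[leb]_(x in `[0%R, 1%R]) `|left_fderiv a 0 1 f x|%:E <=
   (Gamma (1 - a))^-1%:E * fnorm a 0 1 f)%E.
Proof.
move=> mf; rewrite fnorm_densityE -ge0_integralZl//; last 3 first.
- by apply: measurable_funTS; exact: measurable_fnorm_density.
- by move=> s _; exact: fnorm_density_ge0.
- by rewrite lee_fin invr_ge0 ltW.
apply: ge0_le_integral => //.
- apply/measurable_EFinP; apply: measurable_funTS; apply: measurable_fun_normr.
  exact: measurable_left_fderiv.
- by apply: measurable_funeM; apply: measurable_funTS; exact: measurable_fnorm_density.
- by move=> x _; exact: left_fderiv_le.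
Qed.

Lemma integrable_left_fderiv f : measurable_fun setT f -> (fnorm a 0 1 f < +oo)%E ->
  leb.-integrable `[0, 1] (EFin \o left_fderiv a 0 1 f).
Proof.
move=> mf foo; apply/integrableP; split.
  by apply: measurable_funTS; apply/measurable_EFinP; exact: measurable_left_fderiv.
apply: (le_lt_trans (integral_left_fderiv_le mf)).
by rewrite lte_mul_pinfty// lee_fin invr_ge0 ltW.
Qed.

Lemma ae_fnorm_density_lty f : measurable_fun setT f -> (fnorm a 0 1 f < +oo)%E ->
  {ae leb, forall x, x \in `[0, 1] -> (fnorm_density f x < +oo)%E}.
Proof.
move=> mf foo.
have iN : leb.-integrable `[0, 1] (fnorm_density f).
  apply/integrableP; split; first by apply: measurable_funTS; exact: measurable_fnorm_density.
  apply: le_lt_trans foo; rewrite le_eqVlt (_ : (_ == _) = true)//; apply/eqP.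
  by apply: eq_integral => x _; rewrite gee0_abs ?fnorm_density_ge0.
have := @integrable_ae _ _ _ leb `[0, 1] (measurable_itv _) _ iN.
by apply: filterS => x h xin; have := h xin; rewrite fin_numE => /andP[_]; rewrite ltey.
Qed.

Lemma fnorm_left_fderiv_L1 f : measurable_fun setT f -> (fnorm a 0 1 f < +oo)%E ->
  left_fderiv_L1 a 0 1 f.
Proof.
move=> mf foo; split; last exact: integrable_left_fderiv.
have := ae_fnorm_density_lty mf foo; apply: (@filterS _ _ ae_filter) => x h xin.
move: xin (xin); rewrite {1}in_itv/= => /andP[x0 x1] xin.
apply: left_kernel_integrable => //; first exact: ltW.
by apply: h; rewrite in_itv/= !ltW.
Qed.

(** Only almost everywhere: the real integral is additive where both kernels are integrable, and
    finiteness of the norms guarantees this outside a null set. *)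
Lemma left_fderiv_linear (k : R) f1 f2 : measurable_fun setT f1 -> measurable_fun setT f2 ->
  (fnorm a 0 1 f1 < +oo)%E -> (fnorm a 0 1 f2 < +oo)%E ->
  {ae leb, forall x, x \in `[0, 1] -> left_fderiv a 0 1 (fun y => k * f1 y + f2 y) x =
     k * left_fderiv a 0 1 f1 x + left_fderiv a 0 1 f2 x}.
Proof.
move=> m1 m2 n1 n2.
have := ae_fnorm_density_lty m2 n2; have := ae_fnorm_density_lty m1 n1.
apply: (@filterS2 _ _ ae_filter) => x h1 h2 xin; have {}h1 := h1 xin; have {}h2 := h2 xin.
have x0 : 0 <= x by move: xin; rewrite in_itv/= => /andP[].
have i1 := left_kernel_integrable m1 x0 h1.
have i2 := left_kernel_integrable m2 x0 h2.
rewrite /left_fderiv.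
have -> : \int[leb]_(u in `]0, x[) left_kernel a (fun y => k * f1 y + f2 y) x u =
    k * \int[leb]_(u in `]0, x[) left_kernel a f1 x u +
    \int[leb]_(u in `]0, x[) left_kernel a f2 x u.
  rewrite -RintegralZl// -RintegralD//; last exact: leb_integrableZl.
  by apply: eq_Rintegral => u _; rewrite /left_kernel; ring.
by ring.
Qed.

End FractionalNorm.

(** * The integral as a continuous linear functional *)

Section GeneralizedIntegral.
Context {R : realType}.
Notation leb := (@lebesgue_measure R).

(** The strict inequality makes the steps left-continuous: a position chosen at time [c] is held
    only after [c], as adaptedness requires. *)
Definition step (c x : R) : R := if c < x then 1 else 0.

Lemma measurable_step c : measurable_fun setT (step c).
Proof. by rewrite /step; solve_meas. Qed.

Lemma normc_cexpi (p r : R) : Normc.normc (cexpi p * r%:C) = `|r|.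
Proof.
rewrite /cexpi /= mulr0 subr0 mulr0 add0r !exprMn -mulrDl cos2Dsin2 mul1r.
exact: sqrtr_sqr.
Qed.

Lemma right_fderiv_eq (a : R) (g1 g2 : R -> R) : {in `[0, 1], g1 =1 g2} ->
  right_fderiv a 0 1 (fun y => g1 y - g1 1) = right_fderiv a 0 1 (fun y => g2 y - g2 1).
Proof.
move=> g12; apply/funext => x; rewrite /right_fderiv indicE.
have [|_] := boolP (x \in _); last by rewrite !mulr0.
rewrite inE/= in_itv/= => /andP[x0 x1].
have E1 : g1 1 = g2 1 by rewrite g12// in_itv/= ler01 lexx.
have Ex : g1 x = g2 x by rewrite g12// in_itv/= !ltW.
rewrite E1 Ex; congr (_ * ((_ * (_ + _ * _) * _)%:C)).
apply: eq_Rintegral => u; rewrite inE/= in_itv/= => /andP[xu u1].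
by rewrite /right_kernel Ex g12// in_itv/= !ltW// (lt_trans x0).
Qed.

(** Serves to replace a path, Hoelder on [0, 1] only, by an extension that is Hoelder on the whole
    line. *)
Lemma gls_eq (a : R) (f g1 g2 : R -> R) : {in `[0, 1], g1 =1 g2} ->
  gls_integrable a 0 1 f g2 -> gls_integrable a 0 1 f g1 /\
  gls_integral a 0 1 f g1 = gls_integral a 0 1 f g2.
Proof.
move=> g12 [h1 [h2 h3 h4 h5]]; have E := right_fderiv_eq a g12.
split; last by rewrite /gls_integral E.
split=> //; split; rewrite ?E//.
apply: (@filterS _ _ (@ae_filter_ringOfSetsType _ _ _ leb)) h2 => x h xin.
have := h xin; apply: eq_integrable => // u; move: xin; rewrite inE/= !in_itv/= => /andP[x0 x1] /andP[xu u1].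
have hx : x \in `[0, 1] by rewrite in_itv/= !ltW.
have hu : u \in `[0, 1] by rewrite in_itv/= !ltW// (lt_trans x0).
have hone : (1 : R) \in `[0, 1] by rewrite in_itv/= ler01 lexx.
by rewrite /right_kernel (g12 x)// (g12 u)// (g12 1).
Qed.

Context (a th C : R) (g : R -> R).
Context (a0 : 0 < a) (a1 : a < 1) (ath : a < th) (ath1 : 1 - a < th) (C0 : 0 <= C).
Context (mg : measurable_fun setT g).
Context (hg : forall u v, `|g u - g v| <= C * `|u - v| `^ th).

(** The generalized integral is minus this number: the phases exp(i pi a) and exp(-i pi a) in its
    definition cancel. *)
Definition gls_re (f : R -> R) : R :=
  \int[leb]_(x in `[0, 1]) (left_fderiv a 0 1 f x * right_deriv a g x).

Let mrd := measurable_right_deriv a mg.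

Lemma integrable_gls_re f : measurable_fun setT f -> (fnorm a 0 1 f < +oo)%E ->
  leb.-integrable `[0, 1] (EFin \o (fun x => left_fderiv a 0 1 f x * right_deriv a g x)).
Proof.
move=> mf foo; have [M [M0 hM]] := right_deriv_bounded a0 a1 ath1 C0 mg hg.
have il := integrable_left_fderiv a0 a1 mf foo.
apply: (@leb_le_integrable _ _ _ _ (fun x => M * `|left_fderiv a 0 1 f x|)) => //.
- by apply: measurable_funM; apply: measurable_funTS; [exact: (measurable_left_fderiv a mf)|exact: mrd].
- by move=> x _; rewrite normrM mulrC ler_wpM2r.
- by apply: leb_integrableZl; [exact: measurable_itv|exact: integrable_norm].
Qed.

Lemma gls_re_linear k f1 f2 : measurable_fun setT f1 -> measurable_fun setT f2 ->
  (fnorm a 0 1 f1 < +oo)%E -> (fnorm a 0 1 f2 < +oo)%E ->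
  gls_re (fun x => k * f1 x + f2 x) = k * gls_re f1 + gls_re f2.
Proof.
move=> m1 m2 n1 n2; have i1 := integrable_gls_re m1 n1; have i2 := integrable_gls_re m2 n2.
have mk : measurable_fun setT (fun x => k * f1 x + f2 x) by solve_meas.
rewrite /gls_re -RintegralZl// -RintegralD//; last exact: leb_integrableZl.
rewrite /Rintegral; congr fine; apply: ae_eq_integral => //.
- apply: measurable_funTS; apply/measurable_EFinP; apply: measurable_funM; last exact: mrd.
  exact: (measurable_left_fderiv a mk).
- apply: measurable_funTS; apply/measurable_EFinP; apply: measurable_funD.
    apply: measurable_funM; first exact: measurable_cst.
    by apply: measurable_funM; [exact: (measurable_left_fderiv a m1)|exact: mrd].
  by apply: measurable_funM; [exact: (measurable_left_fderiv a m2)|exact: mrd].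
- apply: (@filterS _ _ (@ae_filter_ringOfSetsType _ _ _ leb)) (left_fderiv_linear k m1 m2 n1 n2).
  by move=> x h xin; rewrite h//; congr EFin; ring.
Qed.

(** Duality of L_1 and L_infty. This continuity for the norm is what allows the integral of an
    infinite series of blocks to be computed term by term. *)
Lemma gls_re_le : exists K, 0 <= K /\ forall f, measurable_fun setT f ->
  (fnorm a 0 1 f < +oo)%E -> `|gls_re f| <= K * fine (fnorm a 0 1 f).
Proof.
have [M [M0 hM]] := right_deriv_bounded a0 a1 ath1 C0 mg hg.
have [_ [Gb _]] := Gamma_reflection_beta a0 a1.
exists (M * (Gamma (1 - a))^-1); split; first by rewrite mulr_ge0 ?invr_ge0 ?(ltW Gb).
move=> f mf foo; have ii := integrable_gls_re mf foo.
have nfin : fnorm a 0 1 f \is a fin_num by rewrite ge0_fin_numE ?fnorm_ge0.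
rewrite -lee_fin EFinM fineK// EFinM -muleA.
apply: (@le_trans _ _ (M%:E * (\int[leb]_(x in `[0%R, 1%R]) `|left_fderiv a 0 1 f x|%:E))%E); last first.
  by rewrite lee_wpmul2l ?lee_fin//; exact: integral_left_fderiv_le.
have ml : measurable_fun setT (left_fderiv a 0 1 f) by exact: (measurable_left_fderiv a mf).
rewrite /gls_re /Rintegral -abse_EFin fineK; last exact: (@integrable_fin_num _ _ _ leb `[0, 1] (measurable_itv _) _ ii).
apply: (le_trans (le_abse_integral _ _ _)) => //; first exact: measurable_int ii.
rewrite -ge0_integralZl_EFin//; last first.
  by apply: measurable_funTS; apply/measurable_EFinP; exact: (measurable_fun_normr ml).
apply: ge0_le_integral => //.
- by apply: measurableT_comp => //; exact: measurable_int ii.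
- by apply: measurable_funeM; apply: measurable_funTS; apply/measurable_EFinP; exact: (measurable_fun_normr ml).
- by move=> x _; rewrite /= -EFinM lee_fin normrM mulrC ler_wpM2r.
Qed.

Lemma gls_of_fnorm f : measurable_fun setT f -> (fnorm a 0 1 f < +oo)%E ->
  gls_integrable a 0 1 f g /\ gls_integral a 0 1 f g = (- gls_re f)%:C.
Proof.
move=> mf foo; have ii := integrable_gls_re mf foo.
have [M [M0 hM]] := right_deriv_bounded a0 a1 ath1 C0 mg hg.
split; first split.
- exact: fnorm_left_fderiv_L1.
- split.
  + apply: (@filterS _ _ (@ae_filter_ringOfSetsType _ _ _ leb)) (filterT) => x _ xin.
    exact: (right_kernel_itv_integrable ath1 C0 mg hg).
  + apply: measurable_funTS; under eq_fun do rewrite right_fderivE/= mulr0 subr0.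
    by apply: measurable_funM; [exact: measurable_cst|exact: mrd].
  + apply: measurable_funTS; under eq_fun do rewrite right_fderivE/= mulr0 add0r.
    by apply: measurable_funM; [exact: measurable_cst|exact: mrd].
  + rewrite /finite_norm unlock/=; case: ifPn => // _.
    apply: (@le_lt_trans _ _ M%:E); last exact: ltry.
    apply/ess_supP; apply: nearW => x.
    suff h : (`|Normc.normc (right_fderiv a 0 1 (fun y => g y - g 1) x)|%:E <= M%:E)%E by exact: h.
    by rewrite lee_fin right_fderivE normc_cexpi normr_id; exact: hM.
rewrite /gls_integral /cintegral.
have -> : \int[leb]_(x in `[0, 1]) complex.Re ((left_fderiv a 0 1 f x)%:C *
    right_fderiv a 0 1 (fun y => g y - g 1) x) = cos (pi * a) * gls_re f.
  rewrite /gls_re -RintegralZl//; apply: eq_Rintegral => x _.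
  by rewrite right_fderivE/=; ring.
have -> : \int[leb]_(x in `[0, 1]) complex.Im ((left_fderiv a 0 1 f x)%:C *
    right_fderiv a 0 1 (fun y => g y - g 1) x) = sin (pi * a) * gls_re f.
  rewrite /gls_re -RintegralZl//; apply: eq_Rintegral => x _.
  by rewrite right_fderivE/=; ring.
rewrite /cexpi cosN sinN; move: (gls_re f) (cos2Dsin2 (pi * a)) => I h.
apply/eqP; rewrite eq_complex/=; apply/andP; split; apply/eqP; last by ring.
rewrite -[RHS]mul1r -h; ring.
Qed.

End GeneralizedIntegral.

Section StepFunctions.
Context {R : realType}.
Notation leb := (@lebesgue_measure R).
Context (a : R) (a0 : 0 < a) (a1 : a < 1).

Lemma powR_le_subr (s t e : R) : 0 <= t -> t < s -> e <= 0 -> s `^ e <= (s - t) `^ e.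
Proof. by move=> t0 ts e0; apply: powR_le_neg => //; lra. Qed.

Lemma integral_kernel_le (q s : R) : 0 <= q -> q < s ->
  (\int[leb]_(z in `[0%R, q]) ((s - z) `^ (- (1 + a)))%:E <= ((s - q) `^ (- a) / a)%:E)%E.
Proof.
move=> q0 qs; have a0' := a0.
rewrite (@integral_itv_bndoo _ 0 q _ true false); last first.
  by apply: measurable_funTS; apply/measurable_EFinP; solve_meas.
move: q0; rewrite le_eqVlt => /predU1P[<-|q0].
  by rewrite set_itv_ge ?bnd_simp ?ltxx// integral_set0 lee_fin divr_ge0 ?powR_ge0 ?ltW.
have eE : - (1 + a) + 1 = - a by ring.
have e0 : - (1 + a) + 1 != 0 by rewrite eE oppr_eq0 gt_eqF.
rewrite (integral_powR_subl (ltW qs) q0 e0 (or_intror qs)) eE.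
rewrite lee_fin subr0 (_ : _ / - a = ((s - q) `^ (- a) - s `^ (- a)) / a); last first.
  by rewrite invrN; ring.
by rewrite ler_wpM2r ?invr_ge0 ?(ltW a0)// lerBlDr lerDl powR_ge0.
Qed.

(* The last term is the tail from [t], where a Hoelder bound is available. *)
Lemma fnorm_inner_le (f : R -> R) (s t B p J H k : R) : measurable_fun setT f ->
  0 <= t -> t <= p -> p < s -> a < k -> 0 <= B -> 0 <= J -> 0 <= H ->
  (forall z, 0 <= z -> z <= s ->
     `|f s - f z| <= (if z <= t then B else 0) + (if z <= p then J else 0) +
        (if t < z then H * (s - z) `^ k else 0)) ->
  (fnorm_inner a f s <= (B * ((s - t) `^ (- a) / a) + J * ((s - p) `^ (- a) / a) +
     H * ((s - t) `^ (k - a) / (k - a)))%:E)%E.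
Proof.
move=> mf t0 tp ps ak B0 J0 H0 hf; have a0' := a0.
have p0 : 0 <= p by exact: le_trans tp.
have ts : t < s by exact: le_lt_trans ps.
pose K z : R := (s - z) `^ (- (1 + a)).
have K0 z : 0 <= K z by exact: powR_ge0.
pose u1 z : R := if z <= t then B * K z else 0.
pose u2 z : R := if z <= p then J * K z else 0.
pose u3 z : R := if (t < z) && (z < s) then H * (s - z) `^ (k - 1 - a) else 0.
have p1 z : 0 <= u1 z by rewrite /u1; case: ifPn => // _; rewrite mulr_ge0.
have p2 z : 0 <= u2 z by rewrite /u2; case: ifPn => // _; rewrite mulr_ge0.
have p3 z : 0 <= u3 z by rewrite /u3; case: ifPn => // _; rewrite mulr_ge0 ?powR_ge0.
have m1 : measurable_fun setT u1 by rewrite /u1 /K; solve_meas.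
have m2 : measurable_fun setT u2 by rewrite /u2 /K; solve_meas.
have m3 : measurable_fun setT u3 by rewrite /u3; solve_meas.
have me u : measurable_fun setT u -> measurable_fun `[0, s] (fun z : R => (u z : R)%:E).
  by move=> mu; apply: measurable_funTS; apply/measurable_EFinP; exact: mu.
apply: (@le_trans _ _ (\int[leb]_(z in `[0%R, s]) ((u1 z)%:E + (u2 z)%:E + (u3 z)%:E))%E).
  apply: ge0_le_integral => //.
  - by move=> z _; rewrite lee_fin divr_ge0 ?powR_ge0.
  - exact: measurable_fnorm_section.
  - by apply: emeasurable_funD; [apply: emeasurable_funD|]; exact: me.
  move=> z; rewrite /= in_itv/= => /andP[z0 zs]; rewrite -!EFinD lee_fin -powRN -/(K z).
  move: zs; rewrite le_eqVlt => /predU1P[->|zs].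
    by rewrite subrr normr0 mul0r !addr_ge0.
  have sz : 0 < s - z by rewrite subr_gt0.
  rewrite (le_trans (ler_wpM2r (K0 z) (hf z z0 (ltW zs))))// /u1 /u2 /u3 zs andbT !mulrDl.
  rewrite !lerD//; case: ifPn => // _; rewrite ?mul0r//.
  by rewrite -mulrA ler_wpM2l// /K -powRD ?(gt_eqF sz) ?implybT// (_ : k - 1 - a = k - (1 + a))//; ring.
rewrite ge0_integralD//; last 4 first.
- by move=> z _; rewrite -EFinD lee_fin addr_ge0.
- by apply: emeasurable_funD; exact: me.
- by move=> z _; rewrite lee_fin.
- exact: me.
rewrite ge0_integralD//; last 4 first.
- by move=> z _; rewrite lee_fin.
- exact: me.
- by move=> z _; rewrite lee_fin.
- exact: me.
have cut q Q : 0 <= q -> q < s -> 0 <= Q ->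
    (\int[leb]_(z in `[0%R, s]) (if (z <= q)%R then Q * K z else 0%R)%:E <= (Q * ((s - q) `^ (- a) / a))%:E)%E.
  move=> q0 qs Q0; rewrite EFinM.
  apply: (@le_trans _ _ (Q%:E * \int[leb]_(z in `[0%R, q]) (K z)%:E)%E); last first.
    by rewrite lee_wpmul2l ?lee_fin// integral_kernel_le.
  rewrite -ge0_integralZl_EFin//; last 2 first.
  - by move=> z _; rewrite lee_fin.
  - by apply: measurable_funTS; apply/measurable_EFinP; rewrite /K; solve_meas.
  rewrite !integral_itv_if le_eqVlt (_ : (_ == _) = true)//; apply/eqP; apply: eq_integral => z _.
  rewrite !in_itv/=; case: (leP z q) => zq; rewrite ?andbF; last by case: ifPn.
  by rewrite (le_trans zq (ltW qs)).
rewrite !EFinD; apply: leeD; first by apply: leeD; apply: cut.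
rewrite integral_itv_if.
apply: (@le_trans _ _ (\int[leb]_z (u3 z)%:E)%E).
  apply: ge0_le_integral => //.
  - by move=> z _; case: ifPn => // _; rewrite lee_fin.
  - under eq_fun do rewrite in_itv/=.
    by apply: measurable_fun_ifT; [solve_meas|apply/measurable_EFinP; exact: m3|exact: measurable_cst].
  - by apply/measurable_EFinP; exact: m3.
  - by move=> z _; case: ifPn => // _; rewrite lee_fin.
have kaE : k - 1 - a + 1 = k - a by ring.
have ka0 : 0 < k - a by lra.
rewrite /u3 integral_if_powR_subl//; rewrite ?kaE ?gt_eqF//; last by left.
by rewrite subrr powR0 ?gt_eqF// subr0.
Qed.

End StepFunctions.

(** * Step functions *)

Section StepNorm.
Context {R : realType}.
Notation leb := (@lebesgue_measure R).
Context (a : R) (a0 : 0 < a) (a1 : a < 1).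

Lemma fnorm_le (f U : R -> R) : measurable_fun setT f -> measurable_fun setT U ->
  (forall s, 0 < s -> s < 1 -> (fnorm_density a f s <= (U s)%:E)%E) ->
  (forall s, 0 <= U s) ->
  (fnorm a 0 1 f <= \int[leb]_s (U s)%:E)%E.
Proof.
move=> mf mU fU U0; rewrite fnorm_densityE (@integral_itv_bndoo _ 0 1 _ true false); last first.
  by apply: measurable_funTS; exact: measurable_fnorm_density.
apply: (@le_trans _ _ (\int[leb]_(s in `]0%R, 1%R[) (U s)%:E)%E).
  apply: ge0_le_integral => //.
  - by move=> s _; exact: fnorm_density_ge0.
  - by apply: measurable_funTS; exact: measurable_fnorm_density.
  - by apply: measurable_funTS; apply/measurable_EFinP; exact: mU.
  - by move=> s; rewrite /= in_itv/= => /andP[]; exact: fU.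
apply: ge0_subset_integral => //.
  by apply/measurable_EFinP; exact: mU.
by move=> s _; rewrite lee_fin.
Qed.

Lemma fnorm_inner0 (f : R -> R) s : (forall z, 0 <= z -> z <= s -> f z = f s) ->
  fnorm_inner a f s = 0%E.
Proof.
move=> fs; apply: integral0_eq => z; rewrite /= in_itv/= => /andP[z0 zs].
by rewrite fs// subrr normr0 mul0r.
Qed.

(** After the jump both the value and the inner integral are of order (s - c)^(-a), which is
    integrable as a < 1. The power of 1 - c makes jumps close to time 1 cheap. *)
Lemma fnorm_step_le (c : R) : 0 <= c -> c < 1 ->
  (fnorm a 0 1 (step c) <= ((1 + a^-1) * ((1 - c) `^ (1 - a) / (1 - a)))%:E)%E.
Proof.
move=> c0 c1; have a0' := a0; have a1' := a1.
pose U s : R := if (c < s) && (s < 1) then (1 + a^-1) * (s - c) `^ (- a) else 0.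
have K0 : 0 <= 1 + a^-1 by rewrite addr_ge0// invr_ge0 ltW.
have eE : - a + 1 = 1 - a by ring.
have e0 : 0 < - a + 1 by lra.
have := integral_if_powR_subr K0 (lexx c) c1 (lt0r_neq0 e0) (or_introl e0).
rewrite subrr (powR0 (lt0r_neq0 e0)) subr0 eE => <-.
apply: (@fnorm_le _ U); first exact: measurable_step.
- by rewrite /U; solve_meas.
- move=> s s0 s1; rewrite /U s1 andbT; case: ifPn => [cs|]; last first.
    rewrite -leNgt => sc; rewrite /fnorm_density fnorm_inner0.
      by rewrite /step ltNge sc/= normr0 mul0r adde0.
    by move=> z _ zs; rewrite /step !ltNge sc (le_trans zs sc).
  rewrite /fnorm_density mulrDl EFinD; apply: leeD.
    rewrite lee_fin /step cs normr1 mul1r mul1r -powRN subr0.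
    by apply: powR_le_subr => //; lra.
  apply: (le_trans (@fnorm_inner_le _ a a0 (step c) s c 1 c 0 0 1 _ _ _ _ _ _ _ _ _)) => //.
  - exact: measurable_step.
  - move=> z z0 zs; rewrite if_same addr0 mul0r if_same addr0 /step cs.
    by case: (leP z c) => zc; rewrite ?subr0 ?normr1// subrr normr0.
  - by rewrite !mul0r !addr0 mul1r mulrC.
- by move=> s; rewrite /U; case: ifPn => // _; rewrite mulr_ge0 ?powR_ge0.
Qed.

Lemma fnorm_step_lty (c : R) : 0 <= c -> c < 1 -> (fnorm a 0 1 (step c) < +oo)%E.
Proof. by move=> c0 c1; rewrite (le_lt_trans (fnorm_step_le c0 c1))// ltry. Qed.

(** For c < x, the integral over u <= c yields ((x-c)^(-a) - x^(-a))/a, and its second term cancels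
    the boundary term x^(-a). *)
Lemma left_fderiv_step (c x : R) : 0 <= c -> 0 < x -> x < 1 ->
  left_fderiv a 0 1 (step c) x = if c < x then (Gamma (1 - a))^-1 * (x - c) `^ (- a) else 0.
Proof.
move=> c0 x0 x1; have a0' := a0.
rewrite /left_fderiv indicE mem_set ?mulr1 /=; last by rewrite in_itv/= x0 x1.
rewrite subr0 /Rintegral integral_itv_if {1}/step; case: ifPn => [cx|]; last first.
  rewrite -leNgt => xc; rewrite mul0r integral0_eq ?mulr0 ?addr0 ?mulr0// => u _.
  rewrite in_itv/=; case: ifPn => // /andP[u0 ux].
  by rewrite /left_kernel /step !ltNge xc (le_trans (ltW ux) xc)/= subrr mul0r.
congr (_ * _); rewrite mul1r -powRN.
have eE : - (1 + a) + 1 = - a by ring.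
have e0 : - (1 + a) + 1 != 0 by rewrite eE oppr_eq0 gt_eqF.
rewrite (_ : integral _ _ _ = (((x - c) `^ (- a) - x `^ (- a)) / a)%:E).
  by rewrite /=; field; rewrite gt_eqF.
transitivity (\int[leb]_(u in `]0%R, c]) ((x - u) `^ (- (1 + a)))%:E)%E.
  rewrite integral_itv_if; apply: eq_integral => u _; rewrite !in_itv/=.
  rewrite /left_kernel /step cx powRN; case: (ltP 0 u) => u0//=.
  have [uc|cu] := leP u c; first by rewrite (le_lt_trans uc cx) subr0 mul1r.
  by case: ifPn => // _; rewrite subrr mul0r.
rewrite (@integral_itv_bndoo _ 0 c _ false false); last first.
  by apply: measurable_funTS; apply/measurable_EFinP; solve_meas.
move: c0 (cx); rewrite le_eqVlt => /predU1P[<-|c0] cx'.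
  by rewrite set_itv_ge ?bnd_simp ?ltxx// integral_set0 subr0 subrr mul0r.
rewrite (integral_powR_subl (ltW cx) c0 e0 (or_intror cx)) eE subr0; congr EFin.
by rewrite invrN; ring.
Qed.

Lemma powR_addr_le (x y k : R) : 0 <= x -> 0 <= y -> 0 < k -> k <= 1 ->
  (x + y) `^ k <= 2 * (x `^ k + y `^ k).
Proof.
wlog xy : x y / x <= y.
  move=> H x0 y0 k0 k1; have [xy|yx] := leP x y; first exact: H.
  by rewrite addrC [X in _ * X]addrC; apply: H => //; exact: ltW.
move=> x0 y0 k0 k1; apply: (@le_trans _ _ ((2 * y) `^ k)).
  by apply: ge0_ler_powR; rewrite ?nnegrE ?addr_ge0 ?mulr_ge0//; [exact: ltW|lra].
rewrite powRM//; apply: ler_pM; rewrite ?powR_ge0//.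
  by rewrite -[leRHS](powRr1 (ltW (ltr0Sn _ 1))); apply: ler_powR => //; rewrite ler1n.
by rewrite lerDr powR_ge0.
Qed.

(** The cells are open on the left and closed on the right. As a combination of steps, a block has
    an integral computable by linearity. *)
Definition block (v : nat -> R) (t h : R) (m : nat) (x : R) : R :=
  \sum_(i < m) v i * (step (t + i%:R * h) x - step (t + i.+1%:R * h) x).

Lemma measurable_block v t h m : measurable_fun setT (block v t h m).
Proof.
apply: measurable_sum => i; apply: measurable_funM => //; apply: measurable_funB;
  exact: measurable_step.
Qed.

Section Block.
Context (v : nat -> R) (t h : R) (m : nat) (h0 : 0 < h).

Let grid_le i j : (i <= j)%N -> t + i%:R * h <= t + j%:R * h.
Proof. by move=> ij; rewrite lerD2l ler_pM2r// ler_nat. Qed.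

Lemma block_cell j x : (j < m)%N -> t + j%:R * h < x -> x <= t + j.+1%:R * h ->
  block v t h m x = v j.
Proof.
move=> jm xj jx; rewrite /block (bigD1 (Ordinal jm))//= big1 ?addr0.
  by rewrite /step xj ltNge jx/= subr0 mulr1.
move=> i /eqP/val_eqP/= ij; rewrite /step.
have [ji|ji] := ltnP j i.
  have e1 : x <= t + i%:R * h by rewrite (le_trans jx)// grid_le.
  have e2 : x <= t + i.+1%:R * h by rewrite (le_trans jx)// grid_le// ltnW.
  by rewrite !ltNge e1 e2/= subrr mulr0.
have {}ij : (i < j)%N by rewrite ltn_neqAle ij.
have e1 : t + i%:R * h < x by rewrite (le_lt_trans _ xj)// grid_le// ltnW.
have e2 : t + i.+1%:R * h < x by rewrite (le_lt_trans _ xj)// grid_le.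
by rewrite e1 e2 subrr mulr0.
Qed.

Lemma block_left x : x <= t -> block v t h m x = 0.
Proof.
move=> xt; rewrite /block big1// => i _.
have e j : x <= t + j%:R * h by rewrite (le_trans xt)// lerDl mulr_ge0 ?(ltW h0).
by rewrite /step !ltNge !e subrr mulr0.
Qed.

Lemma block_right x : t + m%:R * h < x -> block v t h m x = 0.
Proof.
move=> xt; rewrite /block big1// => i _.
have e j : (j <= m)%N -> t + j%:R * h < x by move=> jm; rewrite (le_lt_trans _ xt)// grid_le.
by rewrite /step !e ?subrr ?mulr0// ltnW.
Qed.

Lemma cell_exists x : t < x -> x <= t + m%:R * h ->
  exists2 j, (j < m)%N & t + j%:R * h < x <= t + j.+1%:R * h.
Proof.
move=> tx; elim: m => [|n IH]; first by rewrite mul0r addr0 leNgt tx.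
move=> xn; have [xn'|nx] := leP x (t + n%:R * h); last by exists n; rewrite ?nx.
by have [j jn jx] := IH xn'; exists j => //; rewrite ltnW.
Qed.

End Block.

(** The left derivative of a step is a pure power supported after [c], so the pairing is exactly the
    integral in [right_deriv_inversion]. *)
Lemma gls_re_step (th C : R) (g : R -> R) (c : R) :
  a < th -> 1 - a < th -> 0 <= C -> measurable_fun setT g ->
  (forall u v, `|g u - g v| <= C * `|u - v| `^ th) -> 0 <= c -> c < 1 ->
  gls_re a g (step c) = - (g 1 - g c).
Proof.
move=> ath ath1 C0 mg hg c0 c1.
have [_ [Gb0 _]] := Gamma_reflection_beta a0 a1.
have := right_deriv_inversion a0 a1 ath ath1 C0 mg hg c0 c1 => E.
have {}E : \int[leb]_(x in `]c, 1[) ((Gamma (1 - a))^-1 * ((x - c) `^ (- a) * right_deriv a g x)) = - (g 1 - g c).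
  have [M [M0 hM]] := right_deriv_bounded a0 a1 ath1 C0 mg hg.
  rewrite RintegralZl//; first by rewrite E; field; rewrite gt_eqF.
  apply: (@leb_le_integrable _ _ _ _ (fun x => M * (if (c < x) && (x < 1) then 1 * (x - c) `^ (- a) else 0))) => //.
  - apply: measurable_funTS; apply: measurable_funM; first solve_meas.
    exact: (measurable_right_deriv a mg).
  - move=> x; rewrite /= in_itv/= => ->; rewrite normrM (ger0_norm (powR_ge0 _ _)) mul1r mulrC.
    by rewrite ler_wpM2r ?powR_ge0.
  - apply: leb_integrableZl; first exact: measurable_itv.
    apply: (@integrableS _ _ _ leb setT) => //.
    apply: (@integrable_le _ _ (fun x => if (c < x) && (x < 1) then 1 * (x - c) `^ (- a) else 0)).
    + by solve_meas.
    + by solve_meas.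
    + by move=> x; case: ifPn; rewrite ?normr0// ger0_norm// mul1r powR_ge0.
    + have a1' := a1; rewrite integral_if_powR_subr ?ltry//; first by apply: lt0r_neq0; lra.
      by left; lra.
rewrite -E /gls_re /Rintegral (@integral_itv_bndoo _ 0 1 _ true false); last first.
  apply: measurable_funTS; apply/measurable_EFinP; apply: measurable_funM.
    by apply: (@measurable_left_fderiv _ a (step c)); exact: measurable_step.
  exact: (measurable_right_deriv a mg).
congr fine; rewrite !integral_itv_if; apply: eq_integral => x _; rewrite !in_itv/=.
case: (ltP 0 x) => x0/=; last first.
  by rewrite ltNge (le_trans x0 c0).
case: (ltP x 1) => x1; last by rewrite andbF.
rewrite left_fderiv_step// andbT.
by case: (c < x); [congr EFin; exact/esym/mulrA|rewrite mul0r].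
Qed.

End StepNorm.

Section BlockNorm.
Context {R : realType}.
Notation leb := (@lebesgue_measure R).

(** The point is that the bound depends neither on the mesh nor on the number of cells. A Hoelder
    estimate between grid points fails for s and z close together on both sides of a grid point; the
    defect H h^k is charged to the cell of s, where it costs H h^k (s - c_j)^(-a). The sum over the
    cells is of order H (m h) h^(k-a), at most H (1-t)^(1+k-a). *)
Lemma fnorm_block_le (a : R) (v : nat -> R) (t h : R) (m : nat) (B H k : R) :
  0 < a -> a < 1 -> 0 < h -> 0 <= t -> t + m%:R * h < 1 -> a < k -> k <= 1 ->
  0 <= B -> 0 <= H -> (forall i, (i < m)%N -> `|v i| <= B) ->
  (forall i j, (i < j)%N -> (j < m)%N -> `|v j - v i| <= H * ((j - i)%:R * h) `^ k) ->
  (fnorm a 0 1 (block v t h m) <=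
   (((1 + 2 / a) / (1 - a) + 2 / (k - a) / (1 + k - a) + 4 / a / (1 - a)) *
    (B * (1 - t) `^ (1 - a) + H * (1 - t) `^ (1 + k - a)))%:E)%E.
Proof.
move=> a0 a1 h0 t0 t1 ak k1 B0 H0 vB vH.
pose t' := t + m%:R * h; pose f := block v t h m; pose W := 1 - t.
have mh0 : 0 <= m%:R * h by rewrite mulr_ge0 ?(ltW h0).
have tt' : t <= t' by rewrite /t' lerDl.
have tlt1 : t < 1 by exact: le_lt_trans t1.
have W0 : 0 < W by rewrite /W -/t' in t1 *; lra.
(* [K1] pays for the values and the jump at [t], [K2] for the return to zero at [t'], [K3] for the
   Hoelder part and [K4] for the jumps between cells; the factors 2 come from [powR_addr_le]. *)
pose K1 := B * (1 + a^-1); pose K2 := B / a; pose K3 := 2 * H / (k - a); pose K4 := 2 * H * h `^ k / a.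
have i0 : 0 <= a^-1 by rewrite invr_ge0 ltW.
have K10 : 0 <= K1 by rewrite mulr_ge0// addr_ge0.
have K20 : 0 <= K2 by rewrite mulr_ge0.
have K30 : 0 <= K3 by rewrite !mulr_ge0// invr_ge0; lra.
have K40 : 0 <= K4 by rewrite !mulr_ge0 ?powR_ge0.
pose U1 s : R := if (t < s) && (s < 1) then K1 * (s - t) `^ (- a) else 0.
pose U2 s : R := if (t' < s) && (s < 1) then K2 * (s - t') `^ (- a) else 0.
pose U3 s : R := if (t < s) && (s < 1) then K3 * (s - t) `^ (k - a) else 0.
pose c (j : nat) := t + j%:R * h.
(* The width 2 h, instead of h, lets the strict inequality include the closed right end of each
   cell. *)
pose U4 s : R := \sum_(j < m) if (c j < s) && (s < c j + 2 * h) then K4 * (s - c j) `^ (- a) else 0.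
have p1 s : 0 <= U1 s by rewrite /U1; case: ifPn => // _; rewrite mulr_ge0 ?powR_ge0.
have p2 s : 0 <= U2 s by rewrite /U2; case: ifPn => // _; rewrite mulr_ge0 ?powR_ge0.
have p3 s : 0 <= U3 s by rewrite /U3; case: ifPn => // _; rewrite mulr_ge0 ?powR_ge0.
have p4' j s : 0 <= if (c j < s) && (s < c j + 2 * h) then K4 * (s - c j) `^ (- a) else 0.
  by case: ifPn => // _; rewrite mulr_ge0 ?powR_ge0.
have p4 s : 0 <= U4 s by apply: sumr_ge0.
have m1 : measurable_fun setT U1 by rewrite /U1; solve_meas.
have m2 : measurable_fun setT U2 by rewrite /U2; solve_meas.
have m3 : measurable_fun setT U3 by rewrite /U3; solve_meas.
have m4' j : measurable_fun setT (fun s => if (c j < s) && (s < c j + 2 * h) then K4 * (s - c j) `^ (- a) else 0).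
  by solve_meas.
have m4 : measurable_fun setT U4 by apply: measurable_sum.
have mf : measurable_fun setT f by exact: measurable_block.
have fB s : `|f s| <= B.
  have [st|ts] := leP s t; first by rewrite /f (block_left v m h0 st) normr0.
  have [st'|t's] := leP s t'; last by rewrite /f (block_right v h0 t's) normr0.
  have [j jm /andP[j1 j2]] := @cell_exists _ t h m s ts st'.
  by rewrite /f (block_cell v h0 jm j1 j2) vB.
have me u : measurable_fun setT u -> measurable_fun setT (fun z : R => (u z : R)%:E).
  by move=> mu; apply/measurable_EFinP; exact: mu.
apply: (le_trans (@fnorm_le R a f (fun s => U1 s + U2 s + U3 s + U4 s) mf _ _ _)); last first.
- under eq_integral do rewrite !EFinD.
  rewrite ge0_integralD//; last 4 first.
  + by move=> s _; rewrite -!EFinD lee_fin !addr_ge0.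
  + by apply: emeasurable_funD; [apply: emeasurable_funD|]; exact: me.
  + by move=> s _; rewrite lee_fin.
  + exact: me.
  rewrite ge0_integralD//; last 4 first.
  + by move=> s _; rewrite -!EFinD lee_fin !addr_ge0.
  + by apply: emeasurable_funD; exact: me.
  + by move=> s _; rewrite lee_fin.
  + exact: me.
  rewrite ge0_integralD//; last 4 first.
  + by move=> s _; rewrite lee_fin.
  + exact: me.
  + by move=> s _; rewrite lee_fin.
  + exact: me.
  have e0 : 0 < - a + 1 by lra.
  have eE : - a + 1 = 1 - a by ring.
  have a1' : 0 < 1 - a by lra.
  have I1 : (\int[leb]_s (U1 s)%:E = (K1 * (W `^ (1 - a) / (1 - a)))%:E)%E.
    rewrite (integral_if_powR_subr K10 (lexx t) tlt1 (lt0r_neq0 e0) (or_introl e0)).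
    by rewrite subrr (powR0 (lt0r_neq0 e0)) subr0 eE.
  have I2 : (\int[leb]_s (U2 s)%:E <= (K2 * (W `^ (1 - a) / (1 - a)))%:E)%E.
    rewrite (integral_if_powR_subr K20 (lexx t') t1 (lt0r_neq0 e0) (or_introl e0)).
    rewrite subrr (powR0 (lt0r_neq0 e0)) subr0 eE lee_fin ler_wpM2l// ler_wpM2r ?invr_ge0 ?(ltW a1')//.
    by apply: ge0_ler_powR; rewrite ?nnegrE /W ?(ltW a1')//; rewrite -/t' in t1; lra.
  have I3 : (\int[leb]_s (U3 s)%:E = (K3 * (W `^ (1 + k - a) / (1 + k - a)))%:E)%E.
    have e3 : 0 < k - a + 1 by lra.
    rewrite (integral_if_powR_subr K30 (lexx t) tlt1 (lt0r_neq0 e3) (or_introl e3)).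
    by rewrite subrr (powR0 (lt0r_neq0 e3)) subr0 (_ : k - a + 1 = 1 + k - a)//; ring.
  have I4 : (\int[leb]_s (U4 s)%:E <= (4 * H / a / (1 - a) * W `^ (1 + k - a))%:E)%E.
    under eq_integral do rewrite /U4 -sumEFin.
    rewrite ge0_integral_sum//; last 2 first.
    + by move=> j; exact: me.
    + by move=> j s _; rewrite lee_fin.
    have Ij (j : 'I_m) : (\int[leb]_s (if (c j < s)%R && (s < c j + 2 * h)%R then K4 * (s - c j) `^ (- a) else 0%R)%:E
        = (K4 * ((2 * h) `^ (1 - a) / (1 - a)))%:E)%E.
      have cj : c j < c j + 2 * h by rewrite ltrDl mulr_gt0.
      rewrite (integral_if_powR_subr K40 (lexx _) cj (lt0r_neq0 e0) (or_introl e0)).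
      by rewrite subrr (powR0 (lt0r_neq0 e0)) subr0 eE addrAC subrr add0r.
    under eq_bigr do rewrite Ij.
    rewrite sumEFin sumr_const card_ord lee_fin -[X in X <= _]mulr_natl.
    have [->|m_gt0] := posnP m.
      by rewrite mul0r !mulr_ge0 ?powR_ge0 ?invr_ge0// ltW.
    have hm : h <= m%:R * h by rewrite -[leLHS]mul1r ler_pM2r// ler1n.
    have hW : m%:R * h <= W by rewrite /W -/t' in t1 *; rewrite /t' in t1; lra.
    have h2 : (2 * h) `^ (1 - a) <= 2 * h `^ (1 - a).
      rewrite powRM ?(ltW h0)// ler_wpM2r ?powR_ge0// -[leRHS](powRr1 (ltW (ltr0Sn _ 1))).
      by apply: ler_powR; [rewrite ler1n|lra].
    apply: (@le_trans _ _ (m%:R * (K4 * (2 * h `^ (1 - a) / (1 - a))))).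
      by rewrite ler_wpM2l// ler_wpM2l// ler_wpM2r// invr_ge0 ltW.
    have -> : m%:R * (K4 * (2 * h `^ (1 - a) / (1 - a))) =
        4 * H / a / (1 - a) * (m%:R * (h `^ k * h `^ (1 - a))).
      by rewrite /K4; ring.
    rewrite ler_wpM2l//; first by rewrite !mulr_ge0 ?invr_ge0// ltW.
    rewrite -powRD ?(gt_eqF h0) ?implybT//.
    have -> : k + (1 - a) = 1 + (k - a) by ring.
    rewrite powRD ?(gt_eqF h0) ?implybT// (powRr1 (ltW h0)) mulrA.
    have -> : 1 + k - a = 1 + (k - a) by ring.
    rewrite [leRHS]powRD ?(gt_eqF W0) ?implybT// (powRr1 (ltW W0)).
    apply: ler_pM; rewrite ?powR_ge0//.
    by apply: ge0_ler_powR; rewrite ?nnegrE ?(ltW h0) ?(ltW W0)//; lra.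
  apply: (@le_trans _ _ ((K1 * (W `^ (1 - a) / (1 - a)))%:E + (K2 * (W `^ (1 - a) / (1 - a)))%:E +
     (K3 * (W `^ (1 + k - a) / (1 + k - a)))%:E + (4 * H / a / (1 - a) * W `^ (1 + k - a))%:E)%E).
    by rewrite I1 I3; apply: leeD => //; rewrite leeD2r// leeD2l.
  rewrite -!EFinD lee_fin -/W.
  set w1 := W `^ (1 - a); set w2 := W `^ (1 + k - a).
  have w10 : 0 <= w1 by exact: powR_ge0.
  have w20 : 0 <= w2 by exact: powR_ge0.
  set A1 := (1 + 2 / a) / (1 - a); set A2 := 2 / (k - a) / (1 + k - a); set A3 := 4 / a / (1 - a).
  have A10 : 0 <= A1 by rewrite divr_ge0 ?(ltW a1')// addr_ge0// divr_ge0// ltW.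
  have A20 : 0 <= A2 by rewrite !divr_ge0//; lra.
  have A30 : 0 <= A3 by rewrite !divr_ge0// ltW.
  have -> : K1 * (w1 / (1 - a)) + K2 * (w1 / (1 - a)) + K3 * (w2 / (1 + k - a)) + 4 * H / a / (1 - a) * w2 =
      A1 * (B * w1) + (A2 + A3) * (H * w2).
    by rewrite /K1 /K2 /K3 /A1 /A2 /A3; ring.
  rewrite !mulrDl !mulrDr.
  have q1 : 0 <= A1 * (H * w2) := mulr_ge0 A10 (mulr_ge0 H0 w20).
  have q2 : 0 <= A2 * (B * w1) := mulr_ge0 A20 (mulr_ge0 B0 w10).
  have q3 : 0 <= A3 * (B * w1) := mulr_ge0 A30 (mulr_ge0 B0 w10).
  lra.
- by move=> s; rewrite !addr_ge0.
- move=> s s0 s1.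
  have [st|ts] := leP s t.
    rewrite /fnorm_density fnorm_inner0.
      by rewrite /f (block_left v m h0 st) normr0 mul0r adde0 lee_fin !addr_ge0.
    by move=> z _ zs; rewrite /f (block_left v m h0 st) (block_left v m h0 (le_trans zs st)).
  have f1 : (`|f s| / (s - 0) `^ a)%:E%E = (`|f s| * s `^ (- a))%:E%E by rewrite subr0 powRN.
  rewrite /fnorm_density f1.
  have [st'|t's] := leP s t'; last first.
    rewrite {1}/f (block_right v h0 t's) normr0 mul0r add0e.
    apply: (le_trans (@fnorm_inner_le _ a a0 f s t' B t' 0 0 1 mf _ _ _ _ _ _ _ _)) => //.
    + exact: le_trans tt'.
    + move=> z z0 zs; rewrite if_same addr0 mul0r if_same addr0 {1}/f (block_right v h0 t's) sub0r normrN.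
      by case: (leP z t') => zt'; [exact: fB|rewrite /f (block_right v h0 zt') normr0].
    + rewrite !mul0r !addr0 lee_fin /U2 t's s1/= (_ : B * _ = K2 * (s - t') `^ (- a)); last by rewrite /K2; ring.
      have := p1 s; have := p3 s; have := p4 s; lra.
  have [j jm /andP[j1 j2]] := @cell_exists _ t h m s ts st'.
  have tc : t <= c j by rewrite /c lerDl mulr_ge0// ltW.
  have fs : f s = v j by exact: (block_cell v h0 jm j1 j2).
  have U4j : K4 * (s - c j) `^ (- a) <= U4 s.
    rewrite /U4 (bigD1 (Ordinal jm))//= (_ : (c j < s) && _ = true); last first.
      by rewrite j1 /c (le_lt_trans j2)// -natr1 mulrDl mul1r addrA ltrD2l ltr_pMl// ltr1n.
    by rewrite lerDl sumr_ge0.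
  apply: (@le_trans _ _ ((B * (s - t) `^ (- a))%:E +
     (B * ((s - t) `^ (- a) / a) + (2 * H * h `^ k) * ((s - c j) `^ (- a) / a) +
     2 * H * ((s - t) `^ (k - a) / (k - a)))%:E)%E); last first.
    rewrite -EFinD lee_fin /U1 /U3 ts s1/=.
    have -> : B * (s - t) `^ (- a) + (B * ((s - t) `^ (- a) / a) +
        2 * H * h `^ k * ((s - c j) `^ (- a) / a) + 2 * H * ((s - t) `^ (k - a) / (k - a))) =
        K1 * (s - t) `^ (- a) + K3 * (s - t) `^ (k - a) + K4 * (s - c j) `^ (- a).
      by rewrite /K1 /K3 /K4; ring.
    by have := p2 s; lra.
  apply: leeD.
    by rewrite lee_fin ler_pM ?powR_ge0//; apply: powR_le_subr => //; lra.
  apply: (@fnorm_inner_le _ a a0 f s t B (c j) (2 * H * h `^ k) (2 * H) k mf) => //.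
  + by rewrite !mulr_ge0 ?powR_ge0.
  + by rewrite mulr_ge0.
  + move=> z z0 zs; have [zt|tz] := leP z t.
      have -> : f z = 0 := block_left v m h0 zt.
      rewrite subr0 addr0 (le_trans (fB s))// lerDl.
      by case: ifPn => // _; rewrite !mulr_ge0 ?powR_ge0.
    have [i im /andP[i1 i2]] := @cell_exists _ t h m z tz (le_trans zs st').
    have fz : f z = v i := block_cell v h0 im i1 i2.
    rewrite fs add0r fz.
    have ij : (i <= j)%N.
      rewrite leqNgt; apply/negP => ji.
      have : t + j.+1%:R * h <= t + i%:R * h by rewrite lerD2l ler_pM2r// ler_nat.
      by move=> hh; have := le_lt_trans (le_trans j2 hh) i1; rewrite ltNge zs.
    move: ij; rewrite leq_eqVlt => /predU1P[->|ij].
      rewrite subrr normr0 addr_ge0//; last by rewrite !mulr_ge0 ?powR_ge0.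
      by case: ifPn => // _; rewrite !mulr_ge0 ?powR_ge0.
    have zc : z <= c j by rewrite (le_trans i2)// /c lerD2l ler_pM2r// ler_nat.
    rewrite zc (le_trans (vH i j ij jm))//.
    have sz : 0 <= s - z by rewrite subr_ge0.
    have -> : 2 * H * h `^ k + 2 * H * (s - z) `^ k = H * (2 * (h `^ k + (s - z) `^ k)) by ring.
    rewrite ler_wpM2l//; apply: le_trans (powR_addr_le (ltW h0) sz _ k1); last exact: lt_trans ak.
    have hsz : 0 <= h + (s - z) := addr_ge0 (ltW h0) sz.
    apply: ge0_ler_powR; rewrite ?nnegrE ?hsz ?mulr_ge0 ?(ltW h0)//; first by lra.
    rewrite natrB ?(ltnW ij)// mulrBl; move: i2; rewrite -natr1 mulrDl mul1r.
    by rewrite /c in j1; lra.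
- apply: measurable_funD => //; apply: measurable_funD => //; exact: measurable_funD.
Qed.

End BlockNorm.

(** * Norms and integrals of infinite sums of functions *)

Section Series.
Context {R : realType}.
Notation leb := (@lebesgue_measure R).
Context (a : R) (a0 : 0 < a) (a1 : a < 1).

Lemma fnorm_linear_lty (k : R) (f1 f2 : R -> R) : measurable_fun setT f1 -> measurable_fun setT f2 ->
  (fnorm a 0 1 f1 < +oo)%E -> (fnorm a 0 1 f2 < +oo)%E ->
  (fnorm a 0 1 (fun x => k * f1 x + f2 x)%R < +oo)%E.
Proof.
move=> m1 m2 n1 n2; apply: (le_lt_trans (fnorm_linear_le a k m1 m2)).
by apply: lte_add_pinfty => //; apply: lte_mul_pinfty.
Qed.

Lemma fnorm0_lty : (fnorm a 0 1 (fun _ => 0%R) < +oo)%E.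
Proof.
have := fnorm_linear_lty (-1) (measurable_step 0) (measurable_step 0)
  (fnorm_step_lty a0 a1 (lexx 0) ltr01) (fnorm_step_lty a0 a1 (lexx 0) ltr01).
by under eq_fun do rewrite mulN1r addNr.
Qed.

Lemma block_recr v t h m : @block R v t h m.+1 =
  (fun x => v m * ((-1) * step (t + m.+1%:R * h) x + step (t + m%:R * h) x) + block v t h m x).
Proof.
by apply/funext => x; rewrite /block big_ord_recr/= addrC; congr (_ * _ + _); rewrite mulN1r addrC.
Qed.

Lemma fnorm_block_lty v t h m : 0 <= t -> 0 <= h -> t + m%:R * h < 1 ->
  (fnorm a 0 1 (@block R v t h m) < +oo)%E.
Proof.
move=> t0 h0; elim: m => [_|m IH t1].
  by rewrite (_ : block _ _ _ _ = fun=> 0) ?fnorm0_lty//; apply/funext => x; rewrite /block big_ord0.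
have tm : t + m%:R * h < 1 by rewrite (le_lt_trans _ t1)// lerD2l ler_wpM2r// ler_nat.
have p j : 0 <= t + j%:R * h by rewrite addr_ge0// mulr_ge0.
have m1 : measurable_fun setT (fun x => -1 * step (t + m.+1%:R * h) x + step (t + m%:R * h) x).
  apply: measurable_funD; last exact: measurable_step.
  by apply: measurable_funM => //; exact: measurable_step.
rewrite block_recr; apply: fnorm_linear_lty => //; [exact: measurable_block| |exact: IH].
by apply: fnorm_linear_lty; try exact: measurable_step; exact: fnorm_step_lty.
Qed.

(** At each point before 1 the series is a finite sum, so the triangle inequality holds pointwise,
    for two points up to the larger of the two ranks; monotone convergence exchanges sums and
    integrals. The point 1 is discarded by passing to the open interval. *)
Lemma fnorm_series (f : R -> R) (f_ : nat -> R -> R) : measurable_fun setT f ->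
  (forall n, measurable_fun setT (f_ n)) ->
  (forall u, 0 <= u -> u < 1 -> exists N, forall n, (N <= n)%N -> f u = \sum_(i < n) f_ i u) ->
  (fnorm a 0 1 f <= \sum_(n <oo) fnorm a 0 1 (f_ n))%E.
Proof.
move=> mf mf_ hf.
have le_series (c : nat -> R) n : (`|\sum_(i < n) c i|%:E <= \sum_(i <oo) `|c i|%:E)%E.
  apply: (@le_trans _ _ (\sum_(0 <= i < n) `|c i|%:E)%E); last exact: nneseries_lim_ge.
  by rewrite big_mkord sumEFin lee_fin ler_norm_sum.
have E n : fnorm a 0 1 (f_ n) = (\int[leb]_(s in `]0%R, 1%R[) fnorm_density a (f_ n) s)%E.
  rewrite fnorm_densityE (@integral_itv_bndoo _ 0 1 _ true false)//.
  by apply: measurable_funTS; exact: measurable_fnorm_density.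
rewrite (eq_eseriesr (fun n _ => E n)) -integral_nneseries//; last 2 first.
- by move=> n; apply: measurable_funTS; exact: measurable_fnorm_density.
- by move=> n s _; exact: fnorm_density_ge0.
rewrite fnorm_densityE (@integral_itv_bndoo _ 0 1 _ true false); last first.
  by apply: measurable_funTS; exact: measurable_fnorm_density.
apply: ge0_le_integral => //.
- by move=> s _; exact: fnorm_density_ge0.
- by apply: measurable_funTS; exact: measurable_fnorm_density.
- apply: ge0_emeasurable_sum => //.
  + by move=> n s _ _; exact: fnorm_density_ge0.
  + by move=> n _; apply: measurable_funTS; exact: measurable_fnorm_density.
move=> s; rewrite /= in_itv/= => /andP[s0 s1].
have [N hN] := hf s (ltW s0) s1.
rewrite /fnorm_density nneseriesD//; last 2 first.
- by move=> n _ _; rewrite lee_fin divr_ge0 ?powR_ge0.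
- by move=> n _ _; exact: fnorm_inner_ge0.
apply: leeD.
  apply: (@le_trans _ _ (\sum_(n <oo) `|f_ n s / (s - 0) `^ a|%:E)%E); last first.
    apply: lee_nneseries => // n _.
    by rewrite normrM normfV (ger0_norm (powR_ge0 _ _)).
  rewrite (_ : `|f s| / _ = `|\sum_(i < N) (f_ i s / (s - 0) `^ a)|); first exact: le_series.
  by rewrite -mulr_suml -hN// normrM normfV (ger0_norm (powR_ge0 _ _)).
rewrite /fnorm_inner -integral_nneseries//; last 2 first.
- by move=> n; exact: measurable_fnorm_section.
- by move=> n z _; rewrite lee_fin divr_ge0 ?powR_ge0.
apply: ge0_le_integral => //.
- by move=> z _; rewrite lee_fin divr_ge0 ?powR_ge0.
- exact: measurable_fnorm_section.
- apply: ge0_emeasurable_sum => //.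
  + by move=> n z _ _; rewrite lee_fin divr_ge0 ?powR_ge0.
  + by move=> n _; exact: measurable_fnorm_section.
move=> z; rewrite /= in_itv/= => /andP[z0 zs].
have [N' hN'] := hf z z0 (le_lt_trans zs s1).
apply: (@le_trans _ _ (\sum_(n <oo) `|(f_ n s - f_ n z) / (s - z) `^ (1 + a)|%:E)%E); last first.
  apply: lee_nneseries => // n _.
  by rewrite normrM normfV (ger0_norm (powR_ge0 _ _)).
rewrite (_ : `|f s - f z| / _ = `|\sum_(i < maxn N N') ((f_ i s - f_ i z) / (s - z) `^ (1 + a))|); first exact: le_series.
rewrite -mulr_suml big_split/= sumrN -hN ?leq_maxl// -hN' ?leq_maxr//.
by rewrite normrM normfV (ger0_norm (powR_ge0 _ _)).
Qed.

Lemma geometric_partial_le (K q : R) N : 0 <= K -> 0 <= q -> q < 1 ->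
  \sum_(i < N) K * q ^+ i <= K / (1 - q).
Proof.
move=> K0 q0 q1; have q1' : 0 < 1 - q by rewrite subr_gt0.
rewrite ler_pdivlMr// -mulr_sumr -mulrA -[leRHS]mulr1 ler_wpM2l// mulrC.
rewrite (_ : (1 - q) * _ = 1 - q ^+ N).
  by rewrite lerBlDr lerDl exprn_ge0.
elim: N => [|N IH]; first by rewrite big_ord0 mulr0 expr0 subrr.
by rewrite big_ord_recr/= mulrDr IH exprS; ring.
Qed.

Lemma fnorm_series_geometric (f : R -> R) (f_ : nat -> R -> R) (K q : R) : measurable_fun setT f ->
  (forall n, measurable_fun setT (f_ n)) ->
  (forall u, 0 <= u -> u < 1 -> exists N, forall n, (N <= n)%N -> f u = \sum_(i < n) f_ i u) ->
  0 <= K -> 0 <= q -> q < 1 -> (forall n, (fnorm a 0 1 (f_ n) <= (K * q ^+ n)%:E)%E) ->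
  (fnorm a 0 1 f <= (K / (1 - q))%:E)%E.
Proof.
move=> mf mf_ hf K0 q0 q1 hn; apply: (le_trans (fnorm_series mf mf_ hf)).
apply: lime_le; first by apply: is_cvg_nneseries => n _ _; exact: fnorm_ge0.
apply: nearW => N; apply: (@le_trans _ _ (\sum_(0 <= n < N) (K * q ^+ n)%:E)%E).
  by apply: lee_sum => n _.
by rewrite big_mkord sumEFin lee_fin geometric_partial_le.
Qed.

End Series.

Section SeriesIntegral.
Context {R : realType}.
Notation leb := (@lebesgue_measure R).
Context (a th C : R) (g : R -> R).
Context (a0 : 0 < a) (a1 : a < 1) (ath : a < th) (ath1 : 1 - a < th) (C0 : 0 <= C).
Context (mg : measurable_fun setT g).
Context (hg : forall u v, `|g u - g v| <= C * `|u - v| `^ th).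

Let lin k f1 f2 : measurable_fun setT f1 -> measurable_fun setT f2 ->
  (fnorm a 0 1 f1 < +oo)%E -> (fnorm a 0 1 f2 < +oo)%E ->
  gls_re a g (fun x => k * f1 x + f2 x) = k * gls_re a g f1 + gls_re a g f2.
Proof. exact: (gls_re_linear a0 a1 ath1 C0 mg hg k). Qed.

Lemma gls_re0 : gls_re a g (fun _ => 0) = 0.
Proof.
have ms := @measurable_step R 0; have ns := @fnorm_step_lty R a a0 a1 0 (lexx 0) ltr01.
have := lin (-1) ms ms ns ns; rewrite mulN1r addNr => E; rewrite -[RHS]E.
by congr gls_re; apply/funext => x; rewrite mulN1r addNr.
Qed.

Lemma gls_re_block v t h m : 0 <= t -> 0 <= h -> t + m%:R * h < 1 ->
  gls_re a g (block v t h m) = - \sum_(i < m) v i * (g (t + i.+1%:R * h) - g (t + i%:R * h)).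
Proof.
move=> t0 h0; elim: m => [_|m IH t1].
  rewrite (_ : block _ _ _ _ = fun=> 0) ?gls_re0 ?big_ord0 ?oppr0//.
  by apply/funext => x; rewrite /block big_ord0.
have tm : t + m%:R * h < 1 by rewrite (le_lt_trans _ t1)// lerD2l ler_wpM2r// ler_nat.
have p j : 0 <= t + j%:R * h by rewrite addr_ge0// mulr_ge0.
have ms c := @measurable_step R c.
have n1 := @fnorm_step_lty R a a0 a1 _ (p m.+1) t1.
have n2 := @fnorm_step_lty R a a0 a1 _ (p m) tm.
have m1 : measurable_fun setT (fun x => -1 * step (t + m.+1%:R * h) x + step (t + m%:R * h) x).
  apply: measurable_funD; last exact: measurable_step.
  by apply: measurable_funM => //; exact: measurable_step.
have n3 := fnorm_linear_lty (-1) (ms _) (ms _) n1 n2.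
have nb := fnorm_block_lty a0 a1 v t0 h0 tm.
rewrite block_recr (lin (v m) m1 (@measurable_block R v t h m) n3 nb).
rewrite (lin (-1) (ms _) (ms _) n1 n2) (IH tm).
rewrite (gls_re_step a0 a1 ath ath1 C0 mg hg (p m.+1) t1).
rewrite (gls_re_step a0 a1 ath ath1 C0 mg hg (p m) tm) big_ord_recr/=.
by ring.
Qed.

Lemma gls_re_sum (f_ : nat -> R -> R) k : (forall n, measurable_fun setT (f_ n)) ->
  (forall n, (fnorm a 0 1 (f_ n) < +oo)%E) ->
  (fnorm a 0 1 (fun x => \sum_(n < k) f_ n x)%R < +oo)%E /\
  gls_re a g (fun x => \sum_(n < k) f_ n x) = \sum_(n < k) gls_re a g (f_ n).
Proof.
move=> mf nf; elim: k => [|k [IH1 IH2]].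
  rewrite (_ : (fun x => _) = fun=> 0); last by apply/funext => x; rewrite big_ord0.
  by rewrite big_ord0 gls_re0; split => //; exact: fnorm0_lty.
have mk : measurable_fun setT (fun x => \sum_(n < k) f_ n x) by exact: measurable_sum.
rewrite (_ : (fun x => _) = fun x => 1 * f_ k x + \sum_(n < k) f_ n x); last first.
  by apply/funext => x; rewrite big_ord_recr/= mul1r addrC.
split; first exact: (fnorm_linear_lty 1 (mf k) mk (nf k) IH1).
by rewrite (lin 1 (mf k) mk (nf k) IH1) IH2 big_ord_recr/= mul1r addrC.
Qed.

(** The remainder after k terms is a series of the same kind, shifted by k, so its norm is O(q^k);
    the continuity bound [gls_re_le] transfers this to the integrals. *)
Lemma gls_re_series (f : R -> R) (f_ : nat -> R -> R) (K q l : R) : measurable_fun setT f ->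
  (forall n, measurable_fun setT (f_ n)) ->
  (forall u, 0 <= u -> u < 1 -> exists N, forall n, (N <= n)%N -> f u = \sum_(i < n) f_ i u) ->
  0 <= K -> 0 <= q -> q < 1 -> (forall n, (fnorm a 0 1 (f_ n) <= (K * q ^+ n)%:E)%E) ->
  \sum_(n < k) gls_re a g (f_ n) @[k --> \oo] --> l ->
  (fnorm a 0 1 f < +oo)%E /\ gls_re a g f = l.
Proof.
move=> mf mf_ hf K0 q0 q1 hn hl.
have nf_ n : (fnorm a 0 1 (f_ n) < +oo)%E by rewrite (le_lt_trans (hn n))// ltry.
have nf : (fnorm a 0 1 f < +oo)%E.
  by rewrite (le_lt_trans (fnorm_series_geometric mf mf_ hf K0 q0 q1 hn))// ltry.
split => //.
have [L [L0 hL]] := gls_re_le a0 a1 ath1 C0 mg hg.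
have tail k : `|gls_re a g f - \sum_(n < k) gls_re a g (f_ n)| <= L * (K / (1 - q)) * q ^+ k.
  have [ns <-] := gls_re_sum k mf_ nf_.
  have mk : measurable_fun setT (fun x => \sum_(n < k) f_ n x) by exact: measurable_sum.
  pose r x := -1 * (\sum_(n < k) f_ n x) + f x.
  have mr : measurable_fun setT r.
    by apply: measurable_funD => //; apply: measurable_funM.
  have nr : (fnorm a 0 1 r < +oo)%E := fnorm_linear_lty (-1) mk mf ns nf.
  rewrite (_ : _ - _ = gls_re a g r); last by rewrite (lin (-1) mk mf ns nf); ring.
  apply: (le_trans (hL r mr nr)); rewrite -!mulrA ler_wpM2l//.
  rewrite -lee_fin fineK ?ge0_fin_numE ?fnorm_ge0//.
  rewrite (_ : K * _ = (K * q ^+ k) / (1 - q)); last by ring.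
  apply: (@fnorm_series_geometric _ _ r (fun n => f_ (k + n)%N)) => //.
  - move=> u u0 u1; have [N hN] := hf u u0 u1; exists N => n Nn.
    by rewrite /r (hN (k + n)%N) ?(leq_trans Nn) ?leq_addl// big_split_ord/= mulN1r addKr.
  - by rewrite mulr_ge0// exprn_ge0.
  - by move=> n; rewrite -mulrA -exprD.
have hq : q ^+ k @[k --> \oo] --> 0 by apply: cvg_expr; rewrite ger0_norm.
have h0 : gls_re a g f - \sum_(n < k) gls_re a g (f_ n) @[k --> \oo] --> 0.
  have hh : L * (K / (1 - q)) * q ^+ k @[k --> \oo] --> 0.
    by rewrite -[X in _ --> X](mulr0 (L * (K / (1 - q)))); apply: cvgMl_tmp.
  apply/cvgr0Pnorm_le => e e0; move/cvgr0Pnorm_le: hh => /(_ e e0).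
  by apply: filterS => k; apply: le_trans; exact: le_trans (tail k) (ler_norm _).
have h1 : gls_re a g f - \sum_(n < k) gls_re a g (f_ n) @[k --> \oo] --> gls_re a g f - l.
  by apply: cvgB => //; exact: cvg_cst.
by apply/eqP; rewrite -subr_eq0; apply/eqP; apply: (cvg_unique _ h1 h0).
Qed.

End SeriesIntegral.

(** * The strategy along a path *)

Section DiscreteStopping.
Context {R : realType}.

Lemma sum_square_increments (Y : nat -> R) n :
  \sum_(i < n) Y i * (Y i.+1 - Y i) =
  (Y n ^+ 2 - Y 0%N ^+ 2 - \sum_(i < n) (Y i.+1 - Y i) ^+ 2) / 2.
Proof.
elim: n => [|n IH]; first by rewrite !big_ord0 subrr subr0 mul0r.
by rewrite !big_ord_recr/= IH; field.
Qed.

(** Depends only on the values up to index i, which keeps the stopped position adapted. *)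
Definition active (e : R) (Y : nat -> R) (i : nat) : bool :=
  all (fun j => `|Y j| < e) (iota 0 i.+1).

Lemma activeP e Y i : reflect (forall j, (j <= i)%N -> `|Y j| < e) (active e Y i).
Proof.
apply: (iffP allP) => h j; first by move=> ji; apply: h; rewrite mem_iota add0n ltnS.
by rewrite mem_iota add0n ltnS => /andP[_]; exact: h.
Qed.

(** [tau.+1] is the first index that reaches the level; it is positive because Y starts at 0 < e.
    The level is overshot by at most one increment. *)
Lemma stopping (e eta : R) (Y : nat -> R) (m : nat) : 0 < e -> 0 <= eta -> Y 0%N = 0 ->
  (forall i, (i < m)%N -> `|Y i.+1 - Y i| <= eta) ->
  (exists2 j, (j <= m)%N & e <= `|Y j|) ->
  exists tau : nat, [/\ (tau < m)%N, (forall i, active e Y i = (i <= tau)%N),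
    e <= `|Y tau.+1| & `|Y tau.+1| <= e + eta].
Proof.
move=> e0 eta0 Y0 dY [j0 jm0 ej0].
have ex : exists j, e <= `|Y j| by exists j0.
pose s := ex_minn ex.
have [es smin] : e <= `|Y s| /\ forall j, e <= `|Y j| -> (s <= j)%N.
  by rewrite /s; case: ex_minnP.
have s0 : (0 < s)%N.
  by rewrite lt0n; apply/eqP => sE; move: es; rewrite sE Y0 normr0 leNgt e0.
have sm : (s <= m)%N by exact: leq_trans (smin _ ej0) jm0.
have lts j : (j < s)%N -> `|Y j| < e.
  by move=> js; rewrite ltNge; apply/negP => /smin; rewrite leqNgt js.
exists s.-1; rewrite prednK//; split => //.
- move=> i; apply/activeP/idP => [h|h j ji].
    rewrite -ltnS prednK//; rewrite ltnNge; apply/negP => si.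
    by have := h s si; rewrite ltNge es.
  by apply: lts; rewrite -(prednK s0) ltnS (leq_trans ji).
- have hd := dY s.-1; rewrite prednK// in hd.
  have hs : `|Y s.-1| < e by apply: lts; rewrite prednK.
  rewrite (_ : Y s = Y s.-1 + (Y s - Y s.-1)); last by ring.
  by rewrite (le_trans (ler_normD _ _))// lerD ?(ltW hs) ?hd.
Qed.

(** Summation by parts up to the stopping index gives the error (e^2 - Y^2 + Q)/e^2, with Y the
    stopped value and Q the sum of squared increments. Here Y^2 lies between e^2 and (e + eta)^2,
    and Q is at most m eta^2; the extra unit in [m.+1] absorbs the eta^2 of the overshoot. *)
Lemma stopped_sum (e eta : R) (Y : nat -> R) (m : nat) : 0 < e -> 0 <= eta -> Y 0%N = 0 ->
  (forall i, (i < m)%N -> `|Y i.+1 - Y i| <= eta) ->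
  (exists2 j, (j <= m)%N & e <= `|Y j|) ->
  `|1 - 2 * (\sum_(i < m) (if active e Y i then Y i else 0) * (Y i.+1 - Y i)) / e ^+ 2| <=
   2 * (eta / e) + (m.+1)%:R * (eta / e) ^+ 2.
Proof.
move=> e0 eta0 Y0 dY hit.
have [tau [taum actE eY Ye]] := stopping e0 eta0 Y0 dY hit.
pose G i := (if active e Y i then Y i else 0) * (Y i.+1 - Y i).
have -> : \sum_(i < m) (if active e Y i then Y i else 0) * (Y i.+1 - Y i) = \sum_(i < tau.+1) Y i * (Y i.+1 - Y i).
  rewrite -(big_mkord xpredT G) (big_cat_nat (n := tau.+1))//= [X in _ + X]big1_seq ?addr0; last first.
    move=> i /andP[_]; rewrite mem_index_iota => /andP[ti _].
    by rewrite /G actE leqNgt ti mul0r.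
  by rewrite big_mkord; apply: eq_bigr => i _; rewrite /G actE -ltnS ltn_ord.
rewrite sum_square_increments Y0 expr0n/= subr0.
set Q := \sum_(i < tau.+1) _.
have Q0 : 0 <= Q by apply: sumr_ge0 => i _; exact: sqr_ge0.
have Qm : Q <= m%:R * eta ^+ 2.
  apply: (@le_trans _ _ (\sum_(i < tau.+1) eta ^+ 2)).
    apply: ler_sum => i _; rewrite -[leLHS]real_normK ?num_real//.
    rewrite ler_sqr ?nnegrE//; apply: dY.
    by rewrite (leq_trans (ltn_ord i)).
  by rewrite sumr_const card_ord -[leLHS]mulr_natl ler_wpM2r ?sqr_ge0// ler_nat.
have y2 : e ^+ 2 <= Y tau.+1 ^+ 2.
  by rewrite -[leRHS]real_normK ?num_real// ler_sqr ?nnegrE// ltW.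
have y2' : Y tau.+1 ^+ 2 <= (e + eta) ^+ 2.
  by rewrite -[leLHS]real_normK ?num_real// ler_sqr ?nnegrE// addr_ge0// ltW.
have e2 : 0 < e ^+ 2 by rewrite exprn_gt0.
rewrite (_ : 1 - _ = (e ^+ 2 - Y tau.+1 ^+ 2 + Q) / e ^+ 2); last by field; rewrite gt_eqF.
rewrite normrM (gtr0_norm (_ : 0 < (e ^+ 2)^-1)) ?invr_gt0//.
rewrite [leRHS](_ : _ = (2 * e * eta + m.+1%:R * eta ^+ 2) / e ^+ 2); last by field; rewrite gt_eqF.
rewrite ler_wpM2r ?invr_ge0 ?(ltW e2)// ler_norml -natr1 mulrDl mul1r.
rewrite sqrrD -mulr_natl in y2'.
have ee : 0 <= e * eta by rewrite mulr_ge0// ltW.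
have mm : 0 <= m%:R * eta ^+ 2 by rewrite mulr_ge0 ?sqr_ge0.
have e20 : 0 <= eta ^+ 2 by exact: sqr_ge0.
by apply/andP; split; lra.
Qed.

End DiscreteStopping.

Section BlockDecomposition.
Context {R : realType}.

Lemma block_linear (k : R) v1 v2 t h m x :
  block (fun i => k * v1 i + v2 i) t h m x = k * block v1 t h m x + block v2 t h m x.
Proof.
by rewrite /block mulr_sumr -big_split/=; apply: eq_bigr => i _; ring.
Qed.

Lemma block_ext v1 v2 t h m (x : R) : (forall i, (i < m)%N -> v1 i = v2 i) ->
  block v1 t h m x = block v2 t h m x.
Proof. by move=> v12; apply: eq_bigr => i _; rewrite v12. Qed.

(** Represents the jump to zero at the stopping time by two steps. *)
Lemma block_tail s t h m (x : R) : (s <= m)%N ->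
  block (fun i => if (s <= i)%N then 1 else 0) t h m x =
  step (t + s%:R * h) x - step (t + m%:R * h) x.
Proof.
elim: m => [|m IH]; first by rewrite leqn0 => /eqP ->; rewrite /block big_ord0 subrr.
rewrite leq_eqVlt => /predU1P[->|sm].
  rewrite subrr /block big1// => i _.
  by rewrite leqNgt ltn_ord mul0r.
rewrite ltnS in sm; have E := IH sm; rewrite /block in E *.
by rewrite big_ord_recr/= E sm mul1r; ring.
Qed.

End BlockDecomposition.

Section Strategy.
Context {R : realType}.
Implicit Types (x z : R -> R) (n i : nat).

Definition time n : R := 1 - 2^-1 ^+ n.

Lemma halfE n : 2^-1 ^+ n = 2 `^ (- n%:R) :> R.
Proof. by rewrite powR_invn// exprVn. Qed.

Lemma half_gt0 n : 0 < 2^-1 ^+ n :> R. Proof. by rewrite exprn_gt0. Qed.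

Lemma half_le1 n : 2^-1 ^+ n <= 1 :> R.
Proof. by rewrite exprn_ile1// invr_le1 ?unitf_gt0// ler1n. Qed.

Lemma time_ge0 n : 0 <= time n.
Proof. by rewrite subr_ge0 half_le1. Qed.

Lemma time_lt1 n : time n < 1.
Proof. by rewrite ltrBlDr ltrDl half_gt0. Qed.

Lemma timeS n : time n.+1 = time n + 2^-1 ^+ n.+1.
Proof. by rewrite /time exprS; field. Qed.

Context (M : R) (p : nat).

(** Block n has length 2^-(n+1), hence cells of length 2^-((p+1)(n+1)). The parameter [p] is chosen
    so large that the sum of squared increments is small relative to the squared level. *)
Definition mesh_size n : nat := (2 ^ (p * n.+1))%N.
Definition mesh n : R := 2^-1 ^+ (p.+1 * n.+1).
Definition grid n i : R := time n + i%:R * mesh n.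
(** Half of the threshold in the small-ball event: the other half is given up when a crossing at an
    arbitrary time is moved to a grid point. *)
Definition level n : R := (2^-1 ^+ n.+1) `^ M / 2.
Definition dev x n i : R := x (grid n i) - x (time n).
Definition position x n i : R := if active (level n) (dev x n) i then dev x n i else 0.
Definition gain x n : R := \sum_(i < mesh_size n) position x n i * (dev x n i.+1 - dev x n i).

(* [wealth x z n] is the integral up to [time n] of the strategy, which aims on
   each block at closing the gap to the current value of [z]. *)
Fixpoint wealth x z n : R :=
  if n is k.+1 then
    wealth x z k + 2 * (z (time k) - wealth x z k) / level k ^+ 2 * gain x k
  else 0.

Definition gap x z n : R := z (time n) - wealth x z n.
Definition coef x z n : R := 2 * gap x z n / level n ^+ 2.
Definition strategy_block x z n : R -> R :=
  block (fun i => coef x z n * position x n i) (time n) (mesh n) (mesh_size n).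
(** The sum may stop there: a block with n > 1/(1-u) starts after u, because n < 2^n. A finite sum
    keeps the measurability in the path elementary; at and after time 1 the value 0 is a default. *)
Definition strategy x z (u : R) : R :=
  if u < 1 then \sum_(n < (Num.truncn (1 - u)^-1).+1) strategy_block x z n u else 0.

Lemma mesh_gt0 n : 0 < mesh n. Proof. exact: half_gt0. Qed.

Lemma mesh_sizeM n : (mesh_size n)%:R * mesh n = 2^-1 ^+ n.+1.
Proof.
rewrite /mesh_size /mesh mulSn exprD natrX mulrCA -exprMn mulfV ?expr1n ?mulr1//.
Qed.

Lemma grid_size n : grid n (mesh_size n) = time n.+1.
Proof. by rewrite /grid mesh_sizeM timeS. Qed.

Lemma level_gt0 n : 0 < level n.
Proof. by rewrite divr_gt0// powR_gt0// half_gt0. Qed.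

Lemma grid_ge n i : time n <= grid n i.
Proof. by rewrite lerDl mulr_ge0// ltW// mesh_gt0. Qed.

Lemma grid_mono n i j : (i <= j)%N -> grid n i <= grid n j.
Proof. by move=> ij; rewrite lerD2l ler_pM2r ?mesh_gt0// ler_nat. Qed.

Lemma grid_le n i : (i <= mesh_size n)%N -> grid n i <= time n.+1.
Proof. by move=> h; rewrite -grid_size grid_mono. Qed.

Lemma grid01 n i : (i <= mesh_size n)%N -> grid n i \in `[0, 1].
Proof.
move=> h; rewrite in_itv/= (le_trans (time_ge0 n) (grid_ge n i))/=.
by rewrite (le_trans (grid_le h))// ltW// time_lt1.
Qed.

Lemma gridS n i : grid n i.+1 = grid n i + mesh n.
Proof. by rewrite /grid -natr1 mulrDl mul1r addrA. Qed.

Lemma grid0 n : grid n 0 = time n. Proof. by rewrite /grid mul0r addr0. Qed.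

Lemma dev0 x n : dev x n 0 = 0. Proof. by rewrite /dev grid0 subrr. Qed.

Lemma time01 n : time n \in `[0, 1].
Proof. by rewrite in_itv/= time_ge0 ltW// time_lt1. Qed.

Lemma strategy_block0 x z n u : u <= time n -> strategy_block x z n u = 0.
Proof. exact: (block_left _ _ (mesh_gt0 n)). Qed.

Lemma strategyE x z u : u < 1 ->
  exists N, forall n, (N <= n)%N -> strategy x z u = \sum_(i < n) strategy_block x z i u.
Proof.
move=> u1; pose N := (Num.truncn (1 - u)^-1).+1; exists N => n Nn.
have u0 : 0 < 1 - u by rewrite subr_gt0.
rewrite /strategy u1 -/N -(subnKC Nn) big_split_ord/= [X in _ = _ + X]big1 ?addr0// => i _.
apply: strategy_block0; rewrite /time lerBrDr -lerBrDl.
rewrite exprVn -[leRHS]invrK lef_pV2 ?posrE ?invr_gt0 ?exprn_gt0//.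
have : (1 - u)^-1 < N%:R.
  by have /truncn_itv/andP[] : 0 <= (1 - u)^-1 by rewrite invr_ge0 ltW.
move=> /ltW/le_trans; apply; apply: (@le_trans _ _ (N + i)%:R); first by rewrite ler_nat leq_addr.
by rewrite -natrX ler_nat ltnW// ltn_expl.
Qed.

(** The number of terms varies with u, so the strategy is treated as a pointwise limit of sums with
    a fixed number of blocks. *)
Lemma measurable_strategy x z : measurable_fun setT (strategy x z).
Proof.
pose h n u := if u < 1 then \sum_(i < n) strategy_block x z i u else 0.
have mh n : measurable_fun setT (h n).
  apply: measurable_fun_ifT; [solve_meas| |solve_meas].
  by apply: measurable_sum => i; exact: measurable_block.
apply: (measurable_fun_cvg mh).
move=> u _; have [u1|u1] := ltP u 1; last first.
  by rewrite /strategy /h ltNge u1/=; exact: cvg_cst.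
have [N hN] := strategyE x z u1.
by apply: cvg_near_cst; exists N => // n /= Nn; rewrite /h u1 -hN.
Qed.

(** The choice of [coef] makes the relative error of the gain, bounded in [stopped_sum], the factor
    by which the old gap is multiplied. *)
Lemma gapS x z n : gap x z n.+1 =
  z (time n.+1) - z (time n) + gap x z n * (1 - 2 * gain x n / level n ^+ 2).
Proof. by rewrite /gap /=; field; rewrite gt_eqF// level_gt0. Qed.

Lemma wealth_sum x z n : wealth x z n = \sum_(k < n) coef x z k * gain x k.
Proof. by elim: n => [|n IH]; rewrite ?big_ord0// big_ord_recr/= -IH. Qed.

End Strategy.

Section PathEstimates.
Context {R : realType}.

Lemma half_small (A B : R) : 0 < B -> exists N, forall n, (N <= n)%N -> A * 2^-1 ^+ n <= B.
Proof.
move=> B0; have : A * 2^-1 ^+ n @[n --> \oo] --> (A * 0).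
  by apply: cvgMl_tmp; apply: cvg_expr; rewrite ger0_norm ?invr_ge0// invf_lt1// ltr1n.
rewrite mulr0 => /cvgr0_norm_le/(_ _ B0)[N _ hN]; exists N => n Nn.
exact: le_trans (ler_norm _) (hN n Nn).
Qed.

Lemma powR2_le (r s : R) : r <= s -> 2 `^ r <= 2 `^ s.
Proof. by move=> rs; apply: ler_powR => //; rewrite ler1n. Qed.

Lemma powR2D (r s : R) : 2 `^ (r + s) = 2 `^ r * 2 `^ s.
Proof. by rewrite powRD// pnatr_eq0 implybT. Qed.

Context (M : R) (p : nat) (x z : R -> R) (th C Cz rho : R).
Context (M0 : 0 < M) (th1 : 1 / 2 < th) (th2 : th <= 1).
Context (C0 : 0 <= C) (Cz0 : 0 <= Cz) (rho0 : 0 < rho).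
Context (hp : 2 * M + 1 <= p.+1%:R * (2 * th - 1)).
Context (hx : forall s t, s \in `[0, 1] -> t \in `[0, 1] -> `|x t - x s| <= C * `|t - s| `^ th).
Context (hz : forall s t, s \in `[0, 1] -> t \in `[0, 1] -> `|z t - z s| <= Cz * `|t - s| `^ rho).

Let eta n := C * mesh p n `^ th.

Let eta_ge0 n : 0 <= eta n. Proof. by rewrite mulr_ge0 ?powR_ge0. Qed.

Lemma dev_increment n i : (i < mesh_size p n)%N ->
  `|dev p x n i.+1 - dev p x n i| <= eta n.
Proof.
move=> im; rewrite /dev (_ : _ - _ = x (grid p n i.+1) - x (grid p n i)); last by ring.
rewrite (le_trans (hx (grid01 (ltnW im)) (grid01 im)))// gridS addrAC subrr add0r.
by rewrite gtr0_norm ?mesh_gt0.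
Qed.

Let ratioE n : eta n / level M n = 2 * C * 2 `^ (- (n.+1%:R * (p.+1%:R * th - M))).
Proof.
rewrite /eta /level /mesh !halfE natrM -!powRrM invfM invrK -powRN.
have -> : - (n.+1%:R * (p.+1%:R * th - M)) = - (p.+1%:R * n.+1%:R) * th + - (- n.+1%:R * M) by ring.
by rewrite powR2D; ring.
Qed.

Lemma ratio_le n : eta n / level M n <= 2 * C * 2^-1 ^+ n.+1.
Proof.
rewrite ratioE ler_wpM2l ?mulr_ge0// halfE powR2_le// lerN2 -[leLHS]mulr1.
have h1 := M0; have h2 := th2; have h3 := hp.
rewrite ler_wpM2l//; have : 0 <= p.+1%:R * (1 - th) by rewrite mulr_ge0// subr_ge0.
lra.
Qed.

(** There are 2^(p(n+1)) cells, and the squared ratio is of order 2^(-2(n+1)((p+1) th - M)). By [hp]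
    the product decays at least like 2^-(n+1); a suitable [p] exists because 2 th - 1 > 0. *)
Lemma ratio2_le n : (mesh_size p n).+1%:R * (eta n / level M n) ^+ 2 <=
  8 * C ^+ 2 * 2^-1 ^+ n.+1.
Proof.
have m1 : (mesh_size p n).+1%:R <= 2 * 2 `^ (n.+1%:R * p%:R) :> R.
  have -> : 2 `^ (n.+1%:R * p%:R) = (mesh_size p n)%:R :> R.
    by rewrite /mesh_size -natrM powR_mulrn// natrX mulnC.
  have : 1 <= (mesh_size p n)%:R :> R by rewrite ler1n expn_gt0.
  by rewrite -natr1; lra.
rewrite (le_trans (ler_wpM2r (sqr_ge0 _) m1))// ratioE expr2.
set E := - _.
rewrite [leLHS](_ : _ = 8 * C ^+ 2 * (2 `^ (n.+1%:R * p%:R) * (2 `^ E * 2 `^ E))); last by ring.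
rewrite -!powR2D halfE ler_wpM2l ?mulr_ge0 ?sqr_ge0// powR2_le//.
rewrite /E (_ : _ + _ = - (n.+1%:R * (2 * (p.+1%:R * th - M) - p%:R))); last by ring.
rewrite lerN2 -[leLHS]mulr1 ler_wpM2l//.
by have h := hp; rewrite -natr1 in h *; lra.
Qed.

(** Twice the constant 2 C of [ratio_le], plus the constant of [ratio2_le], as in the bound of
    [stopped_sum]. *)
Let delta := 4 * C + 8 * C ^+ 2.

Lemma gap_step n : (exists2 j, (j <= mesh_size p n)%N & level M n <= `|dev p x n j|) ->
  `|gap M p x z n.+1| <= Cz * 2 `^ (- (n.+1%:R * rho)) +
     `|gap M p x z n| * (delta * 2^-1 ^+ n.+1).
Proof.
move=> hit; rewrite gapS (le_trans (ler_normD _ _))// lerD//.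
  rewrite (le_trans (hz (time01 _) (time01 _)))// timeS addrAC subrr add0r.
  by rewrite gtr0_norm ?half_gt0// halfE -powRrM mulNr.
rewrite normrM ler_wpM2l//.
have := stopped_sum (level_gt0 M n) (eta_ge0 n) (dev0 p x n) (@dev_increment n) hit.
move=> /le_trans; apply; have := ratio_le n; have := ratio2_le n.
by rewrite /delta; lra.
Qed.

Context (n0 : nat).
Context (hit : forall n, (n0 <= n)%N -> exists2 t, time n <= t <= time n.+1 &
  (2^-1 ^+ n.+1) `^ M < `|x t - x (time n)|).

(** The path moves by more than twice the level at some time t of the block. The left end of the
    cell of t is within [eta n] of it in value, and [eta n] is at most the level for large n. *)
Lemma grid_hit : exists N, forall n, (N <= n)%N ->
  exists2 j, (j <= mesh_size p n)%N & level M n <= `|dev p x n j|.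
Proof.
have [N hN] := half_small (2 * C) (@ltr01 R).
exists (maxn n0 N) => n; rewrite geq_max => /andP[n0n Nn].
have [t /andP[t1 t2] ht] := hit n0n.
have lt_t : time n < t.
  rewrite lt_neqAle t1 andbT; apply/eqP => tE; move: ht; rewrite -tE subrr normr0.
  by rewrite ltNge powR_ge0.
have [j jm /andP[j1 j2]] : exists2 j, (j < mesh_size p n)%N &
    time n + j%:R * mesh p n < t <= time n + j.+1%:R * mesh p n.
  by apply: cell_exists => //; rewrite -/(grid p n _) grid_size.
rewrite -/(grid p n _) in j1; rewrite -/(grid p n _) gridS in j2.
exists j; first exact: ltnW.
have t01 : t \in `[0, 1].
  by rewrite in_itv/= (le_trans (time_ge0 n) t1)/= (le_trans t2)// ltW// time_lt1.
have := hx (grid01 (ltnW jm)) t01.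
have tj : `|t - grid p n j| `^ th <= mesh p n `^ th.
  apply: ge0_ler_powR; rewrite ?nnegrE ?(ltW (mesh_gt0 _ _))//; first by have := th1; lra.
  by rewrite gtr0_norm ?subr_gt0// lerBlDl.
move=> /le_trans/(_ (ler_wpM2l C0 tj)) hxt.
have r1 : eta n <= level M n.
  rewrite -[leRHS]mul1r -ler_pdivrMr ?level_gt0// (le_trans (ratio_le n))// hN//.
  exact: leqW.
have e2 : (2^-1 ^+ n.+1) `^ M = 2 * level M n by rewrite /level; field.
have := ler_normD (x t - x (grid p n j)) (dev p x n j).
rewrite /dev addrA subrK => htri.
by rewrite /eta in r1; rewrite e2 in ht; lra.
Qed.

(** The contraction factor [delta] 2^-(n+1) eventually falls below 2^(-rho)/2, so the decay rate is
    imposed by the increments of z alone. Nothing is claimed about the gap before the level is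
    reached on every block. *)
Lemma gap_bound : exists N K, 0 <= K /\ forall n, (N <= n)%N ->
  (exists2 j, (j <= mesh_size p n)%N & level M n <= `|dev p x n j|) /\
  `|gap M p x z n| <= K * 2 `^ (- (n%:R * rho)).
Proof.
have [N1 h1] := grid_hit.
have q0 : 0 < 2 `^ (- rho) / 2 :> R by rewrite divr_gt0// powR_gt0.
have [N2 h2] := half_small delta q0.
pose N := maxn N1 N2.
(* The first term gives Cz <= K/2, which leaves K/2 for the old gap in the inductive step; the
   second starts the induction at N. *)
pose K := 2 * Cz + `|gap M p x z N| * 2 `^ (N%:R * rho).
have K0 : 0 <= K by rewrite addr_ge0 ?mulr_ge0 ?powR_ge0.
exists N, K; split => // n Nn; split; first by apply: h1; rewrite (leq_trans _ Nn)// leq_maxl.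
rewrite -(subnKC Nn); elim: (n - N)%N => [|k IH].
  rewrite addn0 /K mulrDl -[X in _ <= _ + X]mulrA -powR2D subrr powRr0 mulr1 lerDr.
  by rewrite !mulr_ge0 ?powR_ge0.
rewrite addnS (le_trans (gap_step _))//.
  by apply: h1; rewrite (leq_trans _ (leq_addr _ _))// leq_maxl.
set m := (N + k)%N in IH *.
have hm : delta * 2^-1 ^+ m.+1 <= 2 `^ (- rho) / 2.
  by apply: h2; rewrite leqW// (leq_trans _ (leq_addr _ _))// leq_maxr.
have d0 : 0 <= delta * 2^-1 ^+ m.+1.
  by rewrite mulr_ge0 ?(ltW (half_gt0 _))// /delta addr_ge0// mulr_ge0// sqr_ge0.
have := ler_pM (normr_ge0 _) d0 IH hm.
have -> : K * 2 `^ (- (m%:R * rho)) * (2 `^ (- rho) / 2) = K / 2 * 2 `^ (- (m.+1%:R * rho)).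
  rewrite (_ : - (m.+1%:R * rho) = - (m%:R * rho) + - rho); last by rewrite -natr1; ring.
  by rewrite powR2D; ring.
set w := 2 `^ (- (m.+1%:R * rho)).
have w0 : 0 <= w by exact: powR_ge0.
have CK : Cz <= K / 2.
  rewrite ler_pdivlMr// mulrC /K lerDl mulr_ge0// powR_ge0//.
have := ler_wpM2r w0 CK.
move: (`|_| * _) => y; lra.
Qed.

End PathEstimates.

(** * Norm of one block of the strategy *)

Section BlockEstimate.
Context {R : realType}.

Lemma interpolate (A u v l : R) : 0 <= A -> A <= u -> A <= v -> 0 <= l -> l <= 1 ->
  A <= u `^ (1 - l) * v `^ l.
Proof.
move=> A0 Au Av l0 l1.
have -> : A = A `^ (1 - l) * A `^ l.
  by rewrite -powRD ?subrK ?powRr1// oner_eq0.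
by apply: ler_pM; rewrite ?powR_ge0//; apply: ge0_ler_powR; rewrite ?nnegrE; lra.
Qed.

Context (M : R) (p : nat) (x z : R -> R) (th C rho a k : R).
Context (M0 : 0 < M) (th1 : 1 / 2 < th) (th2 : th <= 1) (C0 : 0 <= C).
Context (a0 : 0 < a) (a1 : a < 1) (ak : a < k) (kth : k <= th).
Context (kappa1 : 0 < rho - M + 1 - a) (kappa2 : 0 < rho - M * (1 + k / th) + 1 + k - a).
Context (hx : forall s t, s \in `[0, 1] -> t \in `[0, 1] -> `|x t - x s| <= C * `|t - s| `^ th).

Let lam := k / th.
Let th0 : 0 < th. Proof. by have h := th1; lra. Qed.
Let lam0 : 0 <= lam. Proof. by rewrite divr_ge0 ?(ltW th0)//; have := a0; have := ak; lra. Qed.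
Let lam1 : lam <= 1. Proof. by rewrite ler_pdivrMr// mul1r. Qed.

Let stepK := (1 + a^-1) / (1 - a).
Let blockK := (1 + 2 / a) / (1 - a) + 2 / (k - a) / (1 + k - a) + 4 / a / (1 - a).

Let stepK0 : 0 <= stepK.
Proof.
have h1 := a0; have h2 := a1; rewrite /stepK divr_ge0//; last by lra.
by rewrite addr_ge0// invr_ge0 ltW.
Qed.

Let blockK0 : 0 <= blockK.
Proof.
have h1 := a0; have h2 := a1; have h3 := ak.
have i0 : 0 <= a^-1 by rewrite invr_ge0 ltW.
have i1 : 0 <= (1 - a)^-1 by rewrite invr_ge0; lra.
have i2 : 0 <= (k - a)^-1 by rewrite invr_ge0; lra.
have i3 : 0 <= (1 + k - a)^-1 by rewrite invr_ge0; lra.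
apply: addr_ge0; first apply: addr_ge0.
- by apply: mulr_ge0 => //; apply: addr_ge0 => //; exact: mulr_ge0.
- by apply: mulr_ge0 => //; exact: mulr_ge0.
- by apply: mulr_ge0 => //; exact: mulr_ge0.
Qed.

(** The stopped position is the path frozen at [tau], minus the constant Y(tau) on the remaining
    cells. Freezing does not enlarge increments beyond the Hoelder bound, so [fnorm_block_le]
    applies to the first part; the second is a combination of two steps of height at most the
    level. *)
Lemma strategy_block_fnorm n :
  (exists2 j, (j <= mesh_size p n)%N & level M n <= `|dev p x n j|) ->
  (fnorm a 0 1 (strategy_block M p x z n) <=
   ((2 * stepK + blockK) * (`|coef M p x z n| * level M n * (2^-1 ^+ n) `^ (1 - a)) +
    blockK * (`|coef M p x z n| * (2 * level M n) `^ (1 - lam) * C `^ lam * (2^-1 ^+ n) `^ (1 + k - a)))%:E)%E.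
Proof.
move=> hit; have a0' := a0; have a1' := a1; have ak' := ak; have kth' := kth; have th2' := th2.
set c := coef M p x z n; set e := level M n; set m := mesh_size p n; set Y := dev p x n.
have e0 : 0 < e by exact: level_gt0.
pose eta := C * mesh p n `^ th.
have eta0 : 0 <= eta by rewrite mulr_ge0 ?powR_ge0.
have dY i : (i < m)%N -> `|Y i.+1 - Y i| <= eta.
  exact: (dev_increment hx).
have [tau [taum actE _ _]] := stopping e0 eta0 (dev0 p x n) dY hit.
have Yact j : (j <= tau)%N -> `|Y j| < e.
  by move=> jt; have := actE tau; rewrite leqnn => /activeP; apply.
pose y' i := Y (minn i tau).
have y'e i : `|y' i| < e by apply: Yact; exact: geq_minr.
have t'1 : time n.+1 < 1 :> R by exact: time_lt1.
have g1 : grid p n tau.+1 < 1 :> R by rewrite (le_lt_trans _ t'1)// grid_le.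
have t'0 : 0 <= time n.+1 :> R by exact: time_ge0.
have g0 : 0 <= grid p n tau.+1 :> R by rewrite (le_trans (time_ge0 n))// grid_ge.
pose st u := -1 * step (time n.+1) u + step (grid p n tau.+1) u : R.
pose bl := block (fun i => c * y' i) (time n) (mesh p n) m.
have blE : strategy_block M p x z n = fun u => - (c * Y tau) * st u + bl u.
  apply/funext => u; rewrite /strategy_block -/c -/m.
  rewrite (@block_ext _ _ (fun i => - (c * Y tau) * (if (tau.+1 <= i)%N then 1 else 0) + c * y' i)); last first.
    move=> i im; rewrite /position actE /y' -/Y.
    have [it|ti] := leqP i tau; first by rewrite mulr0 add0r.
    by ring.
  rewrite block_linear block_tail// -/(grid p n _) -/(grid p n _) grid_size.
  by rewrite /st; congr (_ * _ + _); ring.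
have mst : measurable_fun setT st.
  apply: measurable_funD; last exact: measurable_step.
  by apply: measurable_funM => //; exact: measurable_step.
have mbl : measurable_fun setT bl by exact: measurable_block.
have ms b := @measurable_step R b.
set W := 2^-1 ^+ n.
have WE : W = 1 - time n by rewrite /W /time; ring.
have W0 : 0 < W by exact: half_gt0.
have nstep b : time n <= b -> b < 1 -> (fnorm a 0 1 (step b) <= (stepK * W `^ (1 - a))%:E)%E.
  move=> tb b1; apply: (le_trans (fnorm_step_le a0 a1 (le_trans (time_ge0 n) tb) b1)).
  rewrite lee_fin [leLHS](_ : _ = stepK * (1 - b) `^ (1 - a)); last by rewrite /stepK; ring.
  rewrite ler_wpM2l//.
  by apply: ge0_ler_powR; rewrite ?nnegrE ?(ltW W0)// ?WE; lra.
have nst : (fnorm a 0 1 st <= (2 * stepK * W `^ (1 - a))%:E)%E.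
  apply: (le_trans (fnorm_linear_le a (-1) (ms _) (ms _))).
  rewrite normrN1 mul1e (_ : 2 * stepK * _ = stepK * W `^ (1 - a) + stepK * W `^ (1 - a)); last by ring.
  rewrite EFinD; apply: leeD; apply: nstep => //; last exact: grid_ge.
  by rewrite timeS lerDl ltW// half_gt0.
pose H := `|c| * (2 * e) `^ (1 - lam) * C `^ lam.
have H0 : 0 <= H by rewrite !mulr_ge0 ?powR_ge0.
have nbl : (fnorm a 0 1 bl <= (blockK * (`|c| * e * W `^ (1 - a) + H * W `^ (1 + k - a)))%:E)%E.
  rewrite WE; apply: fnorm_block_le => //.
  - exact: mesh_gt0.
  - exact: time_ge0.
  - by rewrite -/(grid p n _) grid_size.
  - exact: le_trans th2.
  - by rewrite mulr_ge0// ltW.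
  - by move=> i im; rewrite normrM ler_wpM2l// ltW.
  move=> i j ij jm; rewrite -mulrBr normrM /H -!mulrA ler_wpM2l//.
  set i' := minn i tau; set j' := minn j tau.
  have ij' : (i' <= j')%N by rewrite leq_min geq_minr geq_min (ltnW ij).
  have j'm : (j' <= m)%N by rewrite geq_min ltnW.
  have dji : (j' - i' <= j - i)%N.
    rewrite /i' /j'; case: (leqP i tau) => it; case: (leqP j tau) => jt.
    - by [].
    - by rewrite leq_sub2r// ltnW.
    - by have := leq_trans (ltnW ij) jt; rewrite leqNgt it.
    - by rewrite subnn.
  set d := (j - i)%:R * mesh p n.
  have d0 : 0 <= d by rewrite mulr_ge0// ltW// mesh_gt0.
  have -> : C `^ lam * d `^ k = (C * d `^ th) `^ lam.
    by rewrite powRM ?powR_ge0// -powRrM /lam mulrCA divff ?mulr1// gt_eqF.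
  apply: interpolate => //.
    rewrite (le_trans (ler_normB _ _))// (_ : 2 * e = e + e); last by ring.
    by rewrite lerD// ltW.
  rewrite /y' -/i' -/j' /Y /dev (_ : _ - _ = x (grid p n j') - x (grid p n i')); last by ring.
  apply: (le_trans (hx (grid01 (leq_trans ij' j'm)) (grid01 j'm))); rewrite ler_wpM2l//.
  apply: ge0_ler_powR; rewrite ?nnegrE ?(ltW th0)//.
  rewrite ger0_norm ?subr_ge0 ?grid_mono// /grid opprD addrACA subrr add0r -mulrBl -natrB//.
  by rewrite ler_wpM2r ?ler_nat// ltW// mesh_gt0.
rewrite blE; apply: (le_trans (fnorm_linear_le a _ mst mbl)).
apply: (@le_trans _ _ ((`|c| * e)%:E * (2 * stepK * W `^ (1 - a))%:E +
   (blockK * (`|c| * e * W `^ (1 - a) + H * W `^ (1 + k - a)))%:E)%E).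
  apply: leeD => //; apply: lee_pmul => //; first exact: fnorm_ge0.
  by rewrite lee_fin normrN normrM ler_wpM2l// ltW// Yact.
rewrite -EFinM -EFinD lee_fin /H le_eqVlt (_ : (_ == _) = true)//; apply/eqP.
by ring.
Qed.

Let kappa := Num.min (rho - M + 1 - a) (rho - M * (1 + k / th) + 1 + k - a).

(** The coefficient is at most of order 2^(-n rho)/e^2 with e of order 2^(-nM). The two terms of the
    previous bound carry e and e^(1 - lam), so they decay with the two exponents whose minimum is
    [kappa]. *)
Lemma strategy_block_geometric (K : R) : 0 <= K -> exists K' q, [/\ 0 <= K', 0 < q, q < 1 &
  forall n, (exists2 j, (j <= mesh_size p n)%N & level M n <= `|dev p x n j|) ->
   `|gap M p x z n| <= K * 2 `^ (- (n%:R * rho)) ->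
   (fnorm a 0 1 (strategy_block M p x z n) <= (K' * q ^+ n)%:E)%E].
Proof.
move=> K0; have a0' := a0; have a1' := a1; have ak' := ak; have kth' := kth; have th2' := th2.
pose q : R := 2 `^ (- kappa).
have kap0 : 0 < kappa by rewrite lt_min kappa1 kappa2.
have q0 : 0 < q by exact: powR_gt0.
have q1 : q < 1.
  have h12 : (1 : R) `^ kappa < 2 `^ kappa.
    by apply: gt0_ltr_powR; rewrite ?nnegrE// ltr1n.
  by rewrite powR1 in h12; rewrite /q powRN invf_lt1 ?powR_gt0.
have qE n : q ^+ n = 2 `^ (- (n%:R * kappa)).
  by rewrite -powR_mulrn ?(ltW q0)// -powRrM; congr (_ `^ _); ring.
have bK : 0 <= blockK := blockK0.
have sK : 0 <= 2 * stepK + blockK by rewrite addr_ge0// mulr_ge0// stepK0.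
(* The numerical factors come from the 2 in [coef] and the halving in [level]; the powers of 2 with
   exponent a multiple of M come from [n.+1] in place of n in [level]. *)
pose c1 : R := 4 * K * 2 `^ M.
pose c2 : R := 8 * K * 2 `^ (M * (1 + lam)) * C `^ lam.
have c10 : 0 <= c1 by rewrite !mulr_ge0 ?powR_ge0.
have c20 : 0 <= c2 by rewrite !mulr_ge0 ?powR_ge0.
exists ((2 * stepK + blockK) * c1 + blockK * c2), q; split => //.
  by rewrite addr_ge0// mulr_ge0.
move=> n hit hgap; apply: (le_trans (strategy_block_fnorm hit)).
have eE : level M n = 2 `^ (- (n.+1%:R * M)) / 2.
  by rewrite /level halfE -powRrM; congr (_ `^ _ / _); ring.
set e := level M n in eE *; have e0 : 0 < e by exact: level_gt0.
have cle : `|coef M p x z n| <= 2 * K * 2 `^ (- (n%:R * rho)) / e ^+ 2.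
  rewrite /coef normrM normfV normrM (ger0_norm (_ : 0 <= 2))// (ger0_norm (sqr_ge0 _)).
  by rewrite ler_wpM2r ?invr_ge0 ?sqr_ge0// -mulrA ler_wpM2l.
have Wpow r : (2^-1 ^+ n) `^ r = 2 `^ (- (n%:R * r)) :> R.
  by rewrite halfE -powRrM; congr (_ `^ _); ring.
rewrite lee_fin [leRHS]mulrDl; apply: lerD.
  rewrite -[leRHS]mulrA ler_wpM2l//.
  apply: (@le_trans _ _ (2 * K * 2 `^ (- (n%:R * rho)) / e ^+ 2 * e * 2 `^ (- (n%:R * (1 - a))))).
    by rewrite Wpow ler_wpM2r ?powR_ge0// ler_wpM2r// ltW.
  have -> : 2 * K * 2 `^ (- (n%:R * rho)) / e ^+ 2 * e * 2 `^ (- (n%:R * (1 - a))) =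
     2 * K * (2 `^ (- (n%:R * rho)) * (e^-1 * 2 `^ (- (n%:R * (1 - a))))).
    by field; rewrite gt_eqF.
  rewrite eE invfM invrK -powRN opprK.
  have -> : 2 * K * (2 `^ (- (n%:R * rho)) * (2 `^ (n.+1%:R * M) * 2 * 2 `^ (- (n%:R * (1 - a))))) =
     4 * K * (2 `^ (- (n%:R * rho)) * (2 `^ (n.+1%:R * M) * 2 `^ (- (n%:R * (1 - a))))) by ring.
  rewrite -!powR2D qE /c1 -[leRHS]mulrA -powR2D ler_wpM2l ?mulr_ge0//.
  apply: powR2_le; rewrite -natr1.
  have : n%:R * kappa <= n%:R * (rho - M + 1 - a) by rewrite ler_wpM2l// ge_min lexx.
  lra.
rewrite -[leRHS]mulrA ler_wpM2l//.
apply: (@le_trans _ _ (2 * K * 2 `^ (- (n%:R * rho)) / e ^+ 2 * (2 * e) `^ (1 - lam) * C `^ lam * 2 `^ (- (n%:R * (1 + k - a))))).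
  by rewrite Wpow ler_wpM2r ?powR_ge0// ler_wpM2r ?powR_ge0// ler_wpM2r ?powR_ge0.
have -> : (2 * e) `^ (1 - lam) = 2 `^ (- (n.+1%:R * M) * (1 - lam)).
  by rewrite powRrM eE; congr (_ `^ _); field.
have -> : (e ^+ 2)^-1 = 4 * 2 `^ (2 * (n.+1%:R * M)).
  rewrite eE expr_div_n invf_div -(powR_mulrn 2 (powR_ge0 _ _)) -powRrM -powRN.
  have -> : - (- (n.+1%:R * M) * 2) = 2 * (n.+1%:R * M) by ring.
  by have -> : 2 ^+ 2 = 4 :> R by ring.
set A1 := 2 `^ _; set A2 := 2 `^ _; set A3 := 2 `^ _; set A4 := 2 `^ _.
have -> : 2 * K * A1 * (4 * A2) * A3 * C `^ lam * A4 = 8 * K * C `^ lam * (A1 * (A2 * (A3 * A4))) by ring.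
rewrite /A1 /A2 /A3 /A4 -!powR2D qE /c2.
have -> : 8 * K * 2 `^ (M * (1 + lam)) * C `^ lam * 2 `^ (- (n%:R * kappa)) =
   8 * K * C `^ lam * (2 `^ (M * (1 + lam)) * 2 `^ (- (n%:R * kappa))) by ring.
rewrite -powR2D ler_wpM2l ?mulr_ge0 ?powR_ge0//.
apply: powR2_le; rewrite -natr1.
have : n%:R * kappa <= n%:R * (rho - M * (1 + lam) + 1 + k - a).
  by rewrite ler_wpM2l// ge_min lexx orbT.
lra.
Qed.

End BlockEstimate.

(** * Replication along a single path *)

Section PathReplication.
Context {R : realType}.

(** Composition with this projection extends a path from [0, 1] to the line with the same Hoelder
    constant. *)
Definition clamp (u : R) : R := Num.max 0 (Num.min 1 u).

Lemma clamp01 u : clamp u \in `[0, 1].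
Proof.
rewrite in_itv/= /clamp le_max lexx/= ge_max ler01/= ge_min lexx//.
Qed.

Lemma clampE u : u \in `[0, 1] -> clamp u = u.
Proof.
rewrite in_itv/= => /andP[u0 u1]; rewrite /clamp (min_idPr u1) (max_idPr _)//.
Qed.

Lemma clamp_le u v : `|clamp u - clamp v| <= `|u - v|.
Proof.
wlog uv : u v / u <= v.
  move=> H; have [|/ltW vu] := leP u v; first exact: H.
  by rewrite distrC [leRHS]distrC; exact: H.
rewrite distrC [leRHS]distrC (ger0_norm (_ : 0 <= v - u)) ?subr_ge0//.
rewrite /clamp /Num.max /Num.min.
case: (ltP 1 u) => h1; case: (ltP 1 v) => h2; do ?case: ifP => //; move=> *;
  rewrite ger0_norm; lra.
Qed.

Lemma holder_measurable (g : R -> R) C th : 0 <= C -> 0 < th ->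
  (forall u v, `|g u - g v| <= C * `|u - v| `^ th) -> measurable_fun setT g.
Proof.
move=> C0 th0 hg; apply: continuous_measurable_fun => u.
apply/cvgrPdist_le => e e0.
have C1 : 0 < C + 1 by lra.
pose d := (e / (C + 1)) `^ (th^-1).
have d0 : 0 < d by rewrite powR_gt0// divr_gt0.
near=> v.
have uv : `|u - v| <= d by near: v; apply: cvgr_dist_le => //; exact: cvg_id.
rewrite (le_trans (hg u v))//.
apply: (@le_trans _ _ (C * d `^ th)).
  by rewrite ler_wpM2l//; apply: ge0_ler_powR; rewrite ?nnegrE ?(ltW th0) ?(ltW d0).
rewrite /d -powRrM mulVf ?gt_eqF// powRr1; last by rewrite divr_ge0// ltW.
by rewrite mulrCA -[leRHS]mulr1 ler_wpM2l ?(ltW e0)// ler_pdivrMr// mul1r lerDl.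
Unshelve. all: end_near. Qed.

Lemma time_cvg : (@time R) n @[n --> \oo] --> (1 : R).
Proof.
rewrite -[X in _ --> X]subr0; apply: cvgB; first exact: cvg_cst.
by apply: cvg_expr; rewrite ger0_norm ?invr_ge0// invf_lt1// ltr1n.
Qed.

(** The deterministic core: the small-ball estimate survives only as the assumption that the path
    makes a large move in each late block. *)
Theorem path_replication (M : R) (p n0 : nat) (x z : R -> R) (th C Cz rho a k : R) :
  0 < M -> 1 / 2 < th -> th <= 1 -> 0 <= C -> 0 <= Cz -> 0 < rho ->
  2 * M + 1 <= p.+1%:R * (2 * th - 1) ->
  (forall s t, s \in `[0, 1] -> t \in `[0, 1] -> `|x t - x s| <= C * `|t - s| `^ th) ->
  (forall s t, s \in `[0, 1] -> t \in `[0, 1] -> `|z t - z s| <= Cz * `|t - s| `^ rho) ->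
  (forall n, (n0 <= n)%N -> exists2 t, time n <= t <= time n.+1 &
    (2^-1 ^+ n.+1) `^ M < `|x t - x (time n)|) ->
  0 < a -> a < 1 / 2 -> 1 - a < th -> a < k -> k <= th ->
  0 < rho - M + 1 - a -> 0 < rho - M * (1 + k / th) + 1 + k - a ->
  [/\ fnorm_finite a 0 1 (strategy M p x z),
      gls_integrable a 0 1 (strategy M p x z) x &
      gls_integral a 0 1 (strategy M p x z) x = (z 1)%:C].
Proof.
move=> M0 th1 th2 C0 Cz0 rho0 hp hx hz hit a0 a12 ath1 ak kth kap1 kap2.
have a1 : a < 1 by lra.
have ath : a < th by lra.
have th0 : 0 < th by lra.
pose g u := x (clamp u).
have hg u v : `|g u - g v| <= C * `|u - v| `^ th.
  rewrite (le_trans (hx _ _ (clamp01 v) (clamp01 u)))// ler_wpM2l//.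
  by apply: ge0_ler_powR; rewrite ?nnegrE ?(ltW th0)// clamp_le.
have gx : {in `[0, 1], g =1 x} by move=> u u01; rewrite /g clampE.
have mg : measurable_fun setT g := holder_measurable C0 th0 hg.
pose f_ n := strategy_block M p x z n.
have mf_ n : measurable_fun setT (f_ n) by exact: measurable_block.
have mS : measurable_fun setT (strategy M p x z) by exact: measurable_strategy.
have nf_ n : (fnorm a 0 1 (f_ n) < +oo)%E.
  apply: fnorm_block_lty => //; [exact: time_ge0|exact: ltW (mesh_gt0 _ _)|].
  by rewrite -/(grid p n _) grid_size; exact: time_lt1.
have [N [K [K0 hN]]] := gap_bound M0 th1 th2 C0 Cz0 hp hx hz hit.
have [K' [q [K'0 q0 q1 hq]]] :=
  strategy_block_geometric p z th1 th2 C0 a0 a1 ak kth kap1 kap2 hx K0.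
(* The first N blocks have finite norm but no decay estimate; dividing their norms by q^n fits them
   under a common geometric bound. *)
pose K2 := K' + \sum_(n < N) fine (fnorm a 0 1 (f_ n)) / q ^+ n.
have t0 n : 0 <= fine (fnorm a 0 1 (f_ n)) / q ^+ n.
  by rewrite divr_ge0 ?fine_ge0 ?fnorm_ge0// exprn_ge0// ltW.
have K20 : 0 <= K2 by rewrite addr_ge0// sumr_ge0.
have geo n : (fnorm a 0 1 (f_ n) <= (K2 * q ^+ n)%:E)%E.
  have [Nn|nN] := leqP N n.
    have [h1 h2] := hN n Nn; apply: (le_trans (hq n h1 h2)).
    by rewrite lee_fin ler_wpM2r ?exprn_ge0 ?(ltW q0)// lerDl sumr_ge0.
  have fin : fnorm a 0 1 (f_ n) \is a fin_num by rewrite ge0_fin_numE; [exact: nf_|exact: fnorm_ge0].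
  rewrite -[leLHS](fineK fin).
  rewrite lee_fin -ler_pdivrMr ?exprn_gt0// (le_trans _ (_ : \sum_(n < N) fine (fnorm a 0 1 (f_ n)) / q ^+ n <= _))//.
    by rewrite (bigD1 (Ordinal nN))//= lerDl sumr_ge0.
  by rewrite lerDr.
have reE n : gls_re a g (f_ n) = - (coef M p x z n * gain M p x n).
  rewrite /f_ /strategy_block (gls_re_block a0 a1 ath ath1 C0 mg hg).
  - congr (- _); rewrite /gain mulr_sumr; apply: eq_bigr => i _.
    rewrite -/(grid p n _) -/(grid p n _) !gx ?grid01// ?(ltnW (ltn_ord i))//.
    by rewrite /dev; ring.
  - exact: time_ge0.
  - exact: ltW (mesh_gt0 _ _).
  - by rewrite -/(grid p n _) grid_size; exact: time_lt1.
have sumE n : \sum_(i < n) gls_re a g (f_ i) = - wealth M p x z n.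
  by rewrite wealth_sum -sumrN; apply: eq_bigr => i _; rewrite reE.
have gap0 : gap M p x z n @[n --> \oo] --> 0.
  apply/cvgr0Pnorm_le => e e0.
  have qr : (2 `^ (- rho) : R) ^+ n @[n --> \oo] --> (0 : R).
    apply: cvg_expr; rewrite ger0_norm ?powR_ge0//.
    have h12 : (1 : R) `^ rho < 2 `^ rho by apply: gt0_ltr_powR; rewrite ?nnegrE// ltr1n.
    by rewrite powR1 in h12; rewrite powRN invf_lt1 ?powR_gt0.
  have : K * (2 `^ (- rho)) ^+ n @[n --> \oo] --> (K * 0) by exact: cvgMl_tmp.
  rewrite mulr0 => /cvgr0_norm_le/(_ _ e0)[N' _ hN']; exists (maxn N N') => // n /=.
  rewrite geq_max => /andP[Nn N'n]; have [_ h2] := hN n Nn.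
  apply: (le_trans h2); apply: le_trans (hN' n N'n); apply: le_trans (ler_norm _).
  by rewrite -powR_mulrn ?powR_ge0// -powRrM (_ : - rho * n%:R = - (n%:R * rho))//; ring.
have z1 : z (time n) @[n --> \oo] --> z 1.
  apply/cvgrPdist_le => e e0.
  have Cz1 : 0 < Cz + 1 by lra.
  pose d := (e / (Cz + 1)) `^ (rho^-1).
  have d0 : 0 < d by rewrite powR_gt0// divr_gt0.
  have := time_cvg => /cvgrPdist_le/(_ _ d0); apply: filterS => n hn.
  have one01 : (1 : R) \in `[0, 1] by rewrite in_itv/= ler01 lexx.
  rewrite (le_trans (hz _ _ (time01 n) one01))//.
  apply: (@le_trans _ _ (Cz * d `^ rho)).
    by rewrite ler_wpM2l//; apply: ge0_ler_powR; rewrite ?nnegrE ?(ltW rho0) ?(ltW d0).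
  rewrite /d -powRrM mulVf ?gt_eqF// powRr1; last by rewrite divr_ge0// ltW.
  by rewrite mulrCA -[leRHS]mulr1 ler_wpM2l ?(ltW e0)// ler_pdivrMr// mul1r lerDl.
have hl : \sum_(i < n) gls_re a g (f_ i) @[n --> \oo] --> - z 1.
  under eq_fun do rewrite sumE.
  have -> : (fun n => - wealth M p x z n) = (fun n => gap M p x z n - z (time n)).
    by apply/funext => n; rewrite /gap; ring.
  by have := cvgB gap0 z1; rewrite sub0r; apply.
have hS u : 0 <= u -> u < 1 -> exists N, forall n, (N <= n)%N -> strategy M p x z u = \sum_(i < n) f_ i u.
  by move=> _; exact: strategyE.
have [nS reS] := gls_re_series a0 a1 ath1 C0 mg hg mS mf_ hS K20 (ltW q0) q1 geo hl.
have [iS IS] := gls_of_fnorm a0 a1 ath1 C0 mg hg mS nS.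
have xg : {in `[0, 1], x =1 g} by move=> u u01; rewrite gx.
have [iX IX] := gls_eq xg iS.
split; [by split; [exact: measurable_funTS|exact: nS]|exact: iX|].
by rewrite IX IS reS opprK.
Qed.

End PathReplication.

(** * Adaptedness and small balls *)

Section Adaptedness.
Context {R : realType} {d : measure_display} {T : measurableType d}.
Context (F : R -> set (set T)) (M : R) (p : nat) (X Z : R -> T -> R).
Hypothesis F_sigma : forall t : R, t \in `[0, 1] -> sigma_algebra [set: T] (F t).
Hypothesis F_mono : forall s t : R, 0 <= s -> s <= t -> t <= 1 -> F s `<=` F t.
Hypotheses (hX : adapted F X) (hZ : adapted F Z).

Section FixedTime.
Variables (t : R) (t01 : t \in `[0, 1]).
(** Turns [F t] into a measurable space of its own, so that the closure properties of measurable
    functions apply to it directly. *)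
Notation W := (g_sigma_algebraType (F t)).
Notation observable f := (measurable_fun [set: W] (f : W -> _)).

Lemma adapted_observable (Y : R -> T -> R) s : adapted F Y -> 0 <= s -> s <= t ->
  observable (Y s).
Proof.
move=> hY s0 st _ B mB; rewrite setTI; apply: sub_sigma_algebra.
have t1 : t <= 1 by move: t01; rewrite in_itv/= => /andP[].
apply: (F_mono s0 st t1); apply: hY => //.
by rewrite in_itv/= s0 (le_trans st).
Qed.

Lemma dev_observable n i : grid p n i <= t -> observable (fun w => dev p (X ^~ w) n i).
Proof.
move=> it; apply: measurable_funB; apply: adapted_observable => //.
- exact: le_trans (time_ge0 n) (grid_ge p n i).
- exact: time_ge0.
- exact: le_trans (grid_ge p n i) it.
Qed.

Lemma position_observable n i : grid p n i <= t ->
  observable (fun w => position M p (X ^~ w) n i).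
Proof.
move=> it; apply: measurable_fun_ifT.
- have : {in iota 0 i.+1, forall j, observable (fun w => dev p (X ^~ w) n j)}.
    move=> j; rewrite mem_iota add0n ltnS => /andP[_ ji]; apply: dev_observable.
    exact: le_trans (grid_mono p n ji) it.
  rewrite /active; elim: (iota 0 i.+1) => [_|j s IH h]/=; first exact: measurable_cst.
  apply: measurable_and; last by apply: IH => k ks; apply: h; rewrite in_cons ks orbT.
  apply: measurable_fun_ltr; last exact: measurable_cst.
  by apply: measurableT_comp; [exact: normr_measurable|apply: h; exact: mem_head].
- exact: dev_observable.
- exact: measurable_cst.
Qed.

Lemma gain_observable n : time n.+1 <= t -> observable (fun w => gain M p (X ^~ w) n).
Proof.
move=> nt; apply: measurable_sum => i.
have h j : (j <= mesh_size p n)%N -> grid p n j <= t.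
  by move=> jm; exact: le_trans (grid_le jm) nt.
apply: measurable_funM; first by apply: position_observable; apply: h; exact: ltnW.
by apply: measurable_funB; apply: dev_observable; apply: h => //; exact: ltnW.
Qed.

Lemma wealth_observable n : time n <= t ->
  observable (fun w => wealth M p (X ^~ w) (Z ^~ w) n).
Proof.
elim: n => [|n IH] nt /=; first exact: measurable_cst.
have nt' : time n <= t by apply: le_trans nt; rewrite timeS lerDl ltW// half_gt0.
apply: measurable_funD; first exact: IH.
apply: measurable_funM; last exact: gain_observable.
apply: measurable_funM; last exact: measurable_cst.
apply: measurable_funM; first exact: measurable_cst.
apply: measurable_funB; last exact: IH.
by apply: adapted_observable => //; exact: time_ge0.
Qed.

Lemma strategy_observable : observable (fun w => strategy M p (X ^~ w) (Z ^~ w) t).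
Proof.
rewrite /strategy; case: (t < 1); last exact: measurable_cst.
apply: measurable_sum => n; rewrite /strategy_block /block; apply: measurable_sum => i.
rewrite -/(grid p n i) -/(grid p n i.+1).
(* A cell that starts at or after t contributes 0 at t, whatever its coefficient; every other cell
   involves only times up to t. *)
have [it|ti] := ltP (grid p n i) t; last first.
  rewrite (_ : (fun w => _) = cst 0); first exact: measurable_cst.
  apply/funext => w; rewrite /step !ltNge ti (le_trans ti (grid_mono p n (leqnSn i)))/=.
  by rewrite subrr mulr0.
have nt : time n <= t by exact: le_trans (grid_ge p n i) (ltW it).
apply: measurable_funM; last exact: measurable_cst.
apply: measurable_funM; last by apply: position_observable; exact: ltW.
apply: measurable_funM; last exact: measurable_cst.
apply: measurable_funM; first exact: measurable_cst.
apply: measurable_funB; last exact: wealth_observable.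
by apply: adapted_observable => //; exact: time_ge0.
Qed.

End FixedTime.

Lemma adapted_strategy : adapted F (fun t w => strategy M p (X ^~ w) (Z ^~ w) t).
Proof.
move=> t t01 B mB.
have := strategy_observable t01 measurableT mB.
by rewrite setTI /measurable/= (sigma_algebra_id (F_sigma t01)).
Qed.

End Adaptedness.

(** * Oscillation of Hoelder paths *)

Section SmallBall.
Context {R : realType}.

Lemma powR_le_eventually (C e : R) (r : R) : 0 < r -> 0 < e ->
  \forall n \near \oo, C * (n.+1%:R^-1) `^ r <= e.
Proof.
move=> r0 e0; have C1 : 0 < `|C| + 1 by rewrite ltr_wpDl.
have [N hN] : exists N : nat, ((`|C| + 1) / e) `^ r^-1 < N%:R.
  by exists (Num.truncn (((`|C| + 1) / e) `^ r^-1)).+1; exact: truncnS_gt.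
exists N => // n /= Nn.
have n0 : 0 < n.+1%:R :> R by rewrite ltr0n.
rewrite -powR_inv1 ?(ltW n0)// -powRrM mulN1r powRN -[leRHS]mulr1 ler_pdivrMr ?powR_gt0// -mulrA mul1r.
rewrite mulrC -ler_pdivrMr//.
have h : (`|C| + 1) / e <= n.+1%:R `^ r.
  have -> : (`|C| + 1) / e = (((`|C| + 1) / e) `^ r^-1) `^ r.
    by rewrite -powRrM mulVf ?lt0r_neq0// powRr1// ltW// divr_gt0.
  apply: ge0_ler_powR; rewrite ?nnegrE ?powR_ge0 ?(ltW r0) ?(ltW n0)//.
  by rewrite (le_trans (ltW hN))// ler_nat ltnW.
by rewrite (le_trans _ h)// ler_pM2r ?invr_gt0// (le_trans (ler_norm _))// lerDl.
Qed.

Lemma sup_increment_le (s D e : R) (x : R -> R) :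
  (sup_increment s D x <= e%:E)%E <-> forall t, s <= t <= s + D -> `|x t - x s| <= e.
Proof.
split=> [h t st|h].
  rewrite -lee_fin; apply: le_trans h; apply: ereal_sup_ubound.
  by exists t => //=; rewrite in_itv.
by apply: ub_ereal_sup => _ [t /= st <-]; rewrite lee_fin h//; move: st; rewrite in_itv.
Qed.

(** Chaining through n equal parts bounds the increment by C n^(1-th), which tends to 0. *)
Lemma holder_gt1 (th : R) (x : R -> R) t : 1 < th -> holder th 0 1 x -> 0 <= t <= 1 -> x t = x 0.
Proof.
move=> th1 [C hC] /andP[t0 t1]; apply/eqP; rewrite -subr_eq0 -normr_le0.
apply/ler_addgt0Pr => e e0; rewrite add0r.
have r0 : 0 < th - 1 by lra.
have [N _ hN] := powR_le_eventually `|C| r0 e0.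
have := hN N (leqnn N); apply: le_trans.
pose y i := x (t * (i%:R / N.+1%:R)).
have n0 : 0 < N.+1%:R :> R by rewrite ltr0n.
have -> : x t - x 0 = \sum_(i < N.+1) (y i.+1 - y i).
  have := telescope_sumr y (leq0n N.+1); rewrite big_mkord => ->.
  by rewrite /y divff ?gt_eqF// mul0r mulr0 mulr1.
apply: (le_trans (ler_norm_sum _ _ _)).
have hi i : (i <= N.+1)%N -> t * (i%:R / N.+1%:R) \in `[0, 1].
  move=> iN; rewrite in_itv/= mulr_ge0 ?divr_ge0 ?(ltW n0)//= mulr_ile1 ?divr_ge0 ?(ltW n0)//.
  by rewrite ler_pdivrMr// mul1r ler_nat.
have step_le (i : 'I_N.+1) : `|y i.+1 - y i| <= `|C| * N.+1%:R^-1 `^ th.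
  rewrite (le_trans (hC _ _ (hi _ (ltnW (ltn_ord i))) (hi _ (ltn_ord i))))//.
  apply: (@le_trans _ _ (`|C| * `|t * (i.+1%:R / N.+1%:R) - t * (i%:R / N.+1%:R)| `^ th)).
    by rewrite ler_wpM2r ?powR_ge0// ler_norm.
  rewrite ler_wpM2l// -mulrBr -mulrBl -natr1 addrAC subrr add0r mul1r.
  apply: ge0_ler_powR; rewrite ?nnegrE ?invr_ge0 ?(ltW n0)//; first by lra.
  rewrite ger0_norm ?mulr_ge0 ?invr_ge0 ?(ltW n0)//.
  by rewrite ger_pMl ?invr_gt0.
apply: (le_trans (ler_sum _ (fun i _ => step_le i))).
rewrite -mulr_sumr ler_wpM2l// sumr_const card_ord -[leLHS]mulr_natr.
rewrite -[X in _ * X <= _]invrK -(@powR_inv1 _ N.+1%:R^-1) ?invr_ge0 ?(ltW n0)//.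
by rewrite -powRD// invr_eq0 (gt_eqF n0) implybT.
Qed.

(** The deterministic counterpart to the small-ball estimate at time 0: on [0, D] a path moves by at
    most C D^th, below D^M for small D when M < th. For th > 1 the path is constant. *)
Lemma holder_oscillation (th M : R) (x : R -> R) : holder th 0 1 x -> 0 <= M ->
  M < th \/ 1 < th ->
  \forall n \near \oo, (sup_increment 0 (2^-1 ^+ n.+1) x <= ((2^-1 ^+ n.+1) `^ M)%:E)%E.
Proof.
move=> hx M0 [Mth|th1]; last first.
  apply: nearW => n; apply/sup_increment_le => t; rewrite add0r => /andP[t0 tn].
  by rewrite (holder_gt1 th1 hx) ?t0 ?(le_trans tn (half_le1 _))// subrr normr0 powR_ge0.
have [C hC] := hx.
have r0 : 0 < th - M by rewrite subr_gt0.
have [N _ hN] := powR_le_eventually `|C| r0 ltr01.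
exists N => // n /= /hN {}hN; apply/sup_increment_le => t; rewrite add0r => /andP[t0 tn].
set D := 2^-1 ^+ n.+1 in tn *.
have D0 : 0 < D by exact: half_gt0.
have h0 : (0 : R) \in `[0, 1] by rewrite in_itv/= lexx ler01.
have ht : t \in `[0, 1] by rewrite in_itv/= t0 (le_trans tn (half_le1 _)).
apply: (le_trans (hC _ _ h0 ht)); rewrite subr0 (ger0_norm t0).
apply: (@le_trans _ _ (`|C| * D `^ th)).
  apply: (@le_trans _ _ (`|C| * t `^ th)); first by rewrite ler_wpM2r ?powR_ge0 ?ler_norm.
  rewrite ler_wpM2l//; apply: ge0_ler_powR; rewrite ?nnegrE ?(ltW D0)//; lra.
have -> : th = (th - M) + M by ring.
rewrite powRD ?(gt_eqF D0) ?implybT// mulrA ger_pMl ?powR_gt0//.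
apply: le_trans hN; rewrite ler_wpM2l//.
apply: ge0_ler_powR; rewrite ?nnegrE ?invr_ge0 ?ler0n ?(ltW D0) ?(ltW r0)//.
rewrite /D exprVn lef_pV2 ?posrE ?exprn_gt0 ?ltr0n// -natrX ler_nat.
by rewrite ltnW// ltn_expl.
Qed.

End SmallBall.

(** * Small-ball events and Borel-Cantelli *)

Section SmallBallProbability.
Context {R : realType} {d : measure_display} {T : measurableType d} (P : probability T R).
Context (X : R -> T -> R) (theta : R).
Hypothesis complete : forall N : set T, P.-negligible N -> measurable N.
Hypothesis mX : forall t : R, t \in `[0, 1] -> measurable_fun setT (X t).
Hypothesis theta0 : 0 < theta.
Hypothesis hH : {ae P, forall w, holder theta 0 1 (X ^~ w)}.

Lemma measurable_ae_eq (A B : set T) : measurable B ->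
  {ae P, forall w, A w <-> B w} -> measurable A.
Proof.
move=> mB [N [mN N0 hN]].
have AB w : ~ N w -> (A w <-> B w).
  by move=> Nw; apply: contrapT => h; apply: Nw; exact: hN.
have -> : A = (B `\` N) `|` (A `&` N).
  apply/seteqP; split=> [w Aw|w [[Bw Nw]|[]//]].
    by have [Nw|Nw] := pselect (N w); [right|left; split=> //; apply/AB].
  exact/AB.
apply: measurableU; first exact: measurableD.
by apply: complete; exists N; split=> // w [].
Qed.

(** Every t lies within 1/n of a point of the n-th equal subdivision, so by continuity these
    countably many points determine the supremum. *)
Lemma holder_increment_le (x : R -> R) (s D e : R) : 0 <= s -> 0 < D -> s + D <= 1 ->
  holder theta 0 1 x ->
  (forall n k : nat, (k <= n.+1)%N -> `|x (s + D * (k%:R / n.+1%:R)) - x s| <= e) ->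
  (sup_increment s D x <= e%:E)%E.
Proof.
move=> s0 D0 sD [C hC] h; apply/sup_increment_le => t /andP[st tsD].
apply/ler_addgt0Pr => r r0.
have [n _ hn] := powR_le_eventually `|C| theta0 r0.
have {}hn := hn n (leqnn n).
have n0 : 0 < n.+1%:R :> R by rewrite ltr0n.
pose u := (t - s) / D * n.+1%:R.
have u0 : 0 <= u by rewrite mulr_ge0 ?divr_ge0 ?(ltW D0) ?(ltW n0)// subr_ge0.
have un : u <= n.+1%:R by rewrite ger_pMl// ler_pdivrMr// mul1r; lra.
pose k := Num.truncn u.
have [ku uk] : k%:R <= u /\ u < k.+1%:R by have /andP := truncn_itv u0.
have kn : (k <= n.+1)%N by rewrite -(ler_nat R) (le_trans ku).
pose q := s + D * (k%:R / n.+1%:R).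
have tE : t = s + D * (u / n.+1%:R) by rewrite /u; field; rewrite !gt_eqF.
have tq : `|t - q| <= n.+1%:R^-1.
  have -> : t - q = D * ((u - k%:R) / n.+1%:R) by rewrite tE /q; ring.
  rewrite ger0_norm; last by rewrite mulr_ge0 ?divr_ge0 ?(ltW D0) ?(ltW n0)// subr_ge0.
  apply: (@le_trans _ _ ((u - k%:R) / n.+1%:R)); first by rewrite ler_piMl ?divr_ge0 ?(ltW n0) ?subr_ge0//; lra.
  rewrite ler_pdivrMr// mulVf ?gt_eqF//; move: uk; rewrite -natr1; lra.
have q01 : q \in `[0, 1].
  rewrite in_itv/= /q addr_ge0//= ?mulr_ge0 ?divr_ge0 ?(ltW D0) ?(ltW n0)//.
  apply: le_trans sD; rewrite lerD2l ger_pMr// ler_pdivrMr// mul1r ler_nat//.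
have t01 : t \in `[0, 1] by rewrite in_itv/=; lra.
have -> : x t - x s = (x q - x s) + (x t - x q) by ring.
rewrite (le_trans (ler_normD _ _))// lerD ?h//.
rewrite (le_trans (hC _ _ q01 t01))//; apply: le_trans hn.
apply: (@le_trans _ _ (`|C| * `|t - q| `^ theta)); first by rewrite ler_wpM2r ?powR_ge0 ?ler_norm.
by rewrite ler_wpM2l//; apply: ge0_ler_powR; rewrite ?nnegrE ?(ltW theta0) ?invr_ge0 ?(ltW n0).
Qed.

(** An uncountable supremum: on Hoelder paths the event agrees with a countable intersection, and
    completeness removes the exceptional null set. Continuity from above in Borel-Cantelli then has
    genuine events to work with. *)
Lemma measurable_small_ball (s D e : R) : 0 <= s -> 0 < D -> s + D <= 1 ->
  measurable [set w | (sup_increment s D (X ^~ w) <= e%:E)%E].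
Proof.
move=> s0 D0 sD.
pose B := \bigcap_(n in [set: nat]) \bigcap_(k in [set k | (k <= n.+1)%N])
  [set w | `|X (s + D * (k%:R / n.+1%:R)) w - X s w| <= e].
have q01 n k : (k <= n.+1)%N -> 0 <= D * (k%:R / n.+1%:R) /\ D * (k%:R / n.+1%:R) <= D.
  move=> kn; split; first by rewrite mulr_ge0 ?divr_ge0 ?ler0n ?(ltW D0).
  by rewrite ger_pMr// ler_pdivrMr ?ltr0n// mul1r ler_nat.
apply: (@measurable_ae_eq _ B).
  apply: bigcapT_measurable => n; apply: bigcap_measurable; first by exists 0%N.
  move=> k /= kn; have [q0 q1] := q01 n k kn.
  rewrite -[X in measurable X]setTI; apply: measurable_fun_le => //.
  apply: measurableT_comp; first exact: normr_measurable.
  apply: measurable_funB; apply: mX; rewrite in_itv/=; last by lra.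
  by move: (D * _) q0 q1 => q q0 q1; apply/andP; split; lra.
apply: filterS hH => w hw; split.
  move=> h n _ k /= kn; have [q0 q1] := q01 n k kn.
  by move/sup_increment_le: h; apply; move: (D * _) q0 q1 => q q0 q1; apply/andP; split; lra.
by move=> h; apply: (holder_increment_le s0 D0 sD hw) => n k kn; exact: (h n I k kn).
Qed.

Context (lambda mu K1 K2 : R).
Hypotheses (lambda0 : 0 < lambda) (K10 : 0 < K1) (K20 : 0 < K2).
Hypothesis hS : forall eps Delta s : R, 0 < eps -> 0 < Delta -> Delta <= 1 ->
  0 <= s -> s <= 1 - Delta ->
  (P [set w | (sup_increment s Delta (X ^~ w) <= eps%:E)%E] <=
   (K1 * expR (- K2 * eps `^ (- lambda) * Delta `^ mu))%:E)%E.

(** For Delta = 2^-(n+1) and eps = Delta^M, the quantity in the exponential is K2 times Delta^(mu -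
    M lambda), which grows geometrically as M > mu/lambda. The starting points are left free: both
    the block ends and the constant 0 are used. *)
Lemma eventually_large_increment (s : nat -> R) (M : R) : mu / lambda < M ->
  (forall n, 0 <= s n) -> (forall n, s n + 2^-1 ^+ n.+1 <= 1) ->
  {ae P, forall w, \forall n \near \oo,
    ~ (sup_increment (s n) (2^-1 ^+ n.+1) (X ^~ w) <= ((2^-1 ^+ n.+1) `^ M)%:E)%E}.
Proof.
move=> hM s0 s1.
pose A n := [set w | (sup_increment (s n) (2^-1 ^+ n.+1) (X ^~ w) <= ((2^-1 ^+ n.+1) `^ M)%:E)%E].
have mA n : measurable (A n) by apply: measurable_small_ball; rewrite ?half_gt0.
pose r := M * lambda - mu.
have r0 : 0 < r by rewrite subr_gt0 -ltr_pdivrMr.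
pose q : R := 2 `^ (- r).
have q0 : 0 < q by rewrite powR_gt0.
have q1 : q < 1.
  have h : (1 : R) `^ r < 2 `^ r by apply: gt0_ltr_powR; rewrite ?nnegrE// ltr1n.
  by rewrite powR1 in h; rewrite /q powRN invf_lt1 ?powR_gt0.
have PA n : (P (A n) <= (K1 / K2 * q ^+ n)%:E)%E.
  have D0 := @half_gt0 R n.+1; have D1 := @half_le1 R n.+1.
  have sD : s n <= 1 - 2^-1 ^+ n.+1 by have := s1 n; lra.
  apply: (le_trans (hS (powR_gt0 M D0) D0 D1 (s0 n) sD)).
  rewrite lee_fin -[leRHS]mulrA ler_wpM2l ?(ltW K10)// -mulrA.
  set y := _ `^ (- lambda) * _.
  have yE : y = (q ^+ n.+1)^-1.
    rewrite /y -powRrM -powRD ?(gt_eqF D0) ?implybT// halfE -powRrM /q -powR_mulrn ?powR_ge0//.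
    by rewrite -powRrM -powRN; congr (_ `^ _); rewrite /r; ring.
  have y0 : 0 < y by rewrite yE invr_gt0 exprn_gt0.
  (* The crude bound exp(-v) <= 1/v already yields a summable geometric sequence. *)
  apply: (@le_trans _ _ (K2 * y)^-1).
    rewrite mulNr expRN lef_pV2 ?posrE ?expR_gt0 ?mulr_gt0//.
    by rewrite (le_trans _ (expR_ge1Dx _))// lerDr.
  rewrite invfM yE invrK ler_wpM2l ?invr_ge0 ?(ltW K20)//.
  by rewrite exprS ger_pMl ?exprn_gt0// ltW.
have sumA : (\sum_(n <oo) P (A n) < +oo)%E.
  apply: (@le_lt_trans _ _ (K1 / K2 / (1 - q))%:E); last exact: ltry.
  apply: lime_le; first by apply: is_cvg_nneseries.
  apply: nearW => N; apply: (@le_trans _ _ (\sum_(0 <= n < N) (K1 / K2 * q ^+ n)%:E)%E).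
    by apply: lee_sum => n _; exact: PA.
  rewrite big_mkord sumEFin lee_fin geometric_partial_le//; last exact: ltW.
  by rewrite divr_ge0 ?(ltW K10) ?(ltW K20).
exists (lim_sup_set A); split.
- by apply: bigcapT_measurable => n; apply: bigcup_measurable => k _; exact: mA.
- exact: lim_sup_set_cvg0 mA sumA.
- move=> w hw n _; apply: contrapT => hn; apply: hw; exists n => // k /= nk hk.
  by apply: hn; exists k.
Qed.

Lemma holder_exponent_bounds : 0 <= mu -> theta <= 1 /\ theta <= mu / lambda.
Proof.
move=> mu0.
(* If theta exceeds mu/lambda, an M strictly between them makes the eventual small and large
   oscillations at time 0 both almost sure; if theta > 1, any M above mu/lambda does. They
   contradict each other, and the whole space is not null. *)
suff key M : mu / lambda < M -> ~ (M < theta \/ 1 < theta).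
  split; rewrite leNgt; apply/negP => h.
    by apply: (key (mu / lambda + 1)); [rewrite ltrDl|right].
  by apply: (key ((mu / lambda + theta) / 2)); [|left]; lra.
move=> hM h; have M0 : 0 <= M by rewrite (le_trans _ (ltW hM))// divr_ge0// (ltW lambda0).
have s1 n : 0 + 2^-1 ^+ n.+1 <= 1 :> R by rewrite add0r half_le1.
have ae := @eventually_large_increment (fun=> 0) M hM (fun=> lexx _) s1.
have : {ae P, forall w, False}.
  apply: filterS2 ae hH => w h1 h2.
  have h3 := holder_oscillation h2 M0 h.
  by have [n [h4 h5]] := filter_ex (filterI h1 h3); exact: h4 h5.
move=> [N [mN N0 hN]].
have NT : N = setT by apply/seteqP; split=> // w _; apply: hN.
by move: N0; rewrite NT probability_setT => /eqP; rewrite onee_eq0.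
Qed.

End SmallBallProbability.

(** * Choice of the exponents *)

Section ReplicationExponents.
Context {R : realType}.

(** With [a], [k] and M at distance O(s) above 1 - theta, 1 - theta and nu, the last exponent is a
    perturbation of g = rho + 1 - nu/theta > 0, and the other one of rho - nu + theta, which is at
    least g. *)
Lemma replication_parameters (theta nu rho : R) : 1 / 2 < theta -> theta <= 1 ->
  theta <= nu -> nu / theta - 1 < rho ->
  exists a k M : R, exists p : nat,
  [/\ 0 < a, 1 - theta < a & a < 1 / 2] /\
  [/\ a < k, k <= theta, 0 < rho - M + 1 - a & 0 < rho - M * (1 + k / theta) + 1 + k - a] /\
  nu < M /\ 2 * M + 1 <= p.+1%:R * (2 * theta - 1).
Proof.
move=> th1 th2 nuth hrho.
have th0 : 0 < theta by lra.
pose g := rho + 1 - nu / theta.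
have g0 : 0 < g by rewrite /g; lra.
pose u := 3 + 2 * nu.
have u0 : 0 < u by rewrite /u; lra.
(* The first bound keeps [a] below 1/2 and [k] below theta; the second keeps the perturbation of the
   last exponent, at most 2 s u because 1/theta < 2, below g/2. *)
pose s := Num.min ((theta - 1 / 2) / 2) (g / (4 * u)).
have s0 : 0 < s by rewrite lt_min !divr_gt0 ?mulr_gt0//; lra.
have s1 : s <= (theta - 1 / 2) / 2 by rewrite ge_min lexx.
have s2 : 4 * (s * u) <= g.
  have : s <= g / (4 * u) by rewrite ge_min lexx orbT.
  by rewrite ler_pdivlMr ?mulr_gt0//; lra.
have ratio : 1 <= nu / theta by rewrite ler_pdivlMr// mul1r.
have gap_le : g <= rho - nu + theta.
  have : 0 <= (1 - theta) * (nu / theta - 1) by rewrite mulr_ge0// subr_ge0.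
  have -> : (1 - theta) * (nu / theta - 1) = nu / theta - 1 - nu + theta.
    by field; rewrite gt_eqF.
  by rewrite /g; lra.
have su : s * 4 <= s * u by rewrite ler_wpM2l ?(ltW s0)// /u; lra.
exists (1 - theta + s), (1 - theta + 2 * s), (nu + s).
exists (Num.truncn ((2 * (nu + s) + 1) / (2 * theta - 1))).
split; first by split; lra.
split; last first.
  split; first lra.
  rewrite -ler_pdivrMr; last by lra.
  by apply: ltW; exact: truncnS_gt.
split; [lra|lra|lra|].
have -> : rho - (nu + s) * (1 + (1 - theta + 2 * s) / theta) + 1 + (1 - theta + 2 * s) - (1 - theta + s) =
    g + s - s * (2 * nu + 1 + 2 * s) / theta.
  by rewrite /g; field; rewrite gt_eqF.
have h : s * (2 * nu + 1 + 2 * s) / theta <= 2 * (s * u).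
  rewrite ler_pdivrMr//.
  have h1 : s * (2 * nu + 1 + 2 * s) <= s * u by rewrite ler_wpM2l ?(ltW s0)// /u; lra.
  have su0 : 0 <= s * u by rewrite mulr_ge0// ltW.
  by nra.
by lra.
Qed.

End ReplicationExponents.

Theorem theorem2p1 (R : realType) (d : measure_display) (T : measurableType d)
    (P : probability T R) (F : R -> set (set T)) (X : R -> T -> R)
    (theta lambda mu K1 K2 : R) (xi : {RV P >-> R}) (Z : R -> T -> R) (rho : R)
    (hF : usual_conditions P F)
    (hX : adapted F X)
    (htheta : 1 / 2 < theta)
    (hH : {ae P, forall w, holder theta 0 1 (X ^~ w)})
    (hlambda : 0 < lambda) (hmu : 0 < mu) (hK1 : 0 < K1) (hK2 : 0 < K2)
    (hS : forall eps Delta s : R, 0 < eps -> 0 < Delta -> Delta <= 1 ->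
       0 <= s -> s <= 1 - Delta ->
       (P [set w | sup_increment s Delta (X ^~ w) <= eps%:E] <=
        (K1 * expR (- K2 * eps `^ (- lambda) * Delta `^ mu))%:E)%E)
    (hZ : adapted F Z)
    (hZrho : {ae P, forall w, holder rho 0 1 (Z ^~ w)})
    (hrho : mu / (lambda * theta) - 1 < rho)
    (hxi : {ae P, forall w, xi w = Z 1 w}) :
  exists psi : R -> T -> R,
    adapted F psi /\
    exists alpha : R,
      [/\ 1 - theta < alpha, alpha < 1 / 2,
          {ae P, forall w, fnorm_finite alpha 0 1 (psi ^~ w)} &
          {ae P, forall w, gls_integrable alpha 0 1 (psi ^~ w) (X ^~ w) /\
             gls_integral alpha 0 1 (psi ^~ w) (X ^~ w) = (xi w)%:C}].
Proof.
have [F_sigma F_mono _ F_null] := hF.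
have zero01 : (0 : R) \in `[0, 1] by rewrite in_itv/= lexx ler01.
have complete N : P.-negligible N -> measurable N.
  by move=> /F_null; apply: (F_sigma 0 zero01).2.
have mX t : t \in `[0, 1] -> measurable_fun setT (X t).
  by move=> t01 _ B mB; rewrite setTI; apply: (F_sigma t t01).2; exact: hX.
have theta0 : 0 < theta by lra.
have [theta1 theta_nu] :=
  holder_exponent_bounds complete mX theta0 hH hlambda hK1 hK2 hS (ltW hmu).
have nuE : mu / lambda / theta - 1 < rho.
  suff -> : mu / lambda / theta = mu / (lambda * theta) by [].
  by rewrite invfM mulrA.
have [a [k [M [p [[a0 a1 a2] [[ak kth kap1 kap2] [hM hp]]]]]]] :=
  replication_parameters htheta theta1 theta_nu nuE.
(* Positivity of [rho] is a consequence of theta <= mu/lambda, not an assumption. *)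
have rho0 : 0 < rho.
  have : 1 <= mu / lambda / theta by rewrite ler_pdivlMr// mul1r.
  lra.
have M0 : 0 < M by lra.
(* The strategy is defined on every path, exceptional ones included, so that adaptedness is proved
   without altering it on a null set. *)
exists (fun t w => strategy M p (X ^~ w) (Z ^~ w) t).
split; first exact: (adapted_strategy M p (fun t t01 => (F_sigma t t01).1) F_mono hX hZ).
have time_le n : time n + 2^-1 ^+ n.+1 <= 1 :> R by rewrite -timeS ltW// time_lt1.
have large := eventually_large_increment complete mX theta0 hH hlambda hK1 hK2 hS hM
  (@time_ge0 R) time_le.
have replicates : {ae P, forall w,
    [/\ fnorm_finite a 0 1 (strategy M p (X ^~ w) (Z ^~ w)),
        gls_integrable a 0 1 (strategy M p (X ^~ w) (Z ^~ w)) (X ^~ w) &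
        gls_integral a 0 1 (strategy M p (X ^~ w) (Z ^~ w)) (X ^~ w) = (Z 1 w)%:C]}.
  apply: filterS3 large hH hZrho => w [n0 _ hn0] [C hC] [Cz hCz].
  (* The constants in [holder] carry no sign, whence the absolute values. *)
  apply: (@path_replication R M p n0 (X ^~ w) (Z ^~ w) theta `|C| `|Cz| rho a k) => //.
  - by move=> s t s01 t01; rewrite (le_trans (hC s t s01 t01))// ler_wpM2r ?powR_ge0 ?ler_norm.
  - by move=> s t s01 t01; rewrite (le_trans (hCz s t s01 t01))// ler_wpM2r ?powR_ge0 ?ler_norm.
  - move=> n /hn0 small; apply: contrapT => none; apply: small.
    apply/sup_increment_le => t; rewrite -timeS => ht.
    by rewrite leNgt; apply/negP => large_t; apply: none; exists t.
  - by lra.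
exists a; split => //.
  by apply: filterS replicates => w [].
by apply: filterS2 replicates hxi => w [_ h1 h2] ->; split.
Qed.
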